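(* Let $\alpha>0$, $0<p<\infty$, and $0<r<\infty$. Let $\mu$ be a positive Borel measure on $\mathbb H$ such that $\mu^1:=\mu|_{\mathbb H\setminus\mathbb R}$ is a Radon measure on $\mathbb H\setminus\mathbb R$. Then the following are equivalent: (a) $\mu$ is a vanishing quaternionic Fock--Carleson measure for $F_\alpha^p$; (b) for every $I\in\mathbb S$, $$\int_{\mathbb H}\left|k_z(w)e^{-\frac{\alpha}{2}|w|^2}\right|^p\,d\mu(w)\to0\qquad\text{as }|z|\to\infty,\ z\in\mathbb C_I;$$ (c) for every $I\in\mathbb S$, $\mu(S(z,r))\to0$ as $|z|\to\infty$, $z\in\mathbb C_I$.
   Context: $\mathbb H$ denotes the quaternions, $\mathbb S=\{I\in\mathbb H: I^2=-1\}$, $\mathbb C_I=\{x+yI:x,y\in\mathbb R\}$ for $I\in\mathbb S$, and $m_{2,I}$ is Lebesgue measure on $\mathbb C_I$. A (left) slice function is $f:\mathbb H\to\mathbb H$ of the form $f(x+yI)=f_0(x,y)+If_1(x,y)$ for all $x,y\in\mathbb R$, $I\in\mathbb S$, where $f_0,f_1:\mathbb R^2\to\mathbb H$ satisfy $f_0(x,-y)=f_0(x,y)$ and $f_1(x,-y)=-f_1(x,y)$. It is slice regular if moreover $f_0,f_1$ are $C^1$ and $\partial_xf_0-\partial_yf_1=0$, $\partial_yf_0+\partial_xf_1=0$. Every non-real quaternion is uniquely $x+yI$ with $I\in\mathbb S$, $y>0$, so $\mathbb H\setminus\mathbb R\cong\mathbb S\times\mathbb C^+$ (with $\mathbb C^+$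 the open upper half plane), and $dV(x+yI)=dm_{2,I}(x+yI)\,d\sigma(I)$, where $\sigma$ is the normalized surface measure on $\mathbb S$; the real axis has $dV$-measure $0$. Put $\|f\|_{p,\alpha}^p=\frac{p\alpha}{\pi}\int_{\mathbb H}|f(z)e^{-\alpha|z|^2/2}|^p\,dV(z)$. The global quaternionic Fock space $F_\alpha^p$ is the space of slice regular $f$ on $\mathbb H$ with $\|f\|_{p,\alpha}<\infty$. A positive Borel measure $\mu$ on $\mathbb H$ is a vanishing quaternionic Fock--Carleson measure for $F_\alpha^p$ if $\lim_{n\to\infty}\int_{\mathbb H}|f_n(z)e^{-\frac{\alpha}{2}|z|^2}|^p\,d\mu(z)=0$ whenever $\{f_n\}$ is a bounded sequence in $F_\alpha^p$ with $f_n\to0$ uniformly on compact subsets of $\mathbb H$. $K_\alpha(z,w)=\sum_{n\ge0}\frac{\alpha^n}{n!}z^n\overline w^{\,n}$ is the reproducing kernel, and $k_z(w)=K_\alpha(w,z)e^{-\alpha|z|^2/2}$ is the normalized reproducing kernel. Symmetric boxes: for $z=x+yJ\in\mathbb H$ with $y\ge0$, $J\in\mathbb S$, and $r>0$, put $z_I=x+yI$ for $I\in\mathbb S$ and $S(z,r)=\bigcup_{I\in\mathbb S}B_I(z_I,r)$, where $B_I(z_I,r)$ is the Euclidean disk in $\mathbb C_I$ with center $z_I$ and radius $r$.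
   Formalization: The positive Borel measure μ is additionally assumed finite on compact subsets of ℍ; without this the claim fails, e.g. for μ = ∞·δ₀, where (c) holds but (a) and (b) do not. *)

(* Defs.v *)
From HB Require Import structures.
From mathcomp Require Import all_boot all_order all_algebra.
From mathcomp Require Import ring lra.
From mathcomp Require Import all_classical all_reals all_analysis.
From mathcomp Require Import measurable_realfun.

Set Implicit Arguments.
Unset Strict Implicit.
Unset Printing Implicit Defensive.

Import Order.TTheory GRing.Theory Num.Theory.
Import numFieldNormedType.Exports.

Local Open Scope classical_set_scope.
Local Open Scope ring_scope.

(* The topology and the Borel sigma-algebra are those of the product; the norm
   `|q| inherited from the product is the sup norm, not the Euclidean norm
   qnorm below. Products of rings also carry a componentwise multiplication in
   the library; the Hamilton product is the one declared for quat. *)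
Definition quat (R : realType) : Type := (R * (R * R * R))%type.

HB.instance Definition _ (R : realType) :=
  NormedModule.copy (quat R) (R * (R * R * R))%type.
HB.instance Definition _ (R : realType) :=
  Measurable.copy (quat R) (R * (R * R * R))%type.

Section quaternions.
Context {R : realType}.
Implicit Types p q w z : quat R.

Definition qone : quat R := (1, (0, 0, 0)).

Definition qmul p q : quat R :=
  let: (a, (b, c, d)) := p in
  let: (a', (b', c', d')) := q in
  (a * a' - b * b' - c * c' - d * d',
    (a * b' + b * a' + c * d' - d * c',
     a * c' - b * d' + c * a' + d * b',
     a * d' + b * c' - c * b' + d * a')).

Let qmulA : associative qmul.
Proof.
move=> [a [[b c] d]] [a' [[b' c'] d']] [a2 [[b2 c2] d2]].
by rewrite /qmul; congr (_, (_, _, _)); ring.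
Qed.

Let qmul1q : left_id qone qmul.
Proof.
by move=> [a [[b c] d]]; rewrite /qmul /qone; congr (_, (_, _, _)); ring.
Qed.

Let qmulq1 : right_id qone qmul.
Proof.
by move=> [a [[b c] d]]; rewrite /qmul /qone; congr (_, (_, _, _)); ring.
Qed.

Let qmulDl : left_distributive qmul +%R.
Proof.
move=> [a [[b c] d]] [a' [[b' c'] d']] [a2 [[b2 c2] d2]].
by rewrite /qmul; congr (_, (_, _, _)) => /=; ring.
Qed.

Let qmulDr : right_distributive qmul +%R.
Proof.
move=> [a [[b c] d]] [a' [[b' c'] d']] [a2 [[b2 c2] d2]].
by rewrite /qmul; congr (_, (_, _, _)) => /=; ring.
Qed.

Let qone_neq0 : qone != 0.
Proof. by apply/eqP => -[] /eqP; rewrite oner_eq0. Qed.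

HB.instance Definition _ := GRing.Zmodule_isNzRing.Build (quat R)
  qmulA qmul1q qmulq1 qmulDl qmulDr qone_neq0.

Let qscaleAl (k : R) p q : k *: qmul p q = qmul (k *: p) q.
Proof.
move: p q => [a [[b c] d]] [a' [[b' c'] d']].
by rewrite /qmul /=; congr (_, (_, _, _)); rewrite /GRing.scale /=; ring.
Qed.

HB.instance Definition _ :=
  GRing.Lmodule_isLalgebra.Build R (quat R) qscaleAl.

Let qscaleAr (k : R) p q : k *: qmul p q = qmul p (k *: q).
Proof.
move: p q => [a [[b c] d]] [a' [[b' c'] d']].
by rewrite /qmul /=; congr (_, (_, _, _)); rewrite /GRing.scale /=; ring.
Qed.

HB.instance Definition _ := GRing.Lalgebra_isAlgebra.Build R (quat R) qscaleAr.

Definition qconj q : quat R := (q.1, - q.2).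

(* Euclidean norm on R^3. *)
Definition enorm (v : R * R * R) : R :=
  Num.sqrt (v.1.1 ^+ 2 + v.1.2 ^+ 2 + v.2 ^+ 2).

Definition qnorm q : R := Num.sqrt (q.1 ^+ 2 + enorm q.2 ^+ 2).

Definition qsphere : set (quat R) := [set I | I * I = -1].

Definition qofR (x : R) : quat R := (x, (0, 0, 0)).

(* The point x + y I. *)
Definition qpt (x y : R) (I : quat R) : quat R := qofR x + y *: I.

Definition qreal : set (quat R) := range qofR.

(* The plane C_I, for I in qsphere. *)
Definition qslice (I : quat R) : set (quat R) :=
  [set z | exists x y : R, z = qpt x y I].

End quaternions.

Arguments qsphere R : clear implicits.
Arguments qreal R : clear implicits.

Section volume.
Context {R : realType}.
Local Open Scope ereal_scope.

Local Notation leb := (@lebesgue_measure R).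
Local Notation R3 :=
  (measurableTypeR R * measurableTypeR R * measurableTypeR R)%type.

Definition lebesgue3 :
    {measure set R3 -> \bar R} :=
  (leb \x leb) \x leb.

Definition ball3 : set R3 :=
  [set v | enorm v <= 1]%R.

Lemma measurable_enorm d (T : measurableType d) (f : T -> (R * R * R)%type) :
  measurable_fun setT f ->
  measurable_fun setT (fun t => enorm (f t)).
Proof.
move=> mf.
have m2 := measurableT_comp measurable_snd mf.
have m1 := measurableT_comp measurable_fst mf.
have m11 := measurableT_comp measurable_fst m1.
have m12 := measurableT_comp measurable_snd m1.
apply: (measurableT_comp (f := @Num.sqrt R)).
  by apply: continuous_measurable_fun; exact: sqrt_continuous.
by apply: measurable_funD; [apply: measurable_funD|]; exact: measurable_funX.
Qed.

Lemma measurable_ball3 : measurable ball3.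
Proof.
rewrite -[ball3]setTI.
apply: (measurable_fun_le (f := fun v : R3 => enorm v) (g := cst 1%R)) => //.
by apply: measurable_enorm; exact: measurable_id.
Qed.

Lemma lebesgue3_ball3_gt0 : 0 < lebesgue3 ball3.
Proof.
pose h := (`[0%R, 2^-1%R]%classic : set (measurableTypeR R)).
have mh : measurable h by exact: measurable_itv.
apply: (@lt_le_trans _ _ (lebesgue3 ((h `*` h) `*` h))).
  rewrite /lebesgue3/= product_measure1E//; last exact: measurableX.
  rewrite /= product_measure1E//= lebesgue_measure_itv/= lte_fin.
  by rewrite invr_gt0 ltr0n/= oppr0 adde0 -!EFinM lte_fin !mulr_gt0 ?invr_gt0.
apply: le_measure; rewrite ?inE; first by do 2?apply: measurableX.
  exact: measurable_ball3.
move=> [[a b] c] /= [[]]; rewrite /h/= !in_itv/=.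
move=> /andP[a0 a1] /andP[b0 b1] /andP[c0 c1].
by rewrite /ball3/= /enorm/= -(@sqrtr1 R) ler_wsqrtr//; nra.
Qed.

Lemma lebesgue3_ball3_lty : lebesgue3 ball3 < +oo.
Proof.
pose h := (`[(-1)%R, 1%R]%classic : set (measurableTypeR R)).
have mh : measurable h by exact: measurable_itv.
apply: (@le_lt_trans _ _ (lebesgue3 ((h `*` h) `*` h))); last first.
  rewrite /lebesgue3/= product_measure1E//; last exact: measurableX.
  rewrite /= product_measure1E//= lebesgue_measure_itv/= lte_fin.
  rewrite gtrN//.
  by rewrite -!EFinD -!EFinM ltry.
apply: le_measure; rewrite ?inE; first exact: measurable_ball3.
  by do 2?apply: measurableX.
move=> [[a b] c]; rewrite /ball3/= /enorm/= -[X in (_ <= X)%R -> _](@sqrtr1 R).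
rewrite ler_psqrt ?nnegrE ?ler01 ?addr_ge0 ?sqr_ge0// => abc.
rewrite /h/= !in_itv/=.
have := (sqr_ge0 a, sqr_ge0 b, sqr_ge0 c); rewrite !expr2 => -[[? ?] ?].
by move: abc; rewrite !expr2 => abc; repeat split; apply/andP; split; nra.
Qed.

(* The direction v / |v| as an imaginary quaternion; it is 0 for v = 0. *)
Definition direction (v : R3) : quat R :=
  (0, (v.1.1 / enorm v, v.1.2 / enorm v, v.2 / enorm v))%R.

Lemma measurable_direction : measurable_fun setT direction.
Proof.
have mid : measurable_fun setT (fun v : R3 => v) by [].
have mV : measurable_fun setT (fun v : R3 => (enorm v)^-1%R).
  rewrite (_ : (fun _ => _) = (fun v => enorm v `^ (-1))%R); last first.
    by apply/funext => v; rewrite powR_inv1 ?sqrtr_ge0.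
  by apply: measurableT_comp (measurable_powR _) (measurable_enorm mid).
have m2 := measurableT_comp measurable_snd mid.
have m1 := measurableT_comp measurable_fst mid.
have m11 := measurableT_comp measurable_fst m1.
have m12 := measurableT_comp measurable_snd m1.
apply/measurable_fun_pair; first exact: measurable_cst.
by apply/measurable_fun_pair; [apply/measurable_fun_pair|];
  apply: measurable_funM.
Qed.

HB.instance Definition _ :=
  isMeasurableFun.Build _ _ _ _ direction measurable_direction.

(* sigma is the law of U / |U| for U uniform in the unit ball of R^3, i.e.
   sigma(A) is the relative volume of the cone {t I : 0 < t <= 1, I in A}. The
   default argument of mnormalize is irrelevant, as ball3 has positive finite
   volume. *)
Definition sphere_measure : probability (quat R) R :=
  distribution (mnormalize (mrestr lebesgue3 measurable_ball3) 
      \d_((0, 0, 0)%R : R3))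
    direction.

(* The domain S x C^+ of polar coordinates: triples (x, y, I) with y > 0. *)
Definition upper :
    set (measurableTypeR R * measurableTypeR R * quat R)%type :=
  [set t | 0 < t.1.2]%R.

Lemma measurable_upper : measurable upper.
Proof.
rewrite -[upper]setTI.
pose g (t : measurableTypeR R * measurableTypeR R * quat R) : R := t.1.2.
rewrite (_ : upper = g @^-1` `]0%R, +oo[%classic); last first.
  by apply/seteqP; split => t /=; rewrite /upper/= in_itv/= andbT.
suff mg : measurable_fun setT g by apply: mg => //; exact: measurable_itv.
exact: (measurableT_comp measurable_snd measurable_fst).
Qed.

Definition polar (t : measurableTypeR R * measurableTypeR R * quat R) : quat R :=
  qpt t.1.1 t.1.2 t.2.

Lemma measurable_polar : measurable_fun setT polar.
Proof.
have mid := @measurable_id _ (measurableTypeR R * measurableTypeR R * quat R)%type setT.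
have m2 := measurableT_comp measurable_snd mid.
have m1 := measurableT_comp measurable_fst mid.
have m11 := measurableT_comp measurable_fst m1.
have m12 := measurableT_comp measurable_snd m1.
have mre := measurableT_comp measurable_fst m2.
have mim := measurableT_comp measurable_snd m2.
have mim1 := measurableT_comp measurable_fst mim.
have mim11 := measurableT_comp measurable_fst mim1.
have mim12 := measurableT_comp measurable_snd mim1.
have mim2 := measurableT_comp measurable_snd mim.
apply/measurable_fun_pair.
  by apply: measurable_funD => //; exact: measurable_funM.
by apply/measurable_fun_pair; [apply/measurable_fun_pair|];
  apply: measurable_funD; do ?exact: measurable_funM; exact: measurable_cst.
Qed.

HB.instance Definition _ := isMeasurableFun.Build _ _ _ _ polar measurable_polar.

(* dV(x + y I) = dx dy dsigma(I) over y > 0. *)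
Definition slice_volume : set (quat R) -> \bar R :=
  pushforward (mrestr ((leb \x leb) \x sphere_measure) measurable_upper) polar.

Let slice_volume0 : slice_volume set0 = 0.
Proof. by rewrite /slice_volume /pushforward preimage_set0 measure0. Qed.

Let slice_volume_ge0 A : 0 <= slice_volume A.
Proof. exact: measure_ge0. Qed.

Let slice_volume_sigma_additive : semi_sigma_additive slice_volume.
Proof.
exact: (@measure_semi_sigma_additive _ _ _
  (pushforward (mrestr ((leb \x leb) \x sphere_measure) measurable_upper) polar)).
Qed.

HB.instance Definition _ := isMeasure.Build _ _ _ slice_volume
  slice_volume0 slice_volume_ge0 slice_volume_sigma_additive.

End volume.

Section slice_regular.
Context {R : realType}.

Definition partial_x (g : R * R -> quat R) : R * R -> quat R := 'D_(1, 0) g.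

Definition partial_y (g : R * R -> quat R) : R * R -> quat R := 'D_(0, 1) g.

Definition C1 (g : R * R -> quat R) : Prop :=
  [/\ forall t, derivable g t (1, 0), forall t, derivable g t (0, 1),
      continuous (partial_x g) & continuous (partial_y g)].

Definition slice_components (f : quat R -> quat R) (f0 f1 : R * R -> quat R) :
    Prop :=
  [/\ forall x y, f0 (x, - y) = f0 (x, y),
      forall x y, f1 (x, - y) = - f1 (x, y) &
      forall x y I, qsphere R I -> f (qpt x y I) = f0 (x, y) + I * f1 (x, y)].

Definition slice_regular (f : quat R -> quat R) : Prop :=
  exists f0 f1 : R * R -> quat R,
    [/\ slice_components f f0 f1, C1 f0, C1 f1,
        forall t, partial_x f0 t - partial_y f1 t = 0 &
        forall t, partial_y f0 t + partial_x f1 t = 0].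

End slice_regular.

Section Fock.
Context {R : realType} (alpha p : R).
Local Open Scope ereal_scope.

Definition weighted (f : quat R -> quat R) (z : quat R) : R :=
  qnorm (expR (- (alpha / 2) * qnorm z ^+ 2) *: f z)%R.

Definition Fock_norm (f : quat R -> quat R) : \bar R :=
  ((p * alpha / pi)%:E *
    \int[slice_volume]_z (weighted f z `^ p)%:E) `^ p^-1.

Definition Fock : set (quat R -> quat R) :=
  [set f | slice_regular f /\ Fock_norm f < +oo].

Definition vanishing_Fock_Carleson (mu : {measure set (quat R) -> \bar R}) :
    Prop :=
  forall f : nat -> quat R -> quat R,
    (forall n, Fock (f n)) ->
    (exists M : R, forall n, Fock_norm (f n) <= M%:E) ->
    {family compact, f @ \oo --> (cst 0%R : quat R -> quat R)} ->
    (fun n => \int[mu]_z (weighted (f n) z `^ p)%:E) @ \oo --> 0.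

End Fock.

Section kernel.
Context {R : realType} (alpha : R).

Definition Fock_kernel (z w : quat R) : quat R :=
  limn (series (fun n => (alpha ^+ n / n`!%:R) *: (z ^+ n * qconj w ^+ n))).

Definition normalized_kernel (z w : quat R) : quat R :=
  expR (- (alpha / 2) * qnorm z ^+ 2) *: Fock_kernel w z.

End kernel.

Section boxes.
Context {R : realType}.

Definition slice_disk (I c : quat R) (r : R) : set (quat R) :=
  [set w | qslice I w /\ qnorm (w - c) < r].

(* Writing z = x + y J with y >= 0 and J in the sphere, x = z.1 and
   y = enorm z.2. *)
Definition symmetric_box (z : quat R) (r : R) : set (quat R) :=
  \bigcup_(I in qsphere R) slice_disk I (qpt z.1 (enorm z.2) I) r.

(* The filter "|z| -> oo, z in C_I". *)
Definition slice_infty (I : quat R) : set_system (quat R) :=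
  filter_from setT (fun M : R => [set z | qslice I z /\ M < qnorm z]).

Lemma slice_infty_proper (I : quat R) : ProperFilter (slice_infty I).
Proof.
apply: filter_from_proper.
  apply: filter_from_filter; first by exists 0.
  move=> M N _ _; exists (Num.max M N) => // z [Iz].
  by rewrite gt_max => /andP[Mz Nz]; split; split.
move=> M _; exists (qpt (`|M| + 1) 0 I); split; first by exists (`|M| + 1), 0.
rewrite /qnorm (_ : _ + _ = (`|M| + 1) ^+ 2); last first.
  by rewrite /qpt scale0r addr0 /enorm /= !expr0n !addr0 sqrtr0 expr0n addr0.
by rewrite sqrtr_sqr ger0_norm ?addr_ge0// (le_lt_trans (ler_norm _))// ltrDl.
Qed.

End boxes.

Section measures.
Context {R : realType}.
Local Open Scope ereal_scope.

(* Borel measures on a locally compact space are understood to be finite on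
   compact sets. *)
Definition finite_on_compacts (mu : {measure set (quat R) -> \bar R}) : Prop :=
  forall K, compact K -> mu K < +oo.

(* For U open, says that the restriction of mu to the space U is a Radon measure:
   finite on compact sets, outer regular on Borel sets, inner regular on open
   sets. *)
Definition Radon_on (U : set (quat R)) (mu : {measure set (quat R) -> \bar R}) :
    Prop :=
  [/\ forall K, compact K -> K `<=` U -> mu K < +oo,
      forall A, measurable A -> A `<=` U ->
        mu A = ereal_inf [set mu V | V in [set V | [/\ open V, A `<=` V & V `<=` U]]] &
      forall V, open V -> V `<=` U ->
        mu V = ereal_sup [set mu K | K in [set K | compact K /\ K `<=` V]]].

End measures.

(* Main.v *)
(* For w = u + v I and z = x + y J with inner product s of I and J, the
   exponential series gives
     |k_z(w)|^2 e^{- alpha |w|^2} =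
       ((1 + s) e^{- alpha ((u - x)^2 + (v - y)^2)} +
        (1 - s) e^{- alpha ((u - x)^2 + (v + y)^2)}) / 2.
   So the k_z form a bounded family in the Fock space tending to 0 on compact
   sets, which gives (a) => (b); and the values for z and its conjugate add up to
   at least e^{- alpha r^2} on S(z, r), which gives (b) => (c).

   For (c) => (a), let N^2 = |f_0|^2 + |f_1|^2 and H = N e^{- alpha |.|^2 / 2}, a
   function on the plane. Up to a factor 2, H dominates |f| e^{- alpha |.|^2 / 2}
   on every slice, and is dominated by it for I in a hemisphere depending on the
   point, so that the integral of H^p over the half plane is controlled by the
   Fock norm of f. A sub-mean-value inequality bounds H^p at a point by its
   integral over a half square around it; integrating in mu and exchanging the
   order of integration bounds the integral over large |w| by the supremum of mu
   over far boxes times the p-th power of the Fock norm. The sub-mean-value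
   inequality, for all p > 0, follows from maximizing dist(z, boundary)^k H(z) on
   the square and Cauchy estimates around the maximum point. *)

Require Import Defs.
From HB Require Import structures.
From mathcomp Require Import all_boot all_order all_algebra.
From mathcomp Require Import ring lra.
From mathcomp Require Import all_classical all_reals all_analysis.
From mathcomp Require Import measurable_realfun.

Set Implicit Arguments.
Unset Strict Implicit.
Unset Printing Implicit Defensive.

Import Order.TTheory GRing.Theory Num.Theory.
Import numFieldNormedType.Exports.

Local Open Scope classical_set_scope.
Local Open Scope ring_scope.

(** On squares, a regular function depends on the slice in an affine way: |f(x + y I)|^2 = N^2 + 2
    <c, I>, with a vector c depending on (x, y) only. Adding the values at I and -I bounds |f| above
    by a multiple of N; the half sphere <c, I> >= 0 bounds it below, and half spheres have mass
    bounded below uniformly. This moves volume integrals and symmetric boxes to the plane. For large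
    y the weighted kernel at z = x + y J is small on the part of the box where I is close to -J;
    there the kernel at the conjugate takes over, whence the sum of the two. The volume lives over y
    > 0; since N is even in y, the maximum can be sought in the closed half plane and the small
    square placed above the maximum point, so that centers on the real axis behave like the others.
    Finiteness of mu on compact sets enters twice: through the sigma-finiteness that permits
    exchanging integrals, and on the remaining ball, where the f_n are uniformly small. *)

(** * Plane calculus: differentials, holomorphic pairs, Cauchy estimates *)

Lemma MVT_between {R : realType} (f df : R -> R) :
  (forall x : R, is_derive x (1 : R) f (df x)) ->
  forall a b, exists2 c, `|c - a| <= `|b - a| & f b - f a = df c * (b - a).
Proof.
move=> fd a b.
have cf u v : {within `[u, v], continuous f}.
  by apply: derivable_within_continuous => x _; have [] := fd x.
have [ab|/ltW ba] := leP a b.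
  have [c] := MVT_segment ab (fun x _ => fd x) (cf _ _).
  rewrite in_itv/= => /andP[ac cb] e; exists c => //.
  by rewrite !ger0_norm ?subr_ge0// lerD2r.
have [c] := MVT_segment ba (fun x _ => fd x) (cf _ _).
rewrite in_itv/= => /andP[ac cb] e; exists c.
  by rewrite !ler0_norm ?subr_le0// lerN2 lerD2r.
by rewrite -opprB e -mulrN opprB.
Qed.

(** The differential with gradient [(a, b)], named so that a linear structure can be attached to
    it. *)
Definition lin2 {R : realType} (a b : R) (h : R * R) : R := a * h.1 + b * h.2.

Lemma lin2_linear {R : realType} (a b : R) : linear (lin2 a b).
Proof. by move=> k u v; rewrite /lin2 /= /GRing.scale/=; ring. Qed.

HB.instance Definition _ {R : realType} (a b : R) :=
  GRing.isLinear.Build R (R * R)%type R *:%R (lin2 a b) (lin2_linear a b).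

Lemma continuous_lin2 {R : realType} (a b : R) : continuous (lin2 a b).
Proof.
move=> t; apply: (@continuousD R R _ (fun h : R * R => a * h.1)
  (fun h : R * R => b * h.2)); apply: continuousM;
  by [exact: cvg_cst|exact: cvg_fst|exact: cvg_snd].
Qed.

(** The increment is split into a horizontal and a vertical one; on each segment the mean value
    theorem produces a partial derivative at a point near [t], and continuity makes the error
    o(h). *)
Lemma is_diff_partials {R : realType} (g gx gy : R * R -> R) :
  (forall x y : R, is_derive x (1 : R) (fun s => g (s, y)) (gx (x, y))) ->
  (forall x y : R, is_derive y (1 : R) (fun s => g (x, s)) (gy (x, y))) ->
  continuous gx -> continuous gy ->
  forall t, is_diff t g (lin2 (gx t) (gy t)).
Proof.
move=> dx dy cx cy t.
have key : g \o shift t = cst (g t) + lin2 (gx t) (gy t) +o_ 0 id.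
  apply: eqaddoE; apply/eqaddoP => _/posnumP[e].
  have e2 : 0 < e%:num / 2 by [].
  have /cvgrPdist_le/(_ _ e2) nx := cx t.
  have /cvgrPdist_le/(_ _ e2) ny := cy t.
  have [d1 /= d10 H1] := (@nbhs_ballP _ _ _ _).1 nx.
  have [d2 /= d20 H2] := (@nbhs_ballP _ _ _ _).1 ny.
  near=> h.
  have hd : `|h| < Num.min d1 d2.
    near: h.
    suff : \forall h \near (0 : R * R), `|h| < Num.min d1 d2 by [].
    by apply: nbhs0_lt; rewrite lt_min d10.
  have [hd1 hd2] : `|h| < d1 /\ `|h| < d2.
    by move: hd; rewrite lt_min => /andP[].
  have h1h : `|h.1| <= `|h| by rewrite prod_normE le_max lexx.
  have h2h : `|h.2| <= `|h| by rewrite prod_normE le_max lexx orbT.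
  have [c1 c1P E1] := MVT_between (fun x => dx x (t.2 + h.2)) t.1
    (t.1 + h.1).
  have [c2 c2P E2] := MVT_between (fun y => dy t.1 y) t.2 (t.2 + h.2).
  rewrite ![_ + _ - t.1]addrAC subrr add0r in c1P E1.
  rewrite ![_ + _ - t.2]addrAC subrr add0r in c2P E2.
  have K1 := H1 (c1, t.2 + h.2); have K2 := H2 (t.1, c2).
  have {}K1 : `|gx t - gx (c1, t.2 + h.2)| <= e%:num / 2.
    apply: K1; split => /=; rewrite -ball_normE /=.
      by rewrite distrC (le_lt_trans c1P)// (le_lt_trans h1h).
    by rewrite opprD addrA subrr add0r normrN (le_lt_trans h2h).
  have {}K2 : `|gy t - gy (t.1, c2)| <= e%:num / 2.
    apply: K2; split => /=; rewrite -ball_normE /=.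
      by rewrite subrr normr0 (le_lt_trans _ hd2).
    by rewrite distrC (le_lt_trans c2P)// (le_lt_trans h2h).
  rewrite [X in `|X|](_ : _ = (gx (c1, t.2 + h.2) - gx t) * h.1 +
      (gy (t.1, c2) - gy t) * h.2); last first.
    transitivity (g (t.1 + h.1, t.2 + h.2) -
        (g (t.1, t.2) + (gx t * h.1 + gy t * h.2))).
      by case: (t) (h) => [t1 t2] [h1 h2]; rewrite [t1 + _]addrC [t2 + _]addrC.
    have -> : g (t.1 + h.1, t.2 + h.2) = g (t.1, t.2) +
        gx (c1, t.2 + h.2) * h.1 + gy (t.1, c2) * h.2.
      by rewrite -E1 -E2; ring.
    by ring.
  rewrite [X in _ <= X](_ : _ = e%:num / 2 * `|h| + e%:num / 2 * `|h|).
    rewrite (le_trans (ler_normD _ _))// !normrM.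
    by rewrite lerD// ler_pM// distrC.
  by rewrite -mulrDl -splitr.
apply: DiffDef; last by apply: diff_unique => //; exact: continuous_lin2.
apply/diff_locallyP; rewrite (@diff_unique _ _ _ g (lin2 (gx t) (gy t)) t) //.
  by split => //; exact: continuous_lin2.
exact: continuous_lin2.
Unshelve. all: by end_near. Qed.

Lemma continuous_pair {T U V : topologicalType} (f : T -> U) (g : T -> V) :
  continuous f -> continuous g -> continuous (fun t => (f t, g t)).
Proof.
move=> cf cg t; apply: (@cvg_pair _ _ _ _ (nbhs (f t)) (nbhs (g t))).
  exact: cf.
exact: cg.
Qed.

Lemma is_derive_is_diff {R : realType} (f : R -> R) (x df : R) :
  is_derive x (1 : R) f df -> is_diff x f ( *%R^~ df).
Proof.
move=> fd; have fx : differentiable f x by apply/derivable1_diffP; case: fd.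
apply: DiffDef => //; rewrite diff1E// derive1E; apply/funext => h.
by have [_ ->] := fd.
Qed.

Lemma is_derive_comp2 {R : realType} (g : R * R -> R) (X Y : R -> R)
    (s u v X' Y' : R) :
  is_diff (X s, Y s) g (lin2 u v) ->
  is_derive s (1 : R) X X' -> is_derive s (1 : R) Y Y' ->
  is_derive s (1 : R) (fun s => g (X s, Y s)) (u * X' + v * Y').
Proof.
move=> gd /is_derive_is_diff Xd /is_derive_is_diff Yd.
have XYd := is_diff_pair Xd Yd.
have D := @is_diff_comp _ _ _ _ (fun s => (X s, Y s)) _ g _ _ XYd gd.
apply: DeriveDef.
  by apply/derivable1_diffP; exact: (@ex_diff _ _ _ _ _ _ _ D).
rewrite deriveE; last exact: (@ex_diff _ _ _ _ _ _ _ D).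
by rewrite (@diff_val _ _ _ _ _ _ _ D) /lin2/= !mul1r.
Qed.

(* The function a + i b of x + i y is holomorphic, with continuous derivative
   p + i q. *)
Definition holo {R : realType} (a b p q : R * R -> R) : Prop :=
  [/\ forall t, is_diff t a (lin2 (p t) (- q t)),
      forall t, is_diff t b (lin2 (q t) (p t)), continuous p & continuous q].

Lemma is_diff_continuous {R : realType} (g : R * R -> R) (u v : R * R -> R) :
  (forall t, is_diff t g (lin2 (u t) (v t))) -> continuous g.
Proof.
by move=> gd t; apply: differentiable_continuous; have [] := gd t.
Qed.

(* The mean m(s) of p over the circle of radius s and c(s) satisfy c' = m by
   differentiation under the integral and c = s m by integrating a derivative
   in th; hence c / s is constant, and m(s) = m(0). *)
Section Cauchy_estimate.
Context {R : realType}.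
Variables (a b p q : R * R -> R) (x0 y0 : R).
Hypothesis h : holo a b p q.
Local Notation leb := (@lebesgue_measure R).

Let circle (s th : R) := (x0 + s * cos th, y0 + s * sin th).
Let f s th := a (circle s th) * cos th + b (circle s th) * sin th.
Let c s := \int[leb]_(th in `[0%R, 2 * pi]) f s th.
Let m s := \int[leb]_(th in `[0%R, 2 * pi]) p (circle s th).

Let continuous_circle1 s : continuous (circle s).
Proof.
apply: continuous_pair => th; apply: cvgD; try exact: cvg_cst;
  apply: cvgM; try exact: cvg_cst.
  exact: continuous_cos.
exact: continuous_sin.
Qed.

Let continuous_circle : continuous (fun t : R * R => circle t.1 t.2).
Proof.
apply: continuous_pair => t; apply: cvgD; try exact: cvg_cst;
  apply: cvgM; try exact: cvg_fst.
  by apply: continuous_comp; [exact: cvg_snd|exact: continuous_cos].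
by apply: continuous_comp; [exact: cvg_snd|exact: continuous_sin].
Qed.

Let ca : continuous a.
Proof. by have [+ _ _ _] := h; exact: is_diff_continuous. Qed.
Let cb : continuous b.
Proof. by have [_ + _ _] := h; exact: is_diff_continuous. Qed.
Let cp : continuous p. Proof. by have [] := h. Qed.

Let cont_comp (g : R * R -> R) s : continuous g ->
  continuous (fun th => g (circle s th)).
Proof.
by move=> cg th; apply: continuous_comp; [exact: continuous_circle1|exact: cg].
Qed.

Let cont_f s : continuous (f s).
Proof.
move=> th; apply: cvgD; apply: cvgM; try exact: cont_comp.
  exact: continuous_cos.
exact: continuous_sin.
Qed.

Let integrable_cont (g : R -> R) : continuous g ->
  leb.-integrable `[0%R, 2 * pi] (EFin \o g).
Proof.
move=> cg; apply: continuous_compact_integrable; first exact: segment_compact.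
exact: continuous_subspaceT.
Qed.

(** [f s th] is the real part of (a + i b) e^{-i th} on the circle. Along the ray a + i b has
    derivative (p + i q) e^{i th}, so the phases cancel and the real part [p] is left. *)
Let derive_f s th : is_derive s (1 : R) (f ^~ th) (p (circle s th)).
Proof.
have [da db _ _] := h.
have dX : is_derive s (1 : R) (fun s => x0 + s * cos th) (cos th).
  by apply: is_derive_eq; rewrite /GRing.scale/=; ring.
have dY : is_derive s (1 : R) (fun s => y0 + s * sin th) (sin th).
  by apply: is_derive_eq; rewrite /GRing.scale/=; ring.
have Da := is_derive_comp2 (X := fun s => x0 + s * cos th)
    (Y := fun s => y0 + s * sin th) (da (circle s th)) dX dY.
have Db := is_derive_comp2 (X := fun s => x0 + s * cos th)
    (Y := fun s => y0 + s * sin th) (db (circle s th)) dX dY.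
rewrite /f /circle; apply: is_derive_eq.
rewrite !scaler0 !add0r /GRing.scale/=.
rewrite -[RHS]mulr1 -(cos2Dsin2 th); ring.
Qed.

Let derive_c s : is_derive s (1 : R) c (m s).
Proof.
(* The compact set serves to bound |p| by a constant for radii near [s], the domination required for
   differentiating under the integral. *)
pose K := [set t : R * R | t.1 \in `[s - 1, s + 1] /\ t.2 \in `[0, 2 * pi]].
have cK : compact K.
  have := compact_setX (@segment_compact R (s - 1) (s + 1))
    (@segment_compact R 0 (2 * pi)).
  by congr compact; apply/seteqP; split => t.
have K0 : K !=set0.
  exists (s, 0); split => /=; rewrite in_itv/= ?lexx ?mulr_ge0 ?pi_ge0//.
  by rewrite lerBlDr lerDl ler01.
have cF : {within K, continuous (fun t : R * R => `|p (circle t.1 t.2)|)}.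
  apply: continuous_subspaceT => t.
  apply: continuous_comp; last exact: norm_continuous.
  by apply: continuous_comp; [exact: continuous_circle|exact: cp].
have [t0 _ t0M] := compact_EVT_max K0 cK cF.
set M := `|p (circle t0.1 t0.2)| in t0M.
have Is : (`]s - 1, s + 1[%classic : set R) s.
  by rewrite /= in_itv/= ltrBlDr !ltrDl ltr01.
have mI : measurable (`[0%R, 2 * pi]%classic : set (measurableTypeR R)).
  exact: measurable_itv.
have d1E x y : partial1of2 f x y = p (circle x y).
  by rewrite partial1of2E; have [] := derive_f x y.
have intM : leb.-integrable `[0%R, 2 * pi] (EFin \o (fun=> M)).
  by apply: integrable_cont => x; exact: cvg_cst.
have intf x : (`]s - 1, s + 1[%classic : set R) x ->
    leb.-integrable `[0%R, 2 * pi] (EFin \o f x).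
  by move=> _; apply: integrable_cont; exact: cont_f.
have derf x y : (`]s - 1, s + 1[%classic : set R) x ->
    (`[0%R, 2 * pi]%classic : set R) y -> derivable (f ^~ y) x 1.
  by move=> _ _; have [] := derive_f x y.
have M0 (y : R) : 0 <= M by exact: normr_ge0.
have Mub x y : (`]s - 1, s + 1[%classic : set R) x ->
    (`[0%R, 2 * pi]%classic : set R) y -> `|partial1of2 f x y| <= M.
  move=> Ix Iy; rewrite d1E; apply: (t0M (x, y)).
  rewrite inE; split => //=; move: Ix; rewrite /= !in_itv/= => /andP[x1 x2].
  by rewrite !ltW.
have D := derivable_under_integral mI Is intf derf M0 intM Mub.
have E := differentiation_under_integral mI Is intf derf M0 intM Mub.
apply: DeriveDef => //; rewrite -derive1E E /m.
by apply: eq_Rintegral => y _; rewrite -d1E.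
Qed.

Let c_eq s : c s = s * m s.
Proof.
have [da db _ _] := h.
(* The imaginary part of (a + i b) e^{-i th}: the motion along the circle contributes [s * p], the
   factor e^{-i th} contributes [- f]. As [F] is 2 pi periodic, the integral of [F'] vanishes. *)
pose F th := b (circle s th) * cos th - a (circle s th) * sin th.
pose F' th := s * p (circle s th) - f s th.
have dF th : is_derive th (1 : R) F (F' th).
  have dX : is_derive th (1 : R) (fun th => x0 + s * cos th) (s * - sin th).
    by apply: is_derive_eq; rewrite /GRing.scale/=; ring.
  have dY : is_derive th (1 : R) (fun th => y0 + s * sin th) (s * cos th).
    by apply: is_derive_eq; rewrite /GRing.scale/=; ring.
  have Da := is_derive_comp2 (X := fun th => x0 + s * cos th)
    (Y := fun th => y0 + s * sin th) (da (circle s th)) dX dY.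
  have Db := is_derive_comp2 (X := fun th => x0 + s * cos th)
    (Y := fun th => y0 + s * sin th) (db (circle s th)) dX dY.
  rewrite /F /circle; apply: is_derive_eq.
  rewrite /F' /f /circle /GRing.scale/=.
  rewrite -[X in _ = X - _]mulr1 -(cos2Dsin2 th); ring.
have cF' : continuous F'.
  move=> th; apply: cvgB; last exact: cont_f.
  by apply: cvgM; [exact: cvg_cst|exact: cont_comp].
have cF : continuous F.
  move=> th; apply: differentiable_continuous; apply/derivable1_diffP.
  by have [] := dF th.
have pi20 : (0 : R) < 2 * pi by rewrite mulr_gt0 ?pi_gt0.
have := @continuous_FTC2 R F' F 0 (2 * pi) pi20 (continuous_subspaceT cF').
have -> : F (2 * pi) = F 0.
  have e1 : cos (2 * pi) = 1 :> R by rewrite mulr_natl cos2pi.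
  have e2 : sin (2 * pi) = 0 :> R by rewrite mulr_natl sin2pi.
  by rewrite /F /circle e1 e2 cos0 sin0.
rewrite -EFinB subrr => FTC.
have {FTC} : \int[leb]_(th in `[0%R, 2 * pi]) F' th = 0.
  rewrite /Rintegral FTC//.
    split; first by move=> x _; have [] := dF x.
      exact/cvg_at_right_filter/cF.
    exact/cvg_at_left_filter/cF.
  by move=> x _; rewrite derive1E; have [] := dF x.
rewrite RintegralB//=; last 2 first.
- apply: integrable_cont => th.
  by apply: cvgM; [exact: cvg_cst|exact: cont_comp].
- exact/integrable_cont/cont_f.
rewrite RintegralZl//; last exact/integrable_cont/cont_comp.
by move/eqP; rewrite subr_eq0 => /eqP.
Qed.

Let m_cst s t : 0 < s -> s <= t -> m s = m t.
Proof.
move=> s0 st; have t0 := lt_le_trans s0 st.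
have dk x : x \in `]s, t[ -> is_derive x (1 : R) (fun x => c x / x) 0.
  rewrite in_itv/= => /andP[sx _]; have xn0 : x != 0.
    by rewrite gt_eqF// (lt_trans s0).
  have Dc := derive_c x.
  have DV := @is_deriveV R (fun y => y) x 1 1 xn0 (is_derive_id _ _).
  apply: is_derive_eq; rewrite /GRing.scale/= c_eq.
  by field.
have ck : {within `[s, t], continuous (fun x => c x / x)}.
  apply: continuous_in_subspaceT => x; rewrite inE/= in_itv/= => /andP[sx _].
  have xn0 : x != 0 by rewrite gt_eqF// (lt_le_trans s0).
  apply: cvgM; last exact: inv_continuous.
  apply: differentiable_continuous; apply/derivable1_diffP.
  by have [] := derive_c x.
have [_ _] := MVT_segment st dk ck.
rewrite mul0r => /eqP; rewrite subr_eq0 !c_eq ![_ * m _]mulrC.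
by rewrite !mulfK ?lt0r_neq0// => /eqP.
Qed.

Let m0 : m 0 = 2 * pi * p (x0, y0).
Proof.
rewrite /m (_ : (fun _ => _) = cst (p (x0, y0))); last first.
  by apply/funext => th; rewrite /circle !mul0r !addr0.
rewrite Rintegral_cst//= lebesgue_measure_itv/= lte_fin.
by rewrite mulr_gt0 ?pi_gt0//= oppr0 addr0 mulrC.
Qed.

(** The quotient [c e / e] is [m e], which equals [m s] for [0 < e <= s] by [m_cst]; as [e] tends to
    0 it also tends to the derivative of [c] at 0, which is [m 0]. *)
Let m_eq s : 0 < s -> m s = m 0.
Proof.
move=> s0; apply/eqP/negPn/negP => /negbTE sE.
have e0 : 0 < `|m 0 - m s| by rewrite normr_gt0 subr_eq0 eq_sym sE.
have [dc Dc] := derive_c 0; rewrite /derivable in dc.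
have /cvgrPdist_lt/(_ _ e0) : h^-1 *: (c (h *: 1 + 0) - c 0) @[h --> 0^'] --> m 0.
  by rewrite -Dc; exact: dc.
rewrite /dnbhs/= => /nbhs_ballP[d /= d0 dP].
pose e := Num.min (d / 2) s.
have e1 : 0 < e by rewrite lt_min s0 divr_gt0.
have := dP e; rewrite /ball/= sub0r normrN gtr0_norm// => /(_ _ _).
rewrite !c_eq mul0r subr0 addr0 /GRing.scale/= mulr1 mulKf ?gt_eqF//.
rewrite (@m_cst e s) ?ge_min ?lexx ?orbT// ltxx => H; exfalso.
suff: false by []; apply: H => //.
rewrite gt_min; apply/orP; left; rewrite ltr_pdivrMr// ltr_pMr// ltr1n//.
Qed.

(** The mean value property gives |c s| = 2 pi s |p(x0, y0)|, while the integrand is at most |a| +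
    |b| <= 2 S on the circle, which lies in the square. *)
Lemma Cauchy_estimate1 (s S : R) : 0 < s ->
  (forall x y, `|x - x0| <= s -> `|y - y0| <= s ->
    `|a (x, y)| <= S /\ `|b (x, y)| <= S) ->
  `|p (x0, y0)| <= 2 * S / s.
Proof.
move=> s0 abS; have pi20 : (0 : R) < 2 * pi by rewrite mulr_gt0 ?pi_gt0.
have cE : `|c s| = s * (2 * pi) * `|p (x0, y0)|.
  by rewrite c_eq m_eq// m0 mulrA normrM gtr0_norm// mulr_gt0.
have ub th : `|f s th| <= 2 * S.
  have [||aS bS] := abS (x0 + s * cos th) (y0 + s * sin th).
  - rewrite addrAC subrr add0r normrM gtr0_norm// ler_piMr ?(ltW s0)//.
    by rewrite ler_norml cos_geN1 cos_le1.
  - rewrite addrAC subrr add0r normrM gtr0_norm// ler_piMr ?(ltW s0)//.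
    by rewrite ler_norml sin_geN1 sin_le1.
  rewrite mulr_natl mulr2n (le_trans (ler_normD _ _))// lerD// normrM.
    by rewrite -[leRHS]mulr1 ler_pM// ler_norml cos_geN1 cos_le1.
  by rewrite -[leRHS]mulr1 ler_pM// ler_norml sin_geN1 sin_le1.
have mI : measurable (`[0%R, 2 * pi]%classic : set (measurableTypeR R)).
  exact: measurable_itv.
have : `|c s| <= 2 * S * (2 * pi).
  rewrite (le_trans (le_normr_Rintegral _ _))//.
    exact/integrable_cont/cont_f.
  rewrite [leRHS](_ : _ = \int[leb]_(th in `[0%R, 2 * pi]) cst (2 * S) th).
    apply: le_Rintegral => //=.
      apply: integrable_cont => th; apply: continuous_comp; first exact: cont_f.
      exact: norm_continuous.
    by apply: integrable_cont => th; exact: cvg_cst.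
  rewrite Rintegral_cst//= lebesgue_measure_itv/= lte_fin pi20/=.
  by rewrite oppr0 addr0.
rewrite cE ler_pdivlMr// => H; rewrite -(ler_pM2r pi20); nra.
Qed.
End Cauchy_estimate.

(** * Algebra of differentials and of holomorphic pairs *)

Section is_diff_lin2.
Context {R : realType}.
Implicit Types (g : R * R -> R) (t : R * R) (u v : R).

Lemma is_diff_lin2 u v t : is_diff t (lin2 u v) (lin2 u v).
Proof.
apply: DiffDef; first exact: linear_differentiable (@continuous_lin2 R u v).
exact: diff_lin (@continuous_lin2 R u v).
Qed.

Lemma is_diff2_cst c t : is_diff t (fun=> c) (lin2 0 0 : R * R -> R).
Proof.
have d0 : is_diff t (cst c : R * R -> R) 0 by exact: is_diff_cst.
by apply: is_diff_eq; apply/funext => h; rewrite /lin2 !mul0r addr0.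
Qed.

Lemma is_diff2D g1 g2 t u1 v1 u2 v2 :
  is_diff t g1 (lin2 u1 v1) -> is_diff t g2 (lin2 u2 v2) ->
  is_diff t (fun s => g1 s + g2 s) (lin2 (u1 + u2) (v1 + v2)).
Proof.
move=> d1 d2; have d12 := is_diffD d1 d2.
by apply: is_diff_eq; apply/funext => h; rewrite /lin2 fctE; ring.
Qed.

Lemma is_diff2N g t u v :
  is_diff t g (lin2 u v) -> is_diff t (fun s => - g s) (lin2 (- u) (- v)).
Proof.
move=> d1; have d2 := is_diffN d1.
by apply: is_diff_eq; apply/funext => h; rewrite /lin2 fctE; ring.
Qed.

Lemma is_diff2M g1 g2 t u1 v1 u2 v2 :
  is_diff t g1 (lin2 u1 v1) -> is_diff t g2 (lin2 u2 v2) ->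
  is_diff t (fun s => g1 s * g2 s)
    (lin2 (u1 * g2 t + g1 t * u2) (v1 * g2 t + g1 t * v2)).
Proof.
move=> d1 d2; have d12 := is_diffM d1 d2.
apply: is_diff_eq; apply/funext => h; rewrite /lin2 !fctE /GRing.scale/=; ring.
Qed.

Lemma is_diff2_comp (f : R -> R) g t df u v :
  is_derive (g t) (1 : R) f df -> is_diff t g (lin2 u v) ->
  is_diff t (fun s => f (g s)) (lin2 (df * u) (df * v)).
Proof.
move=> /is_derive_is_diff fd gd; have d12 := is_diff_comp gd fd.
by apply: is_diff_eq; apply/funext => h; rewrite /lin2 /=; ring.
Qed.

End is_diff_lin2.

Lemma is_diff2_eq {R : realType} (g : R * R -> R) t u v u' v' :
  is_diff t g (lin2 u v) -> u = u' -> v = v' -> is_diff t g (lin2 u' v').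
Proof. by move=> ? <- <-. Qed.

Section holo_theory.
Context {R : realType}.
Implicit Types (a b p q : R * R -> R).

Lemma holo_continuousl a b p q : holo a b p q -> continuous a.
Proof. by case=> + _ _ _; exact: is_diff_continuous. Qed.

Lemma holo_continuousr a b p q : holo a b p q -> continuous b.
Proof. by case=> _ + _ _; exact: is_diff_continuous. Qed.

Lemma holoD a b p q a' b' p' q' : holo a b p q -> holo a' b' p' q' ->
  holo (fun t => a t + a' t) (fun t => b t + b' t)
       (fun t => p t + p' t) (fun t => q t + q' t).
Proof.
move=> [da db cp cq] [da' db' cp' cq']; split => t.
- by apply: is_diff2_eq (is_diff2D (da t) (da' t)) _ _ => //; rewrite opprD.
- exact: is_diff2D.
- by apply: cvgD; [exact: cp|exact: cp'].
- by apply: cvgD; [exact: cq|exact: cq'].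
Qed.

Lemma holoM a b p q a' b' p' q' : holo a b p q -> holo a' b' p' q' ->
  holo (fun t => a t * a' t - b t * b' t) (fun t => a t * b' t + b t * a' t)
    (fun t => p t * a' t + a t * p' t - (q t * b' t + b t * q' t))
    (fun t => p t * b' t + a t * q' t + (q t * a' t + b t * p' t)).
Proof.
move=> h h'; have [da db cp cq] := h; have [da' db' cp' cq'] := h'.
have ca := holo_continuousl h; have cb := holo_continuousr h.
have ca' := holo_continuousl h'; have cb' := holo_continuousr h'.
split => t.
- apply: is_diff2_eq (is_diff2D (is_diff2M (da t) (da' t))
    (is_diff2N (is_diff2M (db t) (db' t)))) _ _ => //; ring.
- apply: is_diff2_eq (is_diff2D (is_diff2M (da t) (db' t))
    (is_diff2M (db t) (da' t))) _ _ => //; ring.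
- by apply: cvgB; apply: cvgD; apply: cvgM;
    do [exact: ca|exact: cb|exact: ca'|exact: cb'
       |exact: cp|exact: cq|exact: cp'|exact: cq'].
- by apply: cvgD; apply: cvgD; apply: cvgM;
    do [exact: ca|exact: cb|exact: ca'|exact: cb'
       |exact: cp|exact: cq|exact: cp'|exact: cq'].
Qed.

Lemma holo_cst c d : holo (fun=> c) (fun=> d) (fun=> 0) (fun=> 0 : R).
Proof.
split => t; try exact: cvg_cst.
  by apply: is_diff2_eq (is_diff2_cst _ _) _ _; rewrite ?oppr0.
exact: is_diff2_cst.
Qed.

Lemma eq_holo a b p q a' b' p' q' : holo a b p q ->
  a =1 a' -> b =1 b' -> p =1 p' -> q =1 q' -> holo a' b' p' q'.
Proof. by move=> h /funext<- /funext<- /funext<- /funext<-. Qed.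

(** Multiplication by -i: it puts the imaginary part first, so that what is proved for [a] and [p]
    also covers [b] and [q]. *)
Lemma holo_rot a b p q : holo a b p q ->
  holo b (fun t => - a t) q (fun t => - p t).
Proof.
move=> /(holoM (holo_cst 0 (-1))) h.
by apply: eq_holo h _ _ _ _ => t /=; ring.
Qed.

(* The function exp((c + d i) (zeta - zeta1)) of a complex variable zeta. *)
Lemma holo_exp (c d : R) (t1 : R * R) :
  let L1 t := c * (t.1 - t1.1) - d * (t.2 - t1.2) in
  let L2 t := c * (t.2 - t1.2) + d * (t.1 - t1.1) in
  let a t := expR (L1 t) * cos (L2 t) in
  let b t := expR (L1 t) * sin (L2 t) in
  holo a b (fun t => c * a t - d * b t) (fun t => c * b t + d * a t).
Proof.
move=> L1 L2 a b.
have dL1 t : is_diff t L1 (lin2 c (- d)).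
  have := is_diff2D (is_diff_lin2 c (- d) t)
    (is_diff2_cst (d * t1.2 - c * t1.1) t).
  rewrite !addr0; congr (is_diff_def _ _ _).
  by apply/funext => s; rewrite /L1 /lin2; ring.
have dL2 t : is_diff t L2 (lin2 d c).
  have := is_diff2D (is_diff_lin2 d c t)
    (is_diff2_cst (- d * t1.1 - c * t1.2) t).
  rewrite !addr0; congr (is_diff_def _ _ _).
  by apply/funext => s; rewrite /L2 /lin2; ring.
have dE t := is_diff2_comp (is_derive_expR (L1 t)) (dL1 t).
have dC t := is_diff2_comp (is_derive_cos (L2 t)) (dL2 t).
have dS t := is_diff2_comp (is_derive_sin (L2 t)) (dL2 t).
have da t : is_diff t a (lin2 (c * a t - d * b t) (- (c * b t + d * a t))).
  apply: is_diff2_eq (is_diff2M (dE t) (dC t)) _ _; rewrite /a /b; ring.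
have db t : is_diff t b (lin2 (c * b t + d * a t) (c * a t - d * b t)).
  apply: is_diff2_eq (is_diff2M (dE t) (dS t)) _ _; rewrite /a /b; ring.
have ca := is_diff_continuous da; have cb := is_diff_continuous db.
split=> // t.
- by apply: cvgB; apply: cvgM; do [exact: cvg_cst|exact: ca|exact: cb].
- by apply: cvgD; apply: cvgM; do [exact: cvg_cst|exact: ca|exact: cb].
Qed.

Lemma Cauchy_estimate a b p q x0 y0 (s S : R) : holo a b p q -> 0 < s ->
  (forall x y, `|x - x0| <= s -> `|y - y0| <= s ->
    `|a (x, y)| <= S /\ `|b (x, y)| <= S) ->
  `|p (x0, y0)| <= 2 * S / s /\ `|q (x0, y0)| <= 2 * S / s.
Proof.
move=> h s0 abS; split; first exact: (Cauchy_estimate1 h s0 abS).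
apply: (Cauchy_estimate1 (holo_rot h) s0) => x y xs ys.
by rewrite normrN; have [] := abS x y xs ys.
Qed.

(** Around each point within s / 2 of the center, the square of half side s / 2 lies in the given
    one, so |p| and |q| are at most 4 S / s there; one horizontal and one vertical segment give 8 S
    / s. *)
Lemma holo_lipschitz a b p q x0 y0 (s S : R) : holo a b p q -> 0 < s ->
  (forall x y, `|x - x0| <= s -> `|y - y0| <= s ->
    `|a (x, y)| <= S /\ `|b (x, y)| <= S) ->
  forall x y d, `|x - x0| <= d -> `|y - y0| <= d -> d <= s / 2 ->
    `|a (x, y) - a (x0, y0)| <= 8 * S / s * d.
Proof.
move=> h s0 abS x y d xd yd ds.
have s20 : 0 < s / 2 by rewrite divr_gt0.
have pq x' y' : `|x' - x0| <= s / 2 -> `|y' - y0| <= s / 2 ->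
    `|p (x', y')| <= 4 * S / s /\ `|q (x', y')| <= 4 * S / s.
  move=> xs ys; have -> : 4 * S / s = 2 * S / (s / 2).
    by field; rewrite gt_eqF.
  apply: Cauchy_estimate h s20 _ => x2 y2 x2s y2s; apply: abS.
    rewrite (splitr s) (le_trans (ler_distD x' _ _))// lerD//.
  by rewrite (splitr s) (le_trans (ler_distD y' _ _))// lerD.
have [da _ _ _] := h.
have dx x' : is_derive x' (1 : R) (fun x => a (x, y)) (p (x', y)).
  have D := is_derive_comp2 (X := fun x => x) (Y := fun=> y) (da (x', y))
    (is_derive_id _ _) (is_derive_cst _ _ _).
  by apply: is_derive_eq; rewrite mulr0 mulr1 addr0.
have dy y' : is_derive y' (1 : R) (fun y => a (x0, y)) (- q (x0, y')).
  have D := is_derive_comp2 (Y := fun x => x) (X := fun=> x0) (da (x0, y'))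
    (is_derive_cst _ _ _) (is_derive_id _ _).
  by apply: is_derive_eq; rewrite mulr0 mulr1 add0r.
have [c1 c1P E1] := MVT_between dx x0 x.
have [c2 c2P E2] := MVT_between dy y0 y.
have -> : a (x, y) - a (x0, y0) = p (c1, y) * (x - x0) - q (x0, c2) * (y - y0).
  by rewrite -E1 -mulNr -E2; ring.
have S0 : 0 <= 4 * S / s.
  by apply: le_trans (pq x0 y0 _ _).1 => //; rewrite subrr normr0 ltW.
rewrite (le_trans (ler_normB _ _))// !normrM.
have -> : 8 * S / s * d = 4 * S / s * d + 4 * S / s * d.
  by field; rewrite gt_eqF.
rewrite lerD// ler_pM//.
  apply: (pq _ _ _ _).1; first exact: le_trans c1P (le_trans xd ds).
  exact: le_trans yd ds.
apply: (pq _ _ _ _).2; first by rewrite subrr normr0 ltW.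
exact: le_trans c2P (le_trans yd ds).
Qed.

End holo_theory.

(** * Borel sets and Lebesgue measure of the plane *)

(** The product sigma-algebra is generated by rectangles, so the open set is written as the union of
    the squares with rational center and half side that it contains, a countable union. *)
Lemma open_measurable2 {R : realType} (U : set (R * R)) : open U ->
  measurable (U : set (measurableTypeR R * measurableTypeR R)).
Proof.
move=> oU.
pose B (t : rat * rat * rat : Type) : set (measurableTypeR R * measurableTypeR R) :=
  `]ratr t.1.1 - ratr t.2, ratr t.1.1 + ratr t.2[ `*`
  `]ratr t.1.2 - ratr t.2, ratr t.1.2 + ratr t.2[.
have -> : U = \bigcup_(t in [set t | B t `<=` U]) B t.
  apply/seteqP; split => [[x y] Uxy|]; last by move=> t [? /= + tB]; exact.
  move: (oU); rewrite openE => /(_ _ Uxy)/nbhs_ballP[/= e e0 eU].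
  (* The given point is only within [d] of the rational center, so the square reaches up to 2 d away
     from it: hence d < e / 2. *)
  have e2 : 0 < e / 2 by rewrite divr_gt0.
  have [d] : exists d : rat, ratr d \in `]0, e / 2[ by exact: rat_in_itvoo.
  rewrite in_itv/= => /andP[d0 de].
  have [a] : exists a : rat, ratr a \in `]x - ratr d, x + ratr d[.
    by apply: rat_in_itvoo; rewrite ltrD2l gtrN.
  rewrite in_itv/= => /andP[a1 a2].
  have [b] : exists b : rat, ratr b \in `]y - ratr d, y + ratr d[.
    by apply: rat_in_itvoo; rewrite ltrD2l gtrN.
  rewrite in_itv/= => /andP[b1 b2].
  exists (a, b, d).
    move=> [s t] [] /=; rewrite !in_itv/= => /andP[s1 s2] /andP[t1 t2].
    apply: eU; split; rewrite /= /ball/= ltr_norml; apply/andP; split; lra.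
  by split => /=; rewrite in_itv/=; apply/andP; split; lra.
rewrite bigcup_mkcond; apply: countable_bigcupT_measurable => //.
move=> t; case: ifPn => _ //.
by apply: measurableX; exact: measurable_itv.
Qed.

Lemma continuous_measurable2 {R : realType} (g : R * R -> R) : continuous g ->
  measurable_fun setT (g : measurableTypeR R * measurableTypeR R -> R).
Proof.
move=> /continuousP cg; apply: (measurability _ (RGenOpens.measurableE R)).
move=> _ [_ [a [b ->] <-]]; rewrite setTI; apply: open_measurable2.
by apply: cg; exact: interval_open.
Qed.

Section plane_measure.
Context {R : realType}.
Local Open Scope ereal_scope.
Local Notation leb := (@lebesgue_measure R).
Local Notation RR := (measurableTypeR R * measurableTypeR R)%type.

(* A named copy of the product measure, for which sigma-finiteness is declared. *)
Definition leb2 : set RR -> \bar R := leb \x leb.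

HB.instance Definition _ := Measure.on leb2.

Lemma leb2_setX (A B : set (measurableTypeR R)) : measurable A -> measurable B ->
  leb2 (A `*` B) = leb A * leb B.
Proof. by move=> mA mB; rewrite /leb2 product_measure1E. Qed.

Let leb2_sigma_finite : sigma_finite setT leb2.
Proof.
pose I (n : nat) : set (measurableTypeR R) := `[(- n%:R)%R, n%:R]%classic.
have mI n : measurable (I n) by exact: measurable_itv.
exists (fun n => I n `*` I n).
  apply/seteqP; split => [[x y] _|//].
  exists (Num.truncn (`|x| + `|y|)).+1 => //.
  have := truncnS_gt (`|x| + `|y|)%R.
  have xy : (`|x| <= `|x| + `|y| /\ `|y| <= `|x| + `|y|)%R.
    by rewrite lerDl lerDr.
  case: xy => xy1 xy2 /ltW h; split => /=; rewrite /I/= in_itv/= -ler_norml.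
    exact: le_trans h.
  exact: le_trans h.
move=> n; split; first exact: measurableX.
rewrite leb2_setX//= lebesgue_measure_itv/=; case: ifPn => _.
  by rewrite -EFinB -EFinM ltry.
by rewrite mul0e ltry.
Qed.

HB.instance Definition _ := Measure_isSigmaFinite.Build _ _ _ leb2
  leb2_sigma_finite.

End plane_measure.

(** * Sub-mean-value inequality for Gaussian weighted norms *)

Section submean.
Context {R : realType} (alpha : R).
Hypothesis alpha_gt0 : 0 < alpha.

Definition gaussw (t : R * R) : R := expR (- (alpha / 2) * (t.1 ^+ 2 + t.2 ^+ 2)).

(* [N] behaves like the norm of a vector of holomorphic functions. *)
Definition holo_norm (N : R * R -> R) : Prop :=
  [/\ forall t, 0 <= N t, continuous N,
      forall x y, N (x, - y) = N (x, y) &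
      forall t, exists a b p q, [/\ holo a b p q,
        forall s, a s ^+ 2 + b s ^+ 2 <= N s ^+ 2 & N t <= 3 * `|a t|]].

Lemma continuous_gaussw : continuous gaussw.
Proof.
move=> t; apply: continuous_comp; last exact: continuous_expR.
apply: cvgM; first exact: cvg_cst.
rewrite !expr2; under eq_cvg do rewrite !expr2.
by apply: cvgD; apply: cvgM; do [exact: cvg_fst|exact: cvg_snd].
Qed.

(* |exp(- alpha conj(z1) (z - z1))| is the Gaussian weight at z up to a factor
   bounded on the square, so the Lipschitz estimate for the product of this
   function with a + i b controls H itself. *)
Lemma lower_bound_near_max (N : R * R -> R) (rho d B : R) (x1 y1 : R) :
  holo_norm N -> 0 < d -> d <= rho -> 1 <= B ->
  let H t := N t * gaussw t in
  (forall x y, `|x - x1| <= d -> `|y - y1| <= d -> H (x, y) <= B * H (x1, y1)) ->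
  let E := expR (alpha * rho ^+ 2) in
  forall x y, `|x - x1| <= d / (48 * B * E) -> `|y - y1| <= d / (48 * B * E) ->
    H (x1, y1) / (6 * E) <= H (x, y).
Proof.
move=> [N0 cN Ne hN] d0 drho B1 H HB E x y xd yd.
have [a [b [p [q [h abN aN]]]]] := hN (x1, y1).
have E1 : 1 <= E by rewrite -expR0 ler_expR mulr_ge0 ?sqr_ge0// ltW.
have B0 : 0 < B by exact: lt_le_trans B1.
have E0 : 0 < E by exact: lt_le_trans E1.
pose K := expR (alpha / 2 * (x1 ^+ 2 + y1 ^+ 2)).
have K0 : 0 < K by exact: expR_gt0.
have N1 : N (x1, y1) = H (x1, y1) * K.
  by rewrite /H /gaussw /= -mulrA -expRD mulNr addNr expR0 mulr1.
have hG := holoM h (holo_exp (- alpha * x1) (alpha * y1) (x1, y1)).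
set a' := (fun t => a t * _ - b t * _) in hG; set b' := (fun t => _ + _) in hG.
have abG s t : `|s - x1| <= d -> `|t - y1| <= d ->
    `|a' (s, t)| <= H (s, t) * K * E /\ `|b' (s, t)| <= H (s, t) * K * E.
  move=> sd td.
  have HKE0 : 0 <= H (s, t) * K * E.
    by rewrite !mulr_ge0 ?expR_ge0.
  suff: a' (s, t) ^+ 2 + b' (s, t) ^+ 2 <= (H (s, t) * K * E) ^+ 2.
    move=> ab2; split; rewrite -(@ler_pXn2r _ 2%N) ?nnegrE// real_normK ?num_real//;
      apply: le_trans ab2; by rewrite (lerDl, lerDr) sqr_ge0.
  rewrite /a' /b' /=.
  set L1 := - alpha * x1 * (s - x1) - alpha * y1 * (t - y1).
  set L2 := - alpha * x1 * (t - y1) + alpha * y1 * (s - x1).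
  have -> : (a (s, t) * (expR L1 * cos L2) - b (s, t) * (expR L1 * sin L2)) ^+ 2 +
    (a (s, t) * (expR L1 * sin L2) + b (s, t) * (expR L1 * cos L2)) ^+ 2 =
    (a (s, t) ^+ 2 + b (s, t) ^+ 2) * expR L1 ^+ 2.
    by rewrite -[RHS]mulr1 -(cos2Dsin2 L2); ring.
  (* With z = s + i t, L1 = - alpha Re(conj(z1) (z - z1)) = - alpha / 2 (|z|^2 - |z1|^2 - |z -
     z1|^2); the last square is at most 2 rho^2, which is where [E] comes from. *)
  have L1E : expR L1 <= gaussw (s, t) * K * E.
    rewrite /gaussw /K /E -!expRD ler_expR /=.
    have -> : L1 = - (alpha / 2) * (s ^+ 2 + t ^+ 2) +
      alpha / 2 * (x1 ^+ 2 + y1 ^+ 2) +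
      alpha / 2 * ((s - x1) ^+ 2 + (t - y1) ^+ 2) by rewrite /L1; field.
    rewrite lerD2l.
    have sx : (s - x1) ^+ 2 <= rho ^+ 2.
      rewrite -(real_normK (num_real (s - x1))) lerXn2r ?nnegrE//.
        exact: ltW (lt_le_trans d0 drho).
      exact: le_trans sd drho.
    have ty : (t - y1) ^+ 2 <= rho ^+ 2.
      rewrite -(real_normK (num_real (t - y1))) lerXn2r ?nnegrE//.
        exact: ltW (lt_le_trans d0 drho).
      exact: le_trans td drho.
    have -> : alpha * rho ^+ 2 = alpha / 2 * (rho ^+ 2 + rho ^+ 2) by field.
    by rewrite ler_wpM2l ?lerD// divr_ge0 ?ltW.
  have -> : H (s, t) * K * E = N (s, t) * (gaussw (s, t) * K * E).
    by rewrite /H; ring.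
  rewrite exprMn ler_pM ?addr_ge0 ?sqr_ge0//.
  by rewrite lerXn2r ?nnegrE ?expR_ge0// !mulr_ge0 ?expR_ge0.
pose S := B * H (x1, y1) * K * E.
have abS s t : `|s - x1| <= d -> `|t - y1| <= d ->
    `|a' (s, t)| <= S /\ `|b' (s, t)| <= S.
  move=> sd td; have [aH bH] := abG s t sd td.
  by split; [apply: le_trans aH _|apply: le_trans bH _];
    rewrite /S !ler_pM2r//; exact: HB.
(* With 48 B E the Lipschitz bound is exactly H K / 6, half of the lower bound H K / 3 of |a| at the
   center. The remaining H K / 6 is compared with the upper bound H(x, y) K E, which yields the
   factor 6 E. *)
have c2 : d / (48 * B * E) <= d / 2.
  rewrite ler_pM2l// lef_pV2 ?posrE ?mulr_gt0//; nra.
have := holo_lipschitz hG d0 abS xd yd c2.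
have -> : 8 * S / d * (d / (48 * B * E)) = H (x1, y1) * K / 6.
  by rewrite /S; field; rewrite !gt_eqF.
have a'1 : a' (x1, y1) = a (x1, y1).
  by rewrite /a' /= !subrr !mulr0 subrr addr0 expR0 cos0 sin0 !mulr1 !mulr0 subr0.
have dE : d / (48 * B * E) <= d.
  by apply: le_trans c2 _; rewrite ler_pdivrMr// ler_pMr// ler1n.
have [+ _] := abG x y (le_trans xd dE) (le_trans yd dE).
rewrite a'1; move: aN; rewrite N1 => aN aH ad.
have : H (x1, y1) * K / 3 <= `|a (x1, y1)| by rewrite ler_pdivrMr// [leRHS]mulrC.
have := ler_normB (a' (x, y)) (a' (x, y) - a (x1, y1)).
rewrite opprB addrC subrK => a3 a4.
have {aH ad a3 a4} : H (x1, y1) / 6 * K <= H (x, y) * E * K by nra.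
by rewrite ler_pM2r// => ?; rewrite invfM mulrA ler_pdivrMr.
Qed.

End submean.

Section submean_integral.
Context {R : realType} (alpha : R).
Hypothesis alpha_gt0 : 0 < alpha.

(** Cut at the real axis because slice volume integrals run over positive second coordinates. *)
Definition half_square (rho : R) (z : R * R) :
    set (measurableTypeR R * measurableTypeR R) :=
  [set t | [/\ `|t.1 - z.1| < rho, `|t.2 - z.2| < rho & 0 < t.2]].

Lemma measurable_half_square rho z : measurable (half_square rho z).
Proof.
apply: open_measurable2.
have -> : half_square rho z = (fst @^-1` ball z.1 rho) `&`
    ((snd @^-1` ball z.2 rho) `&` (snd @^-1` [set y : R | 0 < y])).
  apply/seteqP; split => t; rewrite /half_square -!ball_normE /=.
    by move=> [? ? ?]; rewrite distrC [`|z.2 - _|]distrC.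
  by rewrite distrC [`|z.2 - _|]distrC => -[? []].
apply: openI; first by apply: open_comp; [move=> ? _; exact: cvg_fst|exact: ball_open].
apply: openI; apply: open_comp; try (by move=> ? _; exact: cvg_snd).
  exact: ball_open.
exact: open_gt.
Qed.

(* A maximum point of (rho - |z - z0|)^k H(z): moving there from z0 makes the
   values of H on a small disk comparable to its value at the center. *)
Lemma exists_almost_max (N : R * R -> R) (rho u v : R) (k : nat) :
  holo_norm N -> 0 < rho -> 0 <= v -> (0 < k)%N ->
  let H t := N t * gaussw alpha t in 0 < H (u, v) ->
  exists x1 y1 d, [/\ [/\ 0 < d, 0 <= y1, `|x1 - u| <= rho - 2 * d &
      `|y1 - v| <= rho - 2 * d],
    H (u, v) <= (2 * d / rho) ^+ k * H (x1, y1) &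
    forall x y, `|x - x1| <= d -> `|y - y1| <= d ->
      H (x, y) <= 2 ^+ k * H (x1, y1)].
Proof.
move=> [N0 cN Ne hN] rho0 v0 k0 H H0.
(* Sup-norm distance to the boundary of the square, equal to [rho] at the center; the point found
   has distance 2 d, whence the ratio 2 d / rho. *)
pose D (t : R * R) := rho - Num.max `|t.1 - u| `|t.2 - v|.
pose K := [set t : R * R | [/\ `|t.1 - u| <= rho, `|t.2 - v| <= rho & 0 <= t.2]].
have cH : continuous H.
  by move=> t; apply: cvgM; [exact: cN|exact: continuous_gaussw].
have cD : continuous D.
  move=> t; apply: cvgB; first exact: cvg_cst.
  apply: (@continuous_max _ _ (fun t : R * R => `|t.1 - u|)
    (fun t : R * R => `|t.2 - v|)).
    apply: (@continuous_comp _ _ _ (fun t : R * R => t.1 - u) Num.norm).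
      by apply: cvgB; [exact: cvg_fst|exact: cvg_cst].
    exact: norm_continuous.
  apply: (@continuous_comp _ _ _ (fun t : R * R => t.2 - v) Num.norm).
    by apply: cvgB; [exact: cvg_snd|exact: cvg_cst].
  exact: norm_continuous.
have cK : compact K.
  apply: (@subclosed_compact _ _
    (`[u - rho, u + rho]%classic `*` `[v - rho, v + rho]%classic)).
  - rewrite (_ : K = [set t | `|t.1 - u| <= rho] `&` ([set t | `|t.2 - v| <= rho] `&`
        [set t | 0 <= t.2])); last first.
      by apply/seteqP; split => t /= [] //= ? [].
    apply: closedI; last apply: closedI.
    + apply: (@preimage_closed _ _ (fun t : R * R => `|t.1 - u|) [set x | x <= rho]).
        move=> t _; apply: (@continuous_comp _ _ _ (fun t : R * R => t.1 - u) Num.norm).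
          by apply: cvgB; [exact: cvg_fst|exact: cvg_cst].
        exact: norm_continuous.
      exact: closed_le.
    + apply: (@preimage_closed _ _ (fun t : R * R => `|t.2 - v|) [set x | x <= rho]).
        move=> t _; apply: (@continuous_comp _ _ _ (fun t : R * R => t.2 - v) Num.norm).
          by apply: cvgB; [exact: cvg_snd|exact: cvg_cst].
        exact: norm_continuous.
      exact: closed_le.
    + apply: (@preimage_closed _ _ (fun t : R * R => t.2) [set x | 0 <= x]).
        by move=> t _; exact: cvg_snd.
      exact: closed_ge.
  - by apply: compact_setX; exact: segment_compact.
  - move=> [x y] [] /=; rewrite !ler_norml => /andP[? ?] /andP[? ?] _.
    by split; rewrite /= in_itv/=; apply/andP; split; lra.
have Kuv : K (u, v) by split; rewrite //= subrr normr0 ltW.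
have cF : {within K, continuous (fun t => D t ^+ k * H t)}.
  apply: continuous_subspaceT => t; apply: cvgM; last exact: cH.
  apply: (@continuous_comp _ _ _ D (fun x => x ^+ k)); first exact: cD.
  exact: exprn_continuous.
have [[x1 y1]] := compact_EVT_max (ex_intro _ _ Kuv) cK cF.
rewrite inE => -[/= x1u y1v y10] tmax.
have max1 := tmax (u, v) (mem_set Kuv).
rewrite /D /= !subrr normr0 maxxx subr0 in max1.
set D1 := rho - _ in max1.
(* The maximal value is at least rho^k H(u, v) > 0; as [0 < k], this excludes a maximum point on the
   boundary. *)
have D10 : 0 < D1.
  have : 0 <= D1 by rewrite subr_ge0 ge_max x1u.
  rewrite le_eqVlt => /predU1P[D1E|//].
  move: max1; rewrite -D1E expr0n eqn0Ngt k0 mul0r leNgt mulr_gt0//.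
  exact: exprn_gt0.
have D2E : rho - 2 * (D1 / 2) = Num.max `|x1 - u| `|y1 - v|.
  by rewrite /D1; field.
exists x1, y1, (D1 / 2); split; first split.
- by rewrite divr_gt0.
- by [].
- by rewrite D2E le_max lexx.
- by rewrite D2E le_max lexx orbT.
- rewrite (_ : 2 * (D1 / 2) = D1); last by rewrite mulrC divfK.
  by rewrite expr_div_n mulrAC ler_pdivlMr ?exprn_gt0// mulrC.
move=> x y xx1 yy1.
(* The maximum is taken over nonnegative ordinates. Evenness of [N] moves a point below the axis to
   its mirror image, and [0 <= v] ensures that this does not increase the distance to [v]. *)
have -> : H (x, y) = H (x, `|y|).
  have [y0|/ltW y0] := leP 0 y; first by rewrite ger0_norm.
  by rewrite ler0_norm// /H /gaussw/= Ne sqrrN.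
have D12 : `|x1 - u| <= rho - D1 /\ `|y1 - v| <= rho - D1.
  have -> : rho - D1 = Num.max `|x1 - u| `|y1 - v| by rewrite /D1; ring.
  by rewrite !le_max !lexx orbT.
have yv : `| `|y| - v| <= `|y - v|.
  have [y0|y0] := leP 0 y; first by rewrite (ger0_norm y0).
  rewrite (ltr0_norm y0) [leRHS]ler0_norm; last by lra.
  by rewrite ler_norml; apply/andP; split; lra.
have [D13 D14] := D12.
have x3 : `|x - u| <= rho - D1 / 2.
  rewrite (le_trans (ler_distD x1 _ _))//; lra.
have y3 : `| `|y| - v| <= rho - D1 / 2.
  rewrite (le_trans yv)// (le_trans (ler_distD y1 _ _))//; lra.
have KK : K (x, `|y|) by split => //=; [apply: le_trans x3 _|apply: le_trans y3 _]; lra.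
have max2 := tmax (x, `|y|) (mem_set KK); rewrite -/D1 in max2.
(* A move by at most D1 / 2 keeps half of the distance to the boundary, at the cost of a factor
   2^k. *)
have D3 : D1 / 2 <= D (x, `|y|) by rewrite /D lerBrDl -lerBrDr ge_max/= x3.
have {max2} : (D1 / 2) ^+ k * H (x, `|y|) <= D1 ^+ k * H (x1, y1).
  apply: le_trans max2; rewrite ler_wpM2r//.
    by rewrite mulr_ge0// expR_ge0.
  by rewrite lerXn2r// nnegrE; lra.
rewrite expr_div_n mulrAC ler_pdivrMr ?exprn_gt0// -mulrA.
by rewrite ler_pM2l ?exprn_gt0// mulrC.
Qed.

(* Near the point of exists_almost_max, H^p is bounded below on a square of side
   comparable to d; the exponent k >= 2 / p absorbs the area d^2. *)
Lemma submean (p rho : R) : 0 < p -> 0 < rho ->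
  exists2 C : R, 0 < C & forall N, holo_norm N -> forall u v, 0 <= v ->
    (((N (u, v) * gaussw alpha (u, v)) `^ p)%:E <= C%:E *
      \int[leb2]_(t in half_square rho (u, v))
        ((N t * gaussw alpha t) `^ p)%:E)%E.
Proof.
move=> p0 rho0.
pose k := (Num.truncn (2 / p)).+1.
have k2 : 2 <= k%:R * p.
  by rewrite -ler_pdivrMr// ltW// truncnS_gt.
pose B : R := 2 ^+ k; pose E := expR (alpha * rho ^+ 2).
have B1 : 1 <= B by rewrite exprn_ege1// ler1n.
have B0 : 0 < B by exact: lt_le_trans B1.
have E0 : 0 < E by exact: expR_gt0.
have E1 : 1 <= E by rewrite -expR0 ler_expR mulr_ge0 ?sqr_ge0// ltW.
pose c := (48 * B * E)^-1; pose c' := ((6 * E)^-1) `^ p.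
have c0 : 0 < c by rewrite invr_gt0 !mulr_gt0.
have c'0 : 0 < c' by rewrite powR_gt0// invr_gt0 mulr_gt0.
have c1 : c < 1.
  by rewrite invf_lt1 ?mulr_gt0//; nra.
(* [c] and [c'] are the relative size of the square and the loss in H^p given by
   [lower_bound_near_max]; with e = d c this constant turns the lower bound H^p c' e^2 into (2 d /
   rho)^2 H^p. *)
exists (4 / (rho ^+ 2 * c ^+ 2 * c')).
  by rewrite divr_gt0// !mulr_gt0// exprn_gt0.
move=> N hN u v v0; pose H t := N t * gaussw alpha t.
rewrite -/(H (u, v)) -/H.
have [N0 cN Ne _] := hN.
have H_ge0 t : 0 <= H t by rewrite mulr_ge0// expR_ge0.
have cH : continuous H.
  by move=> t; apply: cvgM; [exact: cN|exact: continuous_gaussw].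
have mQ := measurable_half_square rho (u, v).
have [HE|Hn0] := eqVneq (H (u, v)) 0.
  rewrite HE powR0 ?gt_eqF// mule_ge0//.
    by rewrite lee_fin ltW// divr_gt0// !mulr_gt0// exprn_gt0.
  by apply: integral_ge0 => t _; rewrite lee_fin powR_ge0.
have H0 : 0 < H (u, v) by rewrite lt_neqAle eq_sym Hn0 H_ge0.
have [x1 [y1 [d [[d0 y10 x1u y1v] Huv Hd]]]] :=
  exists_almost_max hN rho0 v0 (ltn0Sn _ : (0 < k)%N) H0.
have drho : 2 * d <= rho by have := normr_ge0 (x1 - u); lra.
have drho' : d <= rho by lra.
have lower := lower_bound_near_max alpha_gt0 hN d0 drho' B1 Hd.
rewrite -/E -/H in lower.
pose e := d * c.
have e0 : 0 < e by rewrite mulr_gt0.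
have ed : e < d by rewrite gtr_pMr.
(* Only the upper right quarter of the neighborhood: its points have y > y1 >= 0, so it stays in the
   open half plane even if the maximum point is real. *)
pose b : set (measurableTypeR R * measurableTypeR R) :=
  `]x1, x1 + e]%classic `*` `]y1, y1 + e]%classic.
have mb : measurable b by apply: measurableX; exact: measurable_itv.
have bQ : b `<=` half_square rho (u, v).
  move=> [x y] [] /=; rewrite !in_itv/= => /andP[xx1 xe] /andP[yy1 ye].
  move: x1u y1v; rewrite !ler_norml => /andP[v1 v2] /andP[w1 w2].
  move: v1 v2 w1 w2 xx1 xe yy1 ye e0 ed d0 y10; clear => *.
  by split => /=; rewrite ?ltr_norml; try (apply/andP; split); lra.
have mHp : measurable_fun setT (fun t : measurableTypeR R * measurableTypeR R =>
    (H t `^ p)%:E).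
  apply/measurable_EFinP.
  apply: (measurableT_comp (measurable_powR p)); exact: continuous_measurable2.
have bE : leb2 b = (e ^+ 2)%:E.
  rewrite /leb2/= product_measure1E/=; try exact: measurable_itv.
  by rewrite !lebesgue_measure_itv/= !lte_fin !ltrDl e0 -!EFinB -EFinM !(addrAC _ e)
    !subrr !add0r expr2.
have low : (((H (x1, y1) `^ p * c') * e ^+ 2)%:E <=
    \int[leb2]_(t in half_square rho (u, v)) (H t `^ p)%:E)%E.
  apply: (@le_trans _ _ (\int[leb2]_(t in b) (H t `^ p)%:E)%E); last first.
    apply: ge0_subset_integral => //; last by move=> t _; rewrite lee_fin powR_ge0.
    exact: measurable_funTS.
  rewrite EFinM -bE -integral_cst//; apply: ge0_le_integral => //.
  - by move=> t _; rewrite lee_fin mulr_ge0// powR_ge0.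
  - exact: measurable_funTS.
  - move=> [x y] [] /=; rewrite !in_itv/= => /andP[xx1 xe] /andP[yy1 ye].
    have V0 : 0 <= (6 * E)^-1 by rewrite invr_ge0 mulr_ge0// ltW.
    rewrite lee_fin /c' -powRM//.
    apply: ge0_ler_powR; rewrite ?nnegrE ?(ltW p0)//; first exact: mulr_ge0.
    by apply: lower; rewrite -/c -/e ger0_norm; move: xx1 xe yy1 ye; clear; lra.
apply: (@le_trans _ _ ((4 / (rho ^+ 2 * c ^+ 2 * c'))%:E *
    (H (x1, y1) `^ p * c' * e ^+ 2)%:E)%E); last first.
  apply: lee_wpmul2l low.
  by rewrite lee_fin ltW// divr_gt0// !mulr_gt0// exprn_gt0.
have -> : ((4 / (rho ^+ 2 * c ^+ 2 * c'))%:E * (H (x1, y1) `^ p * c' * e ^+ 2)%:E =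
    ((2 * d / rho) ^+ 2 * H (x1, y1) `^ p)%:E)%E.
  by rewrite -EFinM; congr EFin; rewrite /e; field; rewrite !gt_eqF.
rewrite lee_fin; have q0 : 0 < 2 * d / rho by rewrite divr_gt0// mulr_gt0.
apply: (@le_trans _ _ (((2 * d / rho) ^+ k * H (x1, y1)) `^ p)).
  by rewrite ge0_ler_powR ?nnegrE ?(ltW p0)// mulr_ge0// exprn_ge0// ltW.
rewrite powRM ?exprn_ge0 ?(ltW q0)// ler_wpM2r ?powR_ge0//.
rewrite -!powR_mulrn ?(ltW q0)// -powRrM; apply: ger_powR => //.
by rewrite q0 ler_pdivrMr// mul1r.
Qed.

End submean_integral.

(** * Coordinates, slices and imaginary units *)

Section quaternion_coordinates.
Context {R : realType}.
Implicit Types (q w z I J : quat R) (x y : R).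

Lemma qmulE (a b c d a' b' c' d' : R) :
  ((a, (b, c, d)) : quat R) * ((a', (b', c', d')) : quat R) =
  (a * a' - b * b' - c * c' - d * d',
    (a * b' + b * a' + c * d' - d * c',
     a * c' - b * d' + c * a' + d * b',
     a * d' + b * c' - c * b' + d * a')).
Proof. by []. Qed.

Lemma qN1E : - 1 = ((-1, (0, 0, 0)) : quat R).
Proof. by transitivity ((-1, (-0, -0, -0)) : quat R) => //; rewrite oppr0. Qed.

Lemma enorm_sqr (v : R * R * R) :
  enorm v ^+ 2 = v.1.1 ^+ 2 + v.1.2 ^+ 2 + v.2 ^+ 2.
Proof. by rewrite sqr_sqrtr// !addr_ge0// sqr_ge0. Qed.

Lemma enorm_ge0 (v : R * R * R) : 0 <= enorm v.
Proof. exact: sqrtr_ge0. Qed.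

Lemma enorm_eq0 (v : R * R * R) : enorm v = 0 -> v = (0, 0, 0).
Proof.
move=> v0; have := enorm_sqr v; rewrite v0 expr0n/= => /esym/eqP.
rewrite !paddr_eq0 ?addr_ge0 ?sqr_ge0// !sqrf_eq0.
by case: v v0 => [[a b] c] _ /= /andP[/andP[/eqP-> /eqP->] /eqP->].
Qed.

Lemma qnorm_ge0 q : 0 <= qnorm q. Proof. exact: sqrtr_ge0. Qed.

Lemma qnorm_sqr q : qnorm q ^+ 2 = q.1 ^+ 2 + enorm q.2 ^+ 2.
Proof. by rewrite sqr_sqrtr// addr_ge0// sqr_ge0. Qed.

Lemma qnormZ (k : R) q : qnorm (k *: q) = `|k| * qnorm q.
Proof.
apply/eqP; rewrite -(@eqrXn2 _ 2) ?mulr_ge0 ?qnorm_ge0//; apply/eqP.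
rewrite exprMn !qnorm_sqr !enorm_sqr real_normK ?num_real//=.
by rewrite /GRing.scale/=; ring.
Qed.

(** The imaginary components of I^2 are 2 a b, 2 a c and 2 a d. A nonzero [a] would force b = c = d
    = 0 and a^2 = -1; hence a = 0 and I^2 = - (b^2 + c^2 + d^2). *)
Lemma qsphereP I : qsphere R I <-> I.1 = 0 /\ enorm I.2 = 1.
Proof.
case: I => a [[b c] d]; split => [|[/= -> e]].
  rewrite /qsphere /= qmulE => SI.
  have [e1 e2 e3 e4] : [/\ a * a - b * b - c * c - d * d = -1,
      a * b + b * a + c * d - d * c = 0, a * c - b * d + c * a + d * b = 0 &
      a * d + b * c - c * b + d * a = 0].
    by move: SI => -[-> -> -> ->]; rewrite !oppr0.
  have a0 : a = 0.
    apply/eqP/negPn/negP => a0.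
    have b0 : b = 0.
      have : a * b = 0 by lra.
      by move/eqP; rewrite mulf_eq0 (negbTE a0) => /eqP.
    have c0 : c = 0.
      have : a * c = 0 by lra.
      by move/eqP; rewrite mulf_eq0 (negbTE a0) => /eqP.
    have d0 : d = 0.
      have : a * d = 0 by lra.
      by move/eqP; rewrite mulf_eq0 (negbTE a0) => /eqP.
    by have := sqr_ge0 a; move: e1; rewrite b0 c0 d0 expr2; lra.
  split => //; apply/eqP; rewrite -(@eqrXn2 _ 2) ?enorm_ge0// enorm_sqr/=.
  by apply/eqP; move: e1; rewrite a0; lra.
have := enorm_sqr (b, c, d); rewrite e expr1n /= => bcd.
by rewrite /qsphere/= qmulE qN1E; congr (_, (_, _, _)); lra.
Qed.

Lemma qptE x y I : qsphere R I -> qpt x y I = (x, y *: I.2).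
Proof.
move=> /qsphereP[I1 _]; rewrite /qpt /qofR; case: I I1 => a [[b c] d] /= ->.
transitivity ((x + y * 0, (0 + y * b, 0 + y * c, 0 + y * d)) : quat R) => //.
by rewrite mulr0 addr0 !add0r.
Qed.

Lemma enormZ (k : R) (v : R * R * R) : enorm (k *: v) = `|k| * enorm v.
Proof.
apply/eqP; rewrite -(@eqrXn2 _ 2) ?mulr_ge0 ?enorm_ge0//; apply/eqP.
by rewrite exprMn !enorm_sqr real_normK ?num_real//= /GRing.scale/=; ring.
Qed.

Lemma qpt_re x y I : qsphere R I -> (qpt x y I).1 = x.
Proof. by move=> SI; rewrite qptE. Qed.

Lemma qpt_im x y I : qsphere R I -> enorm (qpt x y I).2 = `|y|.
Proof.
by move=> SI; rewrite qptE// enormZ; case: (qsphereP I).1 => // _ ->; rewrite mulr1.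
Qed.

Lemma qnorm_qpt x y I : qsphere R I -> qnorm (qpt x y I) ^+ 2 = x ^+ 2 + y ^+ 2.
Proof.
by move=> SI; rewrite qnorm_sqr qpt_re// qpt_im// real_normK ?num_real.
Qed.

Lemma qsphereN I : qsphere R I -> qsphere R (- I).
Proof. by rewrite /qsphere/= mulrNN. Qed.

Lemma qconj_qpt x y I : qsphere R I -> qconj (qpt x y I) = qpt x (- y) I.
Proof. by move=> SI; rewrite !qptE// /qconj/= scaleNr. Qed.

Lemma direction_sphere (v : R * R * R) : enorm v != 0 ->
  qsphere R (direction v).
Proof.
move=> v0; apply/qsphereP; split => //; apply/eqP.
rewrite -(@eqrXn2 _ 2) ?enorm_ge0// enorm_sqr/= expr1n !expr_div_n -!mulrDl.
by rewrite -enorm_sqr divff// expf_neq0.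
Qed.

Lemma qpt_direction w : w = qpt w.1 (enorm w.2) (direction w.2).
Proof.
case: w => a v; have [v0|v0] := eqVneq (enorm v) 0.
  by rewrite /= v0 /qpt scale0r addr0 (enorm_eq0 v0).
rewrite qptE; last exact: direction_sphere.
case: v v0 => [[b c] d] v0; set e := enorm _ in v0 *.
transitivity ((a, (e * (b / e), e * (c / e), e * (d / e))) : quat R) => //.
by rewrite ![e * _]mulrC !divfK.
Qed.

Definition qi : quat R := (0, (1, 0, 0)).

Lemma qsphere_qi : qsphere R qi.
Proof. by rewrite /qsphere /= qmulE qN1E; congr (_, (_, _, _)); ring. Qed.

(** At a real point [direction] is 0, which is no imaginary unit; every unit fits there, and [qi] is
    taken. *)
Lemma exists_slice w : exists2 I, qsphere R I & w = qpt w.1 (enorm w.2) I.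
Proof.
have [w0|w0] := eqVneq (enorm w.2) 0.
  exists qi; first exact: qsphere_qi.
  by rewrite {1}(qpt_direction w) w0 /qpt !scale0r.
by exists (direction w.2); [exact: direction_sphere|exact: qpt_direction].
Qed.

Definition qdot q q' : R :=
  q.1 * q'.1 + q.2.1.1 * q'.2.1.1 + q.2.1.2 * q'.2.1.2 + q.2.2 * q'.2.2.

Lemma qnorm_sqrE q : qnorm q ^+ 2 = qdot q q.
Proof. by rewrite qnorm_sqr enorm_sqr /qdot; ring. Qed.

Lemma qdot_sphere_le1 I J : qsphere R I -> qsphere R J -> `|qdot I J| <= 1.
Proof.
move=> /qsphereP[I0 I1] /qsphereP[J0 J1].
have := enorm_sqr I.2; have := enorm_sqr J.2; rewrite I1 J1 expr1n => EJ EI.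
rewrite /qdot I0 mul0r add0r ler_norml.
set a := I.2.1.1 in EI *; set b := I.2.1.2 in EI *; set c := I.2.2 in EI *.
set a' := J.2.1.1 in EJ *; set b' := J.2.1.2 in EJ *; set c' := J.2.2 in EJ *.
apply/andP; split.
  have := sqr_ge0 (a + a'); have := sqr_ge0 (b + b'); have := sqr_ge0 (c + c').
  lra.
have := sqr_ge0 (a - a'); have := sqr_ge0 (b - b'); have := sqr_ge0 (c - c').
lra.
Qed.

End quaternion_coordinates.

(** * The complex exponential series in real coordinates *)

Section complex_exponential.
Context {R : realType}.

(* (x + y i)^n as a pair of reals. *)
Fixpoint cpow (z : R * R) (n : nat) : R * R :=
  if n is m.+1 then
    (z.1 * (cpow z m).1 - z.2 * (cpow z m).2,
     z.1 * (cpow z m).2 + z.2 * (cpow z m).1)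
  else (1, 0).

Definition cmul (z w : R * R) : R * R :=
  (z.1 * w.1 - z.2 * w.2, z.1 * w.2 + z.2 * w.1).

Lemma cpowM z w n : cpow (cmul z w) n = cmul (cpow z n) (cpow w n).
Proof.
elim: n => [|n IH] /=; first by rewrite /cmul/= !mulr0 !mulr1 subr0 addr0.
by rewrite IH /cmul/=; congr (_, _); ring.
Qed.

Lemma cpow_conj (x y : R) n :
  cpow (x, - y) n = ((cpow (x, y) n).1, - (cpow (x, y) n).2).
Proof.
elim: n => [|n IH] /=; first by rewrite oppr0.
by rewrite IH /=; congr (_, _); ring.
Qed.

Lemma cpow_real (x : R) n : cpow (x, 0) n = (x ^+ n, 0).
Proof.
elim: n => [|n IH] //=; rewrite IH /= exprS.
by congr (_, _); ring.
Qed.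

Lemma cpow_bound z n :
  `|(cpow z n).1| <= (`|z.1| + `|z.2|) ^+ n /\
  `|(cpow z n).2| <= (`|z.1| + `|z.2|) ^+ n.
Proof.
have h k : `|(cpow z k).1| + `|(cpow z k).2| <= (`|z.1| + `|z.2|) ^+ k.
  elim: k => [|k IH] /=; first by rewrite normr0 addr0 normr1.
  have := ler_normB (z.1 * (cpow z k).1) (z.2 * (cpow z k).2).
  have := ler_normD (z.1 * (cpow z k).2) (z.2 * (cpow z k).1).
  rewrite !normrM => h1 h2; apply: (le_trans (lerD h2 h1)).
  rewrite exprS; apply: (le_trans _ (ler_wpM2l _ IH)); last exact: addr_ge0.
  by rewrite le_eqVlt; apply/orP; left; apply/eqP; ring.
by split; apply: le_trans (h n); rewrite (lerDl, lerDr).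
Qed.

(** A class of coefficients stable under [pseries_diffs], with [M] replaced by [M * K]: it gives the
    convergence of the series and of its first two formal derivatives, as termwise differentiation
    requires. *)
Let dominated (c : nat -> R) (M K : R) :=
  forall n, `|c n| <= M * (K ^+ n / n`!%:R).

Let cvg_dominated c M K x : 0 <= M -> 0 <= K -> dominated c M K ->
  cvgn (pseries c x).
Proof.
move=> M0 K0 cM; apply: normed_cvg => /=.
apply: (@series_le_cvg _ _ (M *: exp_coeff (K * `|x|))) => [n|n|n|].
- exact: normr_ge0.
- by apply: mulr_ge0 => //; rewrite exp_coeff_ge0// mulr_ge0.
- rewrite /= normrM normrX.
  have -> : (M *: exp_coeff (K * `|x|)) n = M * (K ^+ n / n`!%:R) * `|x| ^+ n.
    by rewrite /exp_coeff fctE /GRing.scale/= exprMn; ring.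
  exact: ler_wpM2r.
by apply: is_cvg_seriesZ; exact: is_cvg_series_exp_coeff.
Qed.

Let dominated_diffs c M K : 0 <= K -> dominated c M K ->
  dominated (pseries_diffs c) (M * K) K.
Proof.
move=> K0 cM n; rewrite /pseries_diffs normrM normr_nat.
apply: (le_trans (ler_wpM2l _ (cM n.+1))) => //.
rewrite le_eqVlt; apply/orP; left; apply/eqP.
rewrite exprS factS natrM.
have : n.+1%:R != 0 :> R by rewrite pnatr_eq0.
have : n`!%:R != 0 :> R by rewrite pnatr_eq0 -lt0n fact_gt0.
by move: (n.+1%:R : R) (n`!%:R : R) => u v v0 u0; field; rewrite u0 v0.
Qed.

Let derive_dominated c M K x : 0 <= M -> 0 <= K -> dominated c M K ->
  is_derive x (1 : R) (fun x => limn (pseries c x))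
    (limn (pseries (pseries_diffs c) x)).
Proof.
move=> M0 K0 cM; have MK0 := mulr_ge0 M0 K0; have MKK0 := mulr_ge0 MK0 K0.
apply: (@pseries_snd_diffs _ c (`|x| + 1)).
- exact: cvg_dominated cM.
- apply: cvg_dominated (dominated_diffs K0 cM) => //.
- apply: cvg_dominated (dominated_diffs K0 (dominated_diffs K0 cM)) => //.
by rewrite [ltRHS]ger0_norm ?addr_ge0// ltrDl.
Qed.

Variables x y : R.
Let P n := (cpow (x, y) n).1 / n`!%:R.
Let Q n := (cpow (x, y) n).2 / n`!%:R.
Let K := `|x| + `|y|.
Let K0 : 0 <= K. Proof. exact: addr_ge0. Qed.

Let PK : dominated P 1 K.
Proof.
move=> n; rewrite mul1r normrM normfV normr_nat ler_wpM2r ?invr_ge0//.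
by have [] := cpow_bound (x, y) n.
Qed.

Let QK : dominated Q 1 K.
Proof.
move=> n; rewrite mul1r normrM normfV normr_nat ler_wpM2r ?invr_ge0//.
by have [] := cpow_bound (x, y) n.
Qed.

(** With [g], the real and imaginary parts of the exponential series at t (x + i y). The real
    parameter [t] brings the question to real power series. *)
Let f t := limn (pseries P t).
Let g t := limn (pseries Q t).

Let lim_lin (u v c : nat -> R) (a b t : R) :
  cvgn (pseries u t) -> cvgn (pseries v t) ->
  (forall n, c n = a * u n + b * v n) ->
  limn (pseries c t) = a * limn (pseries u t) + b * limn (pseries v t).
Proof.
move=> cu cv cE; apply/cvg_lim => //.
have -> : pseries c t = (fun n => a * pseries u t n + b * pseries v t n).
  apply/funext => n; rewrite /pseries /series/= !mulr_sumr -big_split/=.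
  by apply: eq_bigr => i _; rewrite cE; ring.
by apply: cvgD; apply: cvgM => //; exact: cvg_cst.
Qed.

Let diffsE n : pseries_diffs P n = x * P n + (- y) * Q n /\
  pseries_diffs Q n = y * P n + x * Q n.
Proof.
rewrite /pseries_diffs /P /Q factS natrM /=.
have : n.+1%:R != 0 :> R by rewrite pnatr_eq0.
have : n`!%:R != 0 :> R by rewrite pnatr_eq0 -lt0n fact_gt0.
by move: (n.+1%:R : R) (n`!%:R : R) => u v v0 u0; split; field; rewrite u0 v0.
Qed.

Let df t : is_derive t (1 : R) f (x * f t - y * g t).
Proof.
have D := derive_dominated t ler01 K0 PK.
apply: is_derive_eq; rewrite (@lim_lin P Q _ x (- y)) ?mulNr//.
- exact: cvg_dominated PK.
- exact: cvg_dominated QK.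
by move=> n; have [] := diffsE n.
Qed.

Let dg t : is_derive t (1 : R) g (y * f t + x * g t).
Proof.
have D := derive_dominated t ler01 K0 QK.
apply: is_derive_eq; rewrite (@lim_lin P Q _ y x)//.
- exact: cvg_dominated PK.
- exact: cvg_dominated QK.
by move=> n; have [] := diffsE n.
Qed.

Let pseries0 (c : nat -> R) : limn (pseries c 0) = c 0%N.
Proof.
apply/cvg_lim => //; apply: cvg_near_cst.
exists 1%N => // -[//|n] _ /=; rewrite /pseries /series/= big_nat_recl//=.
by rewrite expr0 mulr1 big1 ?addr0// => i _; rewrite exprS mul0r mulr0.
Qed.

(* exp(- t z) * sum_n (t z)^n / n! has derivative 0 in t, hence equals 1. *)
Lemma exp_series_complex :
  series P @ \oo --> expR x * cos y /\ series Q @ \oo --> expR x * sin y.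
Proof.
(* [phi] and [psi] are the real and imaginary parts of e^{-t (x + i y)} (f t + i g t). *)
pose phi t := expR (- x * t) * (f t * cos (y * t) + g t * sin (y * t)).
pose psi t := expR (- x * t) * (g t * cos (y * t) - f t * sin (y * t)).
have dphi t : is_derive t (1 : R) phi 0.
  have Df := df t; have Dg := dg t.
  have De : is_derive t (1 : R) (fun t => expR (- x * t)) (- x * expR (- x * t)).
    by apply: is_derive_eq; rewrite /GRing.scale/=; ring.
  have Dc : is_derive t (1 : R) (fun t => cos (y * t)) (- y * sin (y * t)).
    by apply: is_derive_eq; rewrite /GRing.scale/=; ring.
  have Ds : is_derive t (1 : R) (fun t => sin (y * t)) (y * cos (y * t)).
    by apply: is_derive_eq; rewrite /GRing.scale/=; ring.
  by apply: is_derive_eq; rewrite /GRing.scale/=; ring.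
have dpsi t : is_derive t (1 : R) psi 0.
  have Df := df t; have Dg := dg t.
  have De : is_derive t (1 : R) (fun t => expR (- x * t)) (- x * expR (- x * t)).
    by apply: is_derive_eq; rewrite /GRing.scale/=; ring.
  have Dc : is_derive t (1 : R) (fun t => cos (y * t)) (- y * sin (y * t)).
    by apply: is_derive_eq; rewrite /GRing.scale/=; ring.
  have Ds : is_derive t (1 : R) (fun t => sin (y * t)) (y * cos (y * t)).
    by apply: is_derive_eq; rewrite /GRing.scale/=; ring.
  by apply: is_derive_eq; rewrite /GRing.scale/=; ring.
have f0 : f 0 = 1 by rewrite /f pseries0 /P /= divr1.
have g0 : g 0 = 0 by rewrite /g pseries0 /Q /= mul0r.
have := is_derive_0_is_cst 1 0 dphi; have := is_derive_0_is_cst 1 0 dpsi.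
rewrite /phi /psi !mulr0 !mulr1 f0 g0 expR0 cos0 sin0 => E1 E2.
have ex : expR x * expR (- x) = 1 by rewrite -expRD subrr expR0.
have EP : f 1 * cos y + g 1 * sin y = expR x.
  by have := congr1 (fun u => expR x * u) E2; rewrite /= mulrA ex mul1r => ->; ring.
have EQ : g 1 * cos y - f 1 * sin y = 0.
  by have := congr1 (fun u => expR x * u) E1; rewrite /= mulrA ex mul1r => ->; ring.
have [f1 g1] : f 1 = expR x * cos y /\ g 1 = expR x * sin y.
  move: (f 1) (g 1) EP EQ => u v <- EQ; have cs := cos2Dsin2 y.
  have u1 : u * (cos y ^+ 2 + sin y ^+ 2) = u by rewrite cs mulr1.
  have v1 : v * (cos y ^+ 2 + sin y ^+ 2) = v by rewrite cs mulr1.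
  have := congr1 (fun u => u * sin y) EQ; have := congr1 (fun u => u * cos y) EQ.
  by rewrite /= !mul0r => h1 h2; split; [rewrite -[LHS]u1|rewrite -[LHS]v1]; lra.
have ps c : pseries c (1 : R) = series c.
  rewrite /pseries; congr series; apply/funext => n.
  by rewrite /= expr1n mulr1.
rewrite -f1 -g1; split; rewrite -ps.
  exact: (cvg_dominated (x := 1) ler01 K0 PK).
exact: (cvg_dominated (x := 1) ler01 K0 QK).
Qed.

End complex_exponential.

(** * Closed form of the kernel and of its weighted modulus *)

Lemma mul_lin1 {K : comNzRingType} (A : algType K) (k a b a' b' : K) (I J : A) :
  k *: ((a *: 1 + b *: I) * (a' *: 1 + b' *: J)) =
  (k * a * a') *: 1 + (k * b * a') *: I + (k * a * b') *: J +
  (k * b * b') *: (I * J).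
Proof.
rewrite mulrDl !mulrDr -!scalerAl -!scalerAr !scalerA !mul1r mulr1.
rewrite addrACA !scalerDr !scalerA !addrA.
by congr (_ *: _ + _ *: _ + _ *: _ + _ *: _); rewrite -!mulrA; congr (_ * _);
  rewrite // mulrC.
Qed.

Section Fock_kernel_closed_form.
Context {R : realType} (alpha : R).
Implicit Types (I J : quat R) (z t : R * R).

Lemma qpt_exp (x y : R) I n : qsphere R I ->
  qpt x y I ^+ n = (cpow (x, y) n).1 *: 1 + (cpow (x, y) n).2 *: I.
Proof.
move=> SI; elim: n => [|n IH] /=; first by rewrite scale1r scale0r addr0.
rewrite exprS IH /qpt (_ : qofR x = x *: 1); last first.
  by transitivity ((x * 1, (x * 0, x * 0, x * 0)) : quat R) => //; rewrite mulr1 !mulr0.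
have := mul_lin1 1 x y (cpow (x, y) n).1 (cpow (x, y) n).2 I I.
rewrite scale1r !mul1r => ->; rewrite [I * I]SI scalerN scalerBl scalerDl.
rewrite -!addrA; congr (_ + _).
by rewrite addrA [RHS]addrC [X in X + _ = _]addrC.
Qed.

(** Reading [t] and [z] as complex numbers, [kexp1] and [karg1] are modulus and argument of
    exp(alpha t conj(z)), and [kexp2] and [karg2] those of exp(alpha conj(t) conj(z)). *)
Definition kexp1 z t := expR (alpha * (t.1 * z.1 + t.2 * z.2)).
Definition kexp2 z t := expR (alpha * (t.1 * z.1 - t.2 * z.2)).
Definition karg1 z t := alpha * (t.2 * z.1 - t.1 * z.2).
Definition karg2 z t := - alpha * (t.1 * z.2 + t.2 * z.1).

(* For z = x + y J and w = u + v I, the kernel K(w, z) is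
   (kA + kB J) + I (kA' + kB' J), evaluated at (x, y) and (u, v). *)
Definition kA z t :=
  (kexp1 z t * cos (karg1 z t) + kexp2 z t * cos (karg2 z t)) / 2.
Definition kA' z t :=
  (kexp1 z t * sin (karg1 z t) - kexp2 z t * sin (karg2 z t)) / 2.
Definition kB z t :=
  (kexp1 z t * sin (karg1 z t) + kexp2 z t * sin (karg2 z t)) / 2.
Definition kB' z t :=
  (kexp2 z t * cos (karg2 z t) - kexp1 z t * cos (karg1 z t)) / 2.

(** The two exponents. Half sums and half differences of components of their n-th powers isolate the
    products of a component of t^n with one of conj(z)^n, which are the coefficients of 1, I, J and
    I J in the kernel series. *)
Let om1 z t : R * R :=
  (alpha * (t.1 * z.1 + t.2 * z.2), alpha * (t.2 * z.1 - t.1 * z.2)).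
Let om2 z t : R * R :=
  (alpha * (t.1 * z.1 - t.2 * z.2), - alpha * (t.1 * z.2 + t.2 * z.1)).

Let cpow_om1 z t n : cpow (om1 z t) n =
  (alpha ^+ n * ((cpow t n).1 * (cpow (z.1, - z.2) n).1 -
                 (cpow t n).2 * (cpow (z.1, - z.2) n).2),
   alpha ^+ n * ((cpow t n).1 * (cpow (z.1, - z.2) n).2 +
                 (cpow t n).2 * (cpow (z.1, - z.2) n).1)).
Proof.
have -> : om1 z t = cmul (alpha, 0) (cmul t (z.1, - z.2)).
  by rewrite /om1 /cmul/=; congr (_, _); ring.
by rewrite !cpowM cpow_real /cmul/=; congr (_, _); ring.
Qed.

Let cpow_om2 z t n : cpow (om2 z t) n =
  (alpha ^+ n * ((cpow t n).1 * (cpow (z.1, - z.2) n).1 +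
                 (cpow t n).2 * (cpow (z.1, - z.2) n).2),
   alpha ^+ n * ((cpow t n).1 * (cpow (z.1, - z.2) n).2 -
                 (cpow t n).2 * (cpow (z.1, - z.2) n).1)).
Proof.
have -> : om2 z t = cmul (alpha, 0) (cmul (t.1, - t.2) (z.1, - z.2)).
  by rewrite /om2 /cmul/=; congr (_, _); ring.
rewrite !cpowM cpow_real cpow_conj -surjective_pairing /cmul/=.
by congr (_, _); ring.
Qed.

Let cvg_half (a b c : nat -> R) (k la lb : R) :
  series a @ \oo --> la -> series b @ \oo --> lb ->
  (forall n, c n = (a n + k * b n) / 2) ->
  series c @ \oo --> (la + k * lb) / 2.
Proof.
move=> ca cb cE.
have -> : series c = (fun n => (series a n + k * series b n) / 2).
  apply/funext => n; rewrite /series/= mulr_sumr -big_split/= mulr_suml.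
  by apply: eq_bigr => i _; rewrite cE.
by apply: cvgM; [apply: cvgD => //; apply: cvgM => //; exact: cvg_cst|exact: cvg_cst].
Qed.

Lemma Fock_kernelE (u v x y : R) I J : qsphere R I -> qsphere R J ->
  Fock_kernel alpha (qpt u v I) (qpt x y J) =
  kA (x, y) (u, v) *: 1 + kA' (x, y) (u, v) *: I +
  kB (x, y) (u, v) *: J + kB' (x, y) (u, v) *: (I * J).
Proof.
move=> SI SJ; pose z := (x, y); pose t := (u, v).
have [P1 Q1] := exp_series_complex (om1 z t).1 (om1 z t).2.
have [P2 Q2] := exp_series_complex (om2 z t).1 (om2 z t).2.
rewrite -!surjective_pairing in P1 Q1 P2 Q2.
pose c i j n := alpha ^+ n / n`!%:R * i (cpow t n) * j (cpow (z.1, - z.2) n).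
have n0 n : n`!%:R != 0 :> R by rewrite pnatr_eq0 -lt0n fact_gt0.
have cPP : series (c fst fst) @ \oo --> kA z t.
  rewrite /kA -[X in (_ + X) / 2]mul1r; apply: (cvg_half P1 P2) => n.
  by rewrite cpow_om1 cpow_om2 /c /=; field.
have cQP : series (c snd fst) @ \oo --> kA' z t.
  rewrite /kA' -[X in (_ + X) / 2]mulN1r; apply: (cvg_half Q1 Q2) => n.
  by rewrite cpow_om1 cpow_om2 /c /=; field.
have cPQ : series (c fst snd) @ \oo --> kB z t.
  rewrite /kB -[X in (_ + X) / 2]mul1r; apply: (cvg_half Q1 Q2) => n.
  by rewrite cpow_om1 cpow_om2 /c /=; field.
have cQQ : series (c snd snd) @ \oo --> kB' z t.
  rewrite /kB' -[X in (_ + X) / 2]mulN1r; apply: (cvg_half P2 P1) => n.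
  by rewrite cpow_om1 cpow_om2 /c /=; field.
rewrite /Fock_kernel; apply/cvg_lim; first exact: norm_hausdorff.
have -> : series (fun n => alpha ^+ n / n`!%:R *:
      (qpt u v I ^+ n * qconj (qpt x y J) ^+ n)) =
    (fun n => series (c fst fst) n *: (1 : quat R) + series (c snd fst) n *: I +
      series (c fst snd) n *: J + series (c snd snd) n *: (I * J)).
  apply/funext => n; rewrite /series/= !scaler_suml -!big_split/=.
  apply: eq_bigr => k _; rewrite qconj_qpt// !qpt_exp// /c /=.
  exact: mul_lin1.
by apply: cvgD; [apply: cvgD; [apply: cvgD|]|]; exact: cvgZr_tmp.
Qed.

(* Here s is the inner product of I and J. *)
Definition kweight2 (u v x y s : R) : R :=
  ((1 + s) * expR (- alpha * ((u - x) ^+ 2 + (v - y) ^+ 2)) +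
   (1 - s) * expR (- alpha * ((u - x) ^+ 2 + (v + y) ^+ 2))) / 2.

Let norm_kernel (a a' b b' : R) I J : qsphere R I -> qsphere R J ->
  qnorm (a *: 1 + a' *: I + b *: J + b' *: (I * J)) ^+ 2 =
  a ^+ 2 + a' ^+ 2 + b ^+ 2 + b' ^+ 2 + 2 * qdot I J * (a' * b - a * b').
Proof.
move=> /qsphereP[I0 I1] /qsphereP[J0 J1].
have := enorm_sqr I.2; have := enorm_sqr J.2; rewrite I1 J1 expr1n.
case: I I0 {I1} => i0 [[i1 i2] i3] /= ->; case: J J0 {J1} => j0 [[j1 j2] j3] /= ->.
move=> nJ nI; rewrite /qdot/= qmulE.
(* The product I J has real part -<I, J> and imaginary part the cross product of I and J. *)
transitivity (qnorm ((a - b' * (i1 * j1 + i2 * j2 + i3 * j3),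
   (a' * i1 + b * j1 + b' * (i2 * j3 - i3 * j2),
    a' * i2 + b * j2 + b' * (i3 * j1 - i1 * j3),
    a' * i3 + b * j3 + b' * (i1 * j2 - i2 * j1))) : quat R) ^+ 2).
  congr (qnorm _ ^+ 2).
  transitivity ((a * 1 + a' * 0 + b * 0 +
      b' * (0 * 0 - i1 * j1 - i2 * j2 - i3 * j3),
     (a * 0 + a' * i1 + b * j1 + b' * (0 * j1 + i1 * 0 + i2 * j3 - i3 * j2),
      a * 0 + a' * i2 + b * j2 + b' * (0 * j2 - i1 * j3 + i2 * 0 + i3 * j1),
      a * 0 + a' * i3 + b * j3 + b' * (0 * j3 + i1 * j2 - i2 * j1 + i3 * 0)))
     : quat R) => //.
  by congr (_, (_, _, _)); ring.
rewrite qnorm_sqrE /qdot/=.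
(* The coefficient of b'^2 is Lagrange's identity: the squared inner product plus the squared cross
   product is |I|^2 |J|^2. *)
transitivity (a ^+ 2 + a' ^+ 2 * (i1 ^+ 2 + i2 ^+ 2 + i3 ^+ 2) +
  b ^+ 2 * (j1 ^+ 2 + j2 ^+ 2 + j3 ^+ 2) +
  b' ^+ 2 * ((i1 ^+ 2 + i2 ^+ 2 + i3 ^+ 2) * (j1 ^+ 2 + j2 ^+ 2 + j3 ^+ 2)) +
  2 * (0 * 0 + i1 * j1 + i2 * j2 + i3 * j3) * (a' * b - a * b')).
  by ring.
by rewrite -nI -nJ !mulr1.
Qed.

Lemma weighted_kernel (u v x y : R) I J : qsphere R I -> qsphere R J ->
  weighted alpha (normalized_kernel alpha (qpt x y J)) (qpt u v I) ^+ 2 =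
  kweight2 u v x y (qdot I J).
Proof.
move=> SI SJ; rewrite /weighted /normalized_kernel Fock_kernelE// scalerA.
rewrite qnormZ exprMn norm_kernel// real_normK ?num_real// -expRD !qnorm_qpt//.
rewrite /kA /kA' /kB /kB'.
set E1 := kexp1 _ _; set E2 := kexp2 _ _.
move: (karg1 _ _) (karg2 _ _) => th1 th2.
set s := qdot I J.
have c1 := cos2Dsin2 th1; have c2 := cos2Dsin2 th2.
(* The mixed terms in E1 E2 cancel, both in the sum of squares and in a' b - a b', so the arguments
   occur only through cos^2 + sin^2. *)
transitivity (expR (- (alpha / 2) * (u ^+ 2 + v ^+ 2) +
    - (alpha / 2) * (x ^+ 2 + y ^+ 2)) ^+ 2 *
  (((1 + s) * (E1 ^+ 2 * (cos th1 ^+ 2 + sin th1 ^+ 2)) +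
  (1 - s) * (E2 ^+ 2 * (cos th2 ^+ 2 + sin th2 ^+ 2))) / 2)).
  by congr (_ * _); field.
rewrite c1 c2 !mulr1 /kweight2 /E1 /E2 /kexp1 /kexp2 /= !expr2 -!expRD.
rewrite mulrA mulrDr !mulrA [_ * (1 + s)]mulrC [_ * (1 - s)]mulrC -!mulrA -!expRD.
by congr (((1 + s) * expR _ + (1 - s) * expR _) / 2); field.
Qed.

End Fock_kernel_closed_form.

(** * Slice regularity of the kernels *)

Section slice_regular_holo.
Context {R : realType}.
Implicit Types (c : quat R) (t : R * R).

Lemma is_derive_scaled (a : R * R -> R) t u v c (h : R * R) :
  is_diff t a (lin2 u v) ->
  is_derive t h (fun s => a s *: c) (lin2 u v h *: c).
Proof.
move=> [da dE]; have dac := differentiableZl c da.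
apply: DeriveDef; first exact: diff_derivable.
by rewrite deriveE// diffZl// dE.
Qed.

(** Real holomorphic pairs with constant quaternions on the right: both components have the same
    constants, so the unit I only meets them from the left. The kernel uses multiples of 1 and J. *)
Lemma holo_slice_regular (a a' b b' p q p' q' : R * R -> R) c1 c2
    (f : quat R -> quat R) :
  holo a a' p q -> holo b b' p' q' ->
  (forall x y, a (x, - y) = a (x, y)) -> (forall x y, b (x, - y) = b (x, y)) ->
  (forall x y, a' (x, - y) = - a' (x, y)) ->
  (forall x y, b' (x, - y) = - b' (x, y)) ->
  (forall x y I, qsphere R I -> f (qpt x y I) =
    a (x, y) *: c1 + b (x, y) *: c2 + I * (a' (x, y) *: c1 + b' (x, y) *: c2)) ->
  slice_regular f.
Proof.
move=> [da da' cp cq] [db db' cp' cq'] ae be a'o b'o fE.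
pose f0 t := a t *: c1 + b t *: c2.
pose f1 t := a' t *: c1 + b' t *: c2.
have D0 t h : is_derive t h f0
    (lin2 (p t) (- q t) h *: c1 + lin2 (p' t) (- q' t) h *: c2).
  by apply: is_deriveD; exact: is_derive_scaled.
have D1 t h : is_derive t h f1
    (lin2 (q t) (p t) h *: c1 + lin2 (q' t) (p' t) h *: c2).
  by apply: is_deriveD; exact: is_derive_scaled.
have lx (u v : R) : lin2 u v (1, 0) = u by rewrite /lin2/= mulr1 mulr0 addr0.
have ly (u v : R) : lin2 u v (0, 1) = v by rewrite /lin2/= mulr1 mulr0 add0r.
have x0 t : partial_x f0 t = p t *: c1 + p' t *: c2.
  by rewrite /partial_x; have [_ ->] := D0 t (1, 0); rewrite !lx.
have y0 t : partial_y f0 t = - q t *: c1 + - q' t *: c2.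
  by rewrite /partial_y; have [_ ->] := D0 t (0, 1); rewrite !ly.
have x1 t : partial_x f1 t = q t *: c1 + q' t *: c2.
  by rewrite /partial_x; have [_ ->] := D1 t (1, 0); rewrite !lx.
have y1 t : partial_y f1 t = p t *: c1 + p' t *: c2.
  by rewrite /partial_y; have [_ ->] := D1 t (0, 1); rewrite !ly.
have cont (u v : R * R -> R) : continuous u -> continuous v ->
    continuous (fun t => u t *: c1 + v t *: c2).
  move=> cu cv t; apply: cvgD; apply: cvgZr_tmp; [exact: cu|exact: cv].
have contN (u : R * R -> R) : continuous u -> continuous (fun t => - u t).
  by move=> cu t; apply: cvgN; exact: cu.
exists f0, f1; split.
- split => [x y|x y|x y I SI]; first by rewrite /f0 ae be.
    by rewrite /f1 a'o b'o !scaleNr opprD.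
  exact: fE.
- split.
  + by move=> t; have [] := D0 t (1, 0).
  + by move=> t; have [] := D0 t (0, 1).
  + by rewrite (funext x0); exact: cont.
  + by rewrite (funext y0); apply: cont; exact: contN.
- split.
  + by move=> t; have [] := D1 t (1, 0).
  + by move=> t; have [] := D1 t (0, 1).
  + by rewrite (funext x1); exact: cont.
  + by rewrite (funext y1); exact: cont.
- by move=> t; rewrite x0 y1 subrr.
- by move=> t; rewrite y0 x1 addrACA -!scalerDl !addNr !scale0r addr0.
Qed.

End slice_regular_holo.

Section kernel_slice_regular.
Context {R : realType} (alpha : R).

(** exp(alpha conj(t) conj(z)) is antiholomorphic in t, so its conjugate e2 = exp(alpha t z) is
    used. With e1 = exp(alpha t conj(z)), kA + i kA' = (e1 + e2) / 2 and kB + i kB' = - i (e1 - e2)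
    / 2. *)
Lemma holo_kernel (z : R * R) :
  exists p q p' q', holo (kA alpha z) (kA' alpha z) p q /\
    holo (kB alpha z) (kB' alpha z) p' q'.
Proof.
have h1 := holo_exp (alpha * z.1) (- alpha * z.2) (0, 0).
have h2 := holo_exp (alpha * z.1) (alpha * z.2) (0, 0).
have hA := holoM (holo_cst (2^-1) 0) (holoD h1 h2).
have hB := holoM (holo_cst 0 (- 2^-1)) (holoD h1 (holoM (holo_cst (-1) 0) h2)).
have e1 t : expR (alpha * z.1 * (t.1 - 0) - - alpha * z.2 * (t.2 - 0)) =
  kexp1 alpha z t by congr expR; ring.
have e2 t : expR (alpha * z.1 * (t.1 - 0) - alpha * z.2 * (t.2 - 0)) =
  kexp2 alpha z t by congr expR; ring.
have t1 t : alpha * z.1 * (t.2 - 0) + - alpha * z.2 * (t.1 - 0) =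
  karg1 alpha z t by rewrite /karg1; ring.
have t2 t : alpha * z.1 * (t.2 - 0) + alpha * z.2 * (t.1 - 0) =
  - karg2 alpha z t by rewrite /karg2; ring.
do 4!eexists; split.
- by apply: (eq_holo hA); try exact: frefl; move=> t /=;
    rewrite e1 e2 t1 t2 ?cosN ?sinN /kA /kA'; field.
- by apply: (eq_holo hB); try exact: frefl; move=> t /=;
    rewrite e1 e2 t1 t2 ?cosN ?sinN /kB /kB'; field.
Qed.

Lemma normalized_kernel_regular (z : quat R) :
  slice_regular (normalized_kernel alpha z).
Proof.
have [J SJ zE] := exists_slice z.
set x := z.1 in zE; set y := enorm z.2 in zE.
have [p [q [p' [q' [hA hB]]]]] := holo_kernel (x, y).
pose e := expR (- (alpha / 2) * qnorm z ^+ 2).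
(* Replacing v by -v exchanges the two exponentials, which gives the parities of the four
   components. *)
have sw u v : [/\ kexp1 alpha (x, y) (u, - v) = kexp2 alpha (x, y) (u, v),
    kexp2 alpha (x, y) (u, - v) = kexp1 alpha (x, y) (u, v),
    karg1 alpha (x, y) (u, - v) = karg2 alpha (x, y) (u, v) &
    karg2 alpha (x, y) (u, - v) = karg1 alpha (x, y) (u, v)].
  by split; rewrite /kexp1 /kexp2 /karg1 /karg2/=; (try congr expR); ring.
apply: (holo_slice_regular (c1 := e *: 1) (c2 := e *: J) hA hB).
- by move=> u v; rewrite /kA; have [-> -> -> ->] := sw u v; rewrite addrC.
- by move=> u v; rewrite /kB; have [-> -> -> ->] := sw u v; rewrite addrC.
- by move=> u v; rewrite /kA'; have [-> -> -> ->] := sw u v; rewrite -[RHS]mulNr opprB.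
- by move=> u v; rewrite /kB'; have [-> -> -> ->] := sw u v; rewrite -[RHS]mulNr opprB.
move=> u v I SI; rewrite /normalized_kernel -/e zE Fock_kernelE//.
move: (kA _ _ _) (kA' _ _ _) (kB _ _ _) (kB' _ _ _) => a a' b b'.
rewrite mulrDr -!scalerAr mulr1 !scalerDr !scalerA ![_ * e]mulrC.
by rewrite -!addrA; congr (_ + _); rewrite addrCA.
Qed.

End kernel_slice_regular.

(** * Integration against the slice volume *)

Lemma ge0_fubini_restrict d1 d2 (T1 : measurableType d1) (T2 : measurableType d2)
    (R : realType) (m1 : {sigma_finite_measure set T1 -> \bar R})
    (m2 : {sigma_finite_measure set T2 -> \bar R}) (D : set T1)
    (f : T1 * T2 -> \bar R) : measurable D -> measurable_fun setT f ->
  (forall t, 0 <= f t)%E ->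
  (\int[m1 \x m2]_(t in D `*` setT) f t =
   \int[m1]_(x in D) \int[m2]_y f (x, y))%E.
Proof.
move=> mD mf f0; rewrite integral_mkcond fubini_tonelli1/=; first last.
- by move=> t; apply: erestrict_ge0.
- apply/(measurable_restrictT _ _).1 => //; first exact: measurableX.
  exact: measurable_funTS.
rewrite [RHS]integral_mkcond; apply: eq_integral => x _.
rewrite /fubini_F !patchE; case: ifPn => Dx.
  by apply: eq_integral => y _; rewrite patchE ifT//; move: Dx; rewrite !inE.
apply: integral0_eq => y _; rewrite patchE ifF//; apply/negbTE.
by apply: contra Dx; rewrite !inE => -[].
Qed.

Section slice_volume_integral.
Context {R : realType}.
Local Notation leb := (@lebesgue_measure R).
Local Notation R3 :=
  (measurableTypeR R * measurableTypeR R * measurableTypeR R)%type.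

Lemma ge0_integral_mrestr d (T : measurableType d)
    (m : {measure set T -> \bar R}) (D : set T) (mD : measurable D)
    (f : T -> \bar R) :
  measurable_fun setT f -> (forall x, 0 <= f x)%E ->
  (\int[mrestr m mD]_x f x = \int[m]_(x in D) f x)%E.
Proof.
move=> mf f0; rewrite -(setvU D) ge0_integral_setU//; first last.
- by apply/disj_setPS; rewrite setICl.
- exact: measurable_funTS.
- exact: measurableC.
rewrite [X in (X + _)%E](_ : _ = 0%E) ?add0e.
  apply: eq_measure_integral => A mA AD.
  by rewrite /= /mrestr setIidl.
rewrite (eq_measure_integral mzero); last first.
  move=> A mA AD; rewrite /= /mrestr /mzero (_ : A `&` D = set0) ?measure0//.
  by rewrite -subset0 => x [/AD].
exact: integral_measure_zero.
Qed.

Definition upper_half : set (measurableTypeR R * measurableTypeR R) :=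
  [set t | 0 < t.2].

Lemma measurable_upper_half : measurable upper_half.
Proof.
apply: open_measurable2; apply: (@open_comp _ _ snd [set y : R | 0 < y]).
  by move=> ? _; exact: cvg_snd.
exact: open_gt.
Qed.

Lemma integral_slice_volume (g : quat R -> \bar R) :
  measurable_fun setT g -> (forall q, 0 <= g q)%E ->
  (\int[slice_volume]_q g q =
   \int[leb2]_(t in upper_half)
     \int[sphere_measure]_I g (qpt t.1 t.2 I))%E.
Proof.
move=> mg g0.
have mgp : measurable_fun setT (g \o polar).
  by apply: measurableT_comp => //; exact: measurable_polar.
transitivity (\int[mrestr ((leb \x leb) \x sphere_measure) measurable_upper]_t
    (g \o polar) t)%E.
  transitivity (\int[pushforward
    (mrestr ((leb \x leb) \x sphere_measure) measurable_upper) polar]_t g t)%E.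
    by apply: eq_measure_integral.
  by rewrite ge0_integral_pushforward//; exact: measurable_polar.
transitivity (\int[(leb \x leb) \x sphere_measure]_(t in upper)
    (g \o polar) t)%E.
  by apply: ge0_integral_mrestr => // t; exact: g0.
have -> : @upper R = upper_half `*` setT.
  by apply/seteqP; split => [t|t []].
exact: (@ge0_fubini_restrict _ _ _ _ _ leb2 sphere_measure _ _
  measurable_upper_half mgp (fun t => g0 (polar t))).
Qed.

Lemma measurable_inner_integral (g : quat R -> \bar R) :
  measurable_fun setT g -> (forall q, 0 <= g q)%E ->
  measurable_fun upper_half
    (fun t => \int[sphere_measure]_I g (qpt t.1 t.2 I))%E.
Proof.
move=> mg g0.
have mgp : measurable_fun setT (g \o polar).
  by apply: measurableT_comp => //; exact: measurable_polar.
have := @measurable_fun_fubini_tonelli_F _ _ _ _ _ sphere_measure _ mgp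
  (fun t => g0 (polar t)).
exact: measurable_funTS.
Qed.

Lemma sphere_measureE (A : set (quat R)) : measurable A ->
  sphere_measure A =
  (lebesgue3 (direction @^-1` A `&` ball3) *
    (fine (lebesgue3 ball3))^-1%:E)%E.
Proof.
move=> mA; rewrite /sphere_measure /distribution/= /pushforward /mnormalize/=.
have -> : mrestr lebesgue3 measurable_ball3 setT = lebesgue3 (@ball3 R).
  by rewrite /mrestr setTI.
rewrite ifF// gt_eqF ?lebesgue3_ball3_gt0//=.
by rewrite lt_eqF ?lebesgue3_ball3_lty.
Qed.

Lemma measurable_qsphere : measurable (qsphere R).
Proof.
have -> : qsphere R = (fst @^-1` [set 0]) `&`
    ((fun q => enorm q.2) @^-1` [set 1]).
  by apply/seteqP; split => q; [case/qsphereP|move=> qS; exact/qsphereP].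
have m1 : measurable_fun setT (fst : quat R -> measurableTypeR R).
  exact: (@measurable_fst _ _ (measurableTypeR R) R3).
have m2 : measurable_fun setT (fun q : quat R => enorm q.2).
  by apply: measurable_enorm; exact: (@measurable_snd _ _ (measurableTypeR R) R3).
by apply: measurableI; rewrite -[X in measurable X]setTI; [apply: m1|apply: m2].
Qed.

(** The origin is the only vector whose [direction] is not an imaginary unit, and it is Lebesgue
    null. *)
Lemma sphere_measure_compl : sphere_measure (~` qsphere R) = 0%E.
Proof.
have mS := measurableC measurable_qsphere.
rewrite sphere_measureE// (_ : lebesgue3 _ = 0%E) ?mul0e//.
have l0 : lebesgue3 [set ((0, 0, 0) : R3)] = 0%E.
  have -> : [set ((0, 0, 0) : R3)] = ([set 0] `*` [set 0]) `*` [set 0].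
    by apply/seteqP; split => [_ -> //|[[a b] c] [[/= -> ->] ->]].
  rewrite /lebesgue3/= product_measure1E/=; [|by do ?apply: measurableX|by []].
  by rewrite lebesgue_measure_set1 mule0.
apply/eqP; rewrite eq_le measure_ge0 andbT -l0 le_measure ?inE//.
- apply: measurableI; last exact: measurable_ball3.
  by rewrite -[X in measurable X]setTI; exact: measurable_direction.
- have -> : [set ((0, 0, 0) : R3)] = ([set 0] `*` [set 0]) `*` [set 0].
    by apply/seteqP; split => [_ -> //|[[a b] c] [[/= -> ->] ->]].
  by do ?apply: measurableX.
move=> v [/= vS _]; apply: enorm_eq0; apply/eqP/negPn/negP => v0.
by apply: vS; exact: direction_sphere.
Qed.

End slice_volume_integral.

(** * A uniform lower bound for the mass of hemispheres *)

Section hemisphere.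
Context {R : realType}.
Local Notation leb := (@lebesgue_measure R).
Local Notation R3 :=
  (measurableTypeR R * measurableTypeR R * measurableTypeR R)%type.

Definition dot3 (v w : R * R * R) : R :=
  v.1.1 * w.1.1 + v.1.2 * w.1.2 + v.2 * w.2.

Definition hemisphere (c : R * R * R) : set (quat R) :=
  [set I | qsphere R I /\ 0 <= dot3 c I.2].

Lemma measurable_hemisphere c : measurable (hemisphere c).
Proof.
apply: measurableI; first exact: measurable_qsphere.
have m2 := @measurable_snd _ _ (measurableTypeR R) R3.
have m1 := measurableT_comp measurable_fst m2.
have mv := measurableT_comp measurable_snd m2.
have m11 := measurableT_comp measurable_fst m1.
have m12 := measurableT_comp measurable_snd m1.
rewrite -[X in measurable X]setTI.
apply: (measurable_fun_le (f := cst 0) (g := fun q : quat R => dot3 c q.2)) => //.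
by apply: measurable_funD; [apply: measurable_funD|]; exact: measurable_funM.
Qed.

(** Length 1/2, on the side where a x >= 0. Open at 0, so that the vector is nonzero and has a unit
    direction; three coordinates of size at most 1/2 stay in the ball, since 3/4 < 1. *)
Let side (a : R) : set (measurableTypeR R) :=
  if 0 <= a then `]0%R, 2^-1%R]%classic else `[(- 2^-1)%R, 0%R[%classic.

Let measurable_side a : measurable (side a).
Proof. by rewrite /side; case: ifP => _; exact: measurable_itv. Qed.

Let lebesgue_side a : leb (side a) = (2^-1)%:E.
Proof.
have h0 : (0 : R) < 2^-1 by rewrite invr_gt0.
rewrite /side; case: ifP => _; rewrite lebesgue_measure_itv/= lte_fin.
  by rewrite h0 oppr0 adde0.
by rewrite oppr_lt0 h0 opprK add0e.
Qed.

Let sideP a x : side a x -> [/\ 0 <= a * x, x ^+ 2 <= 4^-1 & x != 0].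
Proof.
rewrite /side; case: (leP 0 a) => a0; rewrite /= in_itv/= => /andP[x1 x2].
  by split; [rewrite mulr_ge0// ltW|nra|rewrite gt_eqF].
by split; [rewrite mulr_le0 ?ltW|nra|rewrite lt_eqF].
Qed.

(* Some octant of the ball lies in the cone over the given hemisphere. *)
Lemma hemisphere_measure_ge :
  exists2 k : R, 0 < k & forall c, (k%:E <= sphere_measure (hemisphere c))%E.
Proof.
pose V := fine (lebesgue3 (@ball3 R)).
have V0 : 0 < V by rewrite fine_gt0// lebesgue3_ball3_gt0 lebesgue3_ball3_lty.
exists (8^-1 / V); first by rewrite divr_gt0.
move=> c; rewrite sphere_measureE; last exact: measurable_hemisphere.
rewrite -/V EFinM lee_pmul2r//; last by rewrite lte_fin invr_gt0.
pose B : set R3 := (side c.1.1 `*` side c.1.2) `*` side c.2.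
have mB : measurable B by do 2?apply: measurableX; exact: measurable_side.
have -> : (8^-1)%:E = lebesgue3 B.
  rewrite /lebesgue3/= product_measure1E/=; last 2 first.
  - by apply: measurableX; exact: measurable_side.
  - exact: measurable_side.
  rewrite product_measure1E/=; try exact: measurable_side.
  rewrite !lebesgue_side -!EFinM; congr EFin.
  by field.
apply: le_measure; rewrite ?inE//.
  apply: measurableI; last exact: measurable_ball3.
  rewrite -[X in measurable X]setTI.
  by apply: measurable_direction => //; exact: measurable_hemisphere.
move=> [[x y] z] [[/= /sideP[x1 x2 x0] /sideP[y1 y2 _]] /sideP[z1 z2 _]].
have e0 : enorm (x, y, z) != 0.
  by apply/eqP => /enorm_eq0 -[xE _ _]; rewrite xE eqxx in x0.
split; last first.
  rewrite /ball3/= -(@ler_pXn2r _ 2) ?nnegrE ?enorm_ge0// expr1n enorm_sqr/=.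
  by lra.
split; first exact: direction_sphere.
rewrite /dot3 /direction/= !mulrA -!mulrDl divr_ge0 ?enorm_ge0//.
by rewrite !addr_ge0.
Qed.

End hemisphere.

(** * Comparison of volume integrals with plane integrals *)

Section slice_volume_bounds.
Context {R : realType}.

Lemma measurable_qpt (t : R * R) :
  measurable_fun setT (fun I : quat R => qpt t.1 t.2 I).
Proof.
have mt : measurable_fun setT (fun I : quat R =>
    (t, I) : (measurableTypeR R * measurableTypeR R) * quat R).
  by apply/measurable_fun_pair; [exact: measurable_cst|exact: measurable_id].
exact: (measurableT_comp (@measurable_polar R) mt).
Qed.

Lemma slice_volume_integral_le (g : quat R -> R) (G : R * R -> R) :
  measurable_fun setT g -> (forall q, 0 <= g q) ->
  measurable_fun setT (G : measurableTypeR R * measurableTypeR R -> R) ->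
  (forall x y I, qsphere R I -> g (qpt x y I) <= G (x, y)) ->
  (\int[slice_volume]_q (g q)%:E <= \int[leb2]_t (G t)%:E)%E.
Proof.
move=> mg g0 mG gG.
have mEg : measurable_fun setT (fun q => (g q)%:E) by exact/measurable_EFinP.
have mEG : measurable_fun setT
    (fun t : measurableTypeR R * measurableTypeR R => (G t)%:E).
  exact/measurable_EFinP.
have G0 t : 0 <= G t.
  case: t => x y; apply: le_trans (gG x y (@qi R) qsphere_qi); exact: g0.
have G0' (t : measurableTypeR R * measurableTypeR R) : (0 <= (G t)%:E)%E.
  by rewrite lee_fin.
have g0' q : (0 <= (g q)%:E)%E by rewrite lee_fin.
rewrite integral_slice_volume//.
apply: (@le_trans _ _ (\int[leb2]_(t in upper_half) (G t)%:E)%E); last first.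
  by apply: ge0_subset_integral => //; exact: (@measurable_upper_half R).
apply: ge0_le_integral => //.
- exact: (@measurable_upper_half R).
- by move=> t _; apply: integral_ge0.
- exact: (measurable_inner_integral mEg g0').
- exact: (measurable_funTS mEG).
move=> t _.
have mp : measurable_fun setT (fun I : quat R => (g (qpt t.1 t.2 I))%:E).
  exact: (measurableT_comp mEg (measurable_qpt t)).
apply: (@le_trans _ _ (\int[sphere_measure]_I cst (G t)%:E I)%E); last first.
  rewrite integral_cst// -[leRHS]mule1.
  by apply: lee_wpmul2l; [rewrite lee_fin|exact: probability_le1].
apply: ae_ge0_le_integral => //; first by move=> I _; rewrite lee_fin.
exists (~` qsphere R); split.
- by apply: measurableC; exact: measurable_qsphere.
- exact: sphere_measure_compl.
move=> I Hn SI; apply: Hn => _; rewrite lee_fin.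
by have := gG t.1 t.2 I SI; rewrite -surjective_pairing.
Qed.

(** The hemisphere may vary with the point in any manner, even a nonmeasurable one: only the uniform
    bound [k] of its mass enters the outer integral. *)
Lemma slice_volume_integral_ge (g : quat R -> R) (G : R * R -> R) (k : R) :
  0 < k -> (forall c, (k%:E <= sphere_measure (hemisphere c))%E) ->
  measurable_fun setT g -> (forall q, 0 <= g q) ->
  measurable_fun setT (G : measurableTypeR R * measurableTypeR R -> R) ->
  (forall t, 0 <= G t) ->
  (forall x y, exists c, forall I, hemisphere c I -> G (x, y) <= g (qpt x y I)) ->
  (k%:E * \int[leb2]_(t in upper_half) (G t)%:E <=
   \int[slice_volume]_q (g q)%:E)%E.
Proof.
move=> k0 kP mg g0 mG G0 gG.
have mEg : measurable_fun setT (fun q => (g q)%:E) by exact/measurable_EFinP.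
have mEG : measurable_fun upper_half
    (fun t : measurableTypeR R * measurableTypeR R => (G t)%:E).
  exact/measurable_funTS/measurable_EFinP.
have g0' q : (0 <= (g q)%:E)%E by rewrite lee_fin.
have mU := @measurable_upper_half R.
rewrite integral_slice_volume// -ge0_integralZl//; last 2 first.
- by move=> t _; rewrite lee_fin.
- by rewrite lee_fin ltW.
apply: ge0_le_integral => //.
- by move=> t _; rewrite mule_ge0// lee_fin// ltW.
- exact: emeasurable_funM.
- exact: (measurable_inner_integral mEg g0').
move=> [x y] _ /=; have [c cP] := gG x y.
have mp : measurable_fun setT (fun I : quat R => (g (qpt x y I))%:E).
  exact: (measurableT_comp mEg (measurable_qpt (x, y))).
have mh := measurable_hemisphere c.
apply: (@le_trans _ _
  (\int[sphere_measure]_(I in hemisphere c) (g (qpt x y I))%:E)%E); last first.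
  exact: ge0_subset_integral.
apply: (@le_trans _ _ (\int[sphere_measure]_(I in hemisphere c) cst (G (x, y))%:E I)%E).
  rewrite integral_cst// [leLHS]muleC.
  by apply: lee_wpmul2l; [rewrite lee_fin|exact: kP].
apply: ge0_le_integral => //; first by move=> I _; rewrite lee_fin.
exact: (measurable_funTS mp).
Qed.

(** The value is the same for all centers, which bounds all kernels at once. Variance 1 / (2 a)
    makes each factor a normal density divided by [normal_peak]. *)
Lemma gaussian_plane_integral (a : R) : 0 < a ->
  exists M : R, forall x y,
    (\int[leb2]_t (expR (- a * ((t.1 - x) ^+ 2 + (t.2 - y) ^+ 2)))%:E = M%:E)%E.
Proof.
move=> a0; pose s : R := Num.sqrt ((2 * a)^-1).
have s0 : s != 0 by rewrite gt_eqF// sqrtr_gt0 invr_gt0 mulr_gt0.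
have s2 : s ^+ 2 = (2 * a)^-1 by rewrite sqr_sqrtr// invr_ge0 mulr_ge0// ltW.
pose P := normal_peak s; have P0 : 0 < P by exact: normal_peak_gt0.
have E x u : expR (- a * (u - x) ^+ 2) = P^-1 * normal_pdf x s u.
  rewrite normal_pdfE// mulKf ?gt_eqF// /normal_fun s2; congr expR.
  by rewrite mulr2n; field; rewrite gt_eqF.
have I1 x : (\int[lebesgue_measure]_u (expR (- a * (u - x) ^+ 2))%:E = (P^-1)%:E)%E.
  under eq_integral do rewrite E EFinM.
  rewrite ge0_integralZl//.
  - by rewrite integral_normal_pdf mule1.
  - apply/measurable_EFinP; exact: measurable_normal_pdf.
  - by move=> u _; rewrite lee_fin normal_pdf_ge0.
  - by rewrite lee_fin invr_ge0 ltW.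
have mexp x : measurable_fun setT
    (fun u : measurableTypeR R => expR (- a * (u - x) ^+ 2)).
  apply: (measurableT_comp (@measurable_expR R)); apply: measurable_funM => //.
  by apply: measurable_funX; apply: measurable_funB.
exists (P^-1 * P^-1) => x y.
transitivity (\int[leb2]_t
    ((expR (- a * (t.1 - x) ^+ 2))%:E * (expR (- a * (t.2 - y) ^+ 2))%:E))%E.
  by apply: eq_integral => t _; rewrite mulrDr expRD EFinM.
have mf : measurable_fun setT (fun t : measurableTypeR R * measurableTypeR R =>
    ((expR (- a * (t.1 - x) ^+ 2))%:E * (expR (- a * (t.2 - y) ^+ 2))%:E)%E).
  apply: emeasurable_funM; apply/measurable_EFinP.
    exact: (measurableT_comp (mexp x) measurable_fst).
  exact: (measurableT_comp (mexp y) measurable_snd).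
rewrite /leb2 (fubini_tonelli1 _ mf)/=; last first.
  by move=> t; rewrite mule_ge0// lee_fin expR_ge0.
rewrite /fubini_F /=.
transitivity (\int[lebesgue_measure]_u
    ((P^-1)%:E * (expR (- a * (u - x) ^+ 2))%:E))%E.
  apply: eq_integral => u _; rewrite ge0_integralZl//.
  - by rewrite I1 muleC.
  - exact/measurable_EFinP.
rewrite ge0_integralZl//.
- by rewrite I1 EFinM.
- exact/measurable_EFinP.
- by rewrite lee_fin invr_ge0 ltW.
Qed.

End slice_volume_bounds.

(** * The norm N attached to a slice regular function *)

Section slice_regular_norm.
Context {R : realType}.

Lemma is_derive_proj (pi : quat R -> R) (g : R * R -> quat R) (t v : R * R) :
  continuous pi -> (forall x y, pi (x - y) = pi x - pi y) ->
  (forall (k : R) x, pi (k *: x) = k * pi x) ->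
  derivable g t v -> is_derive t v (fun s => pi (g s)) (pi ('D_v g t)).
Proof.
move=> cpi piB piZ dg.
have cv : h^-1 *: (pi (g (h *: v + t)) - pi (g t)) @[h --> 0^'] --> pi ('D_v g t).
  rewrite (_ : (fun h => _) = pi \o
      (fun h => h^-1 *: ((g \o shift t) (h *: v) - g t))); last first.
    by apply/funext => h; rewrite /= piZ piB.
  by apply: (cvg_comp _ _ dg); exact: cpi.
by apply: DeriveDef; [apply: cvgP cv|apply/cvg_lim].
Qed.

Lemma is_derive_line1 (g : R * R -> R) (t : R * R) (dg : R) :
  is_derive t (1, 0) g dg ->
  is_derive t.1 (1 : R) (fun s => g (s, t.2)) dg.
Proof.
case: t => x y [/= dg1 dg2].
have E : (fun h : R => h^-1 *: ((g \o shift (x, y)) (h *: (1, 0)) - g (x, y))) =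
  (fun h : R => h^-1 *: (((fun s => g (s, y)) \o shift x) (h *: 1) - g (x, y))).
  apply/funext => h; congr (_ *: (g _ - _)).
  transitivity ((h * 1 + x, h * 0 + y) : R * R) => //.
  by rewrite mulr0 add0r.
by apply: DeriveDef; [move: dg1|rewrite -dg2]; rewrite /derivable /derive E.
Qed.

Lemma is_derive_line2 (g : R * R -> R) (t : R * R) (dg : R) :
  is_derive t (0, 1) g dg ->
  is_derive t.2 (1 : R) (fun s => g (t.1, s)) dg.
Proof.
case: t => x y [/= dg1 dg2].
have E : (fun h : R => h^-1 *: ((g \o shift (x, y)) (h *: (0, 1)) - g (x, y))) =
  (fun h : R => h^-1 *: (((fun s => g (x, s)) \o shift y) (h *: 1) - g (x, y))).
  apply/funext => h; congr (_ *: (g _ - _)).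
  transitivity ((h * 0 + x, h * 1 + y) : R * R) => //.
  by rewrite mulr0 add0r.
by apply: DeriveDef; [move: dg1|rewrite -dg2]; rewrite /derivable /derive E.
Qed.

(** A coordinate of H turns the quaternionic Cauchy-Riemann system into a real one; continuity of
    the partial derivatives then gives differentiability. *)
Lemma holo_proj (pi : quat R -> R) (f0 f1 : R * R -> quat R) :
  continuous pi -> (forall x y, pi (x - y) = pi x - pi y) ->
  (forall (k : R) x, pi (k *: x) = k * pi x) ->
  C1 f0 -> C1 f1 ->
  (forall t, partial_x f0 t - partial_y f1 t = 0) ->
  (forall t, partial_y f0 t + partial_x f1 t = 0) ->
  holo (fun t => pi (f0 t)) (fun t => pi (f1 t))
    (fun t => pi (partial_x f0 t)) (fun t => pi (partial_x f1 t)).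
Proof.
move=> cpi piB piZ [d0x d0y c0x c0y] [d1x d1y c1x c1y] CR1 CR2.
have piN x : pi (- x) = - pi x by rewrite -scaleN1r piZ mulN1r.
have y1E t : partial_y f1 t = partial_x f0 t by apply/eqP; rewrite eq_sym -subr_eq0 CR1.
have y0E t : partial_y f0 t = - partial_x f1 t by apply/eqP; rewrite -addr_eq0 CR2.
have cc (g : R * R -> quat R) : continuous g -> continuous (fun t => pi (g t)).
  by move=> cg t; apply: continuous_comp; [exact: cg|exact: cpi].
split; last 2 first.
- exact: cc.
- exact: cc.
- apply: is_diff_partials.
  + move=> x y; have := is_derive_proj cpi piB piZ (d0x (x, y)).
    by move/is_derive_line1.
  + move=> x y; have := is_derive_proj cpi piB piZ (d0y (x, y)).
    by move/is_derive_line2; rewrite -/(partial_y f0 (x, y)) y0E piN.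
  + exact: cc.
  + by move=> t; apply: cvgN; exact: cc.
- apply: is_diff_partials.
  + move=> x y; have := is_derive_proj cpi piB piZ (d1x (x, y)).
    by move/is_derive_line1.
  + move=> x y; have := is_derive_proj cpi piB piZ (d1y (x, y)).
    by move/is_derive_line2; rewrite -/(partial_y f1 (x, y)) y1E.
  + exact: cc.
  + exact: cc.
Qed.

(* With u = f0 and v = f1, the inner product of u and I v is linear in I; these
   are its coefficients. *)
Definition qcross (u v : quat R) : R * R * R :=
  (- u.1 * v.2.1.1 + u.2.1.1 * v.1 - u.2.1.2 * v.2.2 + u.2.2 * v.2.1.2,
   - u.1 * v.2.1.2 + u.2.1.1 * v.2.2 + u.2.1.2 * v.1 - u.2.2 * v.2.1.1,
   - u.1 * v.2.2 - u.2.1.1 * v.2.1.2 + u.2.1.2 * v.2.1.1 + u.2.2 * v.1).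

Lemma qnorm_slice (u v I : quat R) : qsphere R I ->
  qnorm (u + I * v) ^+ 2 =
  qnorm u ^+ 2 + qnorm v ^+ 2 + 2 * dot3 (qcross u v) I.2.
Proof.
move=> /qsphereP[I0 I1]; have := enorm_sqr I.2; rewrite I1 expr1n.
case: I I0 {I1} => i0 [[i1 i2] i3] /= -> nI.
case: u => u0 [[u1 u2] u3]; case: v => v0 [[v1 v2] v3].
rewrite qmulE.
transitivity (qnorm ((u0 + (0 * v0 - i1 * v1 - i2 * v2 - i3 * v3),
  (u1 + (0 * v1 + i1 * v0 + i2 * v3 - i3 * v2),
   u2 + (0 * v2 - i1 * v3 + i2 * v0 + i3 * v1),
   u3 + (0 * v3 + i1 * v2 - i2 * v1 + i3 * v0))) : quat R) ^+ 2) => //.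
rewrite !qnorm_sqrE /qdot /dot3 /qcross/=.
transitivity (u0 ^+ 2 + u1 ^+ 2 + u2 ^+ 2 + u3 ^+ 2 +
  (v0 ^+ 2 + v1 ^+ 2 + v2 ^+ 2 + v3 ^+ 2) * (i1 ^+ 2 + i2 ^+ 2 + i3 ^+ 2) +
  2 * ((- u0 * v1 + u1 * v0 - u2 * v3 + u3 * v2) * i1 +
       (- u0 * v2 + u1 * v3 + u2 * v0 - u3 * v1) * i2 +
       (- u0 * v3 - u1 * v2 + u2 * v1 + u3 * v0) * i3)); first by ring.
by rewrite -nI; ring.
Qed.

(** N^2 is the sum of the squares of the eight real coordinates of f0 and f1, which form four
    holomorphic pairs. The vector [c] vanishes on the real axis because f1 is odd there. *)
Lemma slice_regular_norm (f : quat R -> quat R) : slice_regular f ->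
  exists (N : R * R -> R) (c : R * R -> R * R * R), [/\ holo_norm N,
    [/\ continuous (fun t => (c t).1.1), continuous (fun t => (c t).1.2) &
        continuous (fun t => (c t).2)],
    forall x, c (x, 0) = (0, 0, 0) &
    forall x y I, qsphere R I ->
      qnorm (f (qpt x y I)) ^+ 2 = N (x, y) ^+ 2 + 2 * dot3 (c (x, y)) I.2].
Proof.
move=> [f0 [f1 [[ev od fE] C0 C1' CR1 CR2]]].
pose N t := Num.sqrt (qnorm (f0 t) ^+ 2 + qnorm (f1 t) ^+ 2).
have N2 t : N t ^+ 2 = qnorm (f0 t) ^+ 2 + qnorm (f1 t) ^+ 2.
  by rewrite sqr_sqrtr// addr_ge0// sqr_ge0.
pose pi0 (q : quat R) := q.1; pose pi1 (q : quat R) := q.2.1.1.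
pose pi2 (q : quat R) := q.2.1.2; pose pi3 (q : quat R) := q.2.2.
have c0 : continuous pi0 by move=> q; exact: cvg_fst.
have c3 : continuous pi3.
  by move=> q; apply: (@continuous_comp _ _ _ snd snd); exact: cvg_snd.
have c21 : continuous (fun q : quat R => q.2.1).
  by move=> q; apply: (@continuous_comp _ _ _ snd fst); [exact: cvg_snd|exact: cvg_fst].
have c1 : continuous pi1.
  by move=> q; apply: (@continuous_comp _ _ _ (fun q : quat R => q.2.1) fst);
    [exact: c21|exact: cvg_fst].
have c2 : continuous pi2.
  by move=> q; apply: (@continuous_comp _ _ _ (fun q : quat R => q.2.1) snd);
    [exact: c21|exact: cvg_snd].
have h0 := holo_proj c0 (fun _ _ => erefl) (fun _ _ => erefl) C0 C1' CR1 CR2.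
have h1 := holo_proj c1 (fun _ _ => erefl) (fun _ _ => erefl) C0 C1' CR1 CR2.
have h2 := holo_proj c2 (fun _ _ => erefl) (fun _ _ => erefl) C0 C1' CR1 CR2.
have h3 := holo_proj c3 (fun _ _ => erefl) (fun _ _ => erefl) C0 C1' CR1 CR2.
have N2E t : N t ^+ 2 = pi0 (f0 t) ^+ 2 + pi1 (f0 t) ^+ 2 + pi2 (f0 t) ^+ 2 +
    pi3 (f0 t) ^+ 2 + (pi0 (f1 t) ^+ 2 + pi1 (f1 t) ^+ 2 + pi2 (f1 t) ^+ 2 +
    pi3 (f1 t) ^+ 2) by rewrite N2 !qnorm_sqr !enorm_sqr !addrA.
have ca0 := holo_continuousl h0; have cb0 := holo_continuousr h0.
have ca1 := holo_continuousl h1; have cb1 := holo_continuousr h1.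
have ca2 := holo_continuousl h2; have cb2 := holo_continuousr h2.
have ca3 := holo_continuousl h3; have cb3 := holo_continuousr h3.
have cM (g h : R * R -> R) : continuous g -> continuous h ->
    continuous (fun t => g t * h t).
  by move=> cg ch t; apply: cvgM; [exact: cg|exact: ch].
have cD (g h : R * R -> R) : continuous g -> continuous h ->
    continuous (fun t => g t + h t).
  by move=> cg ch t; apply: cvgD; [exact: cg|exact: ch].
have cN (g : R * R -> R) : continuous g -> continuous (fun t => - g t).
  by move=> cg t; apply: cvgN; exact: cg.
have f10 x : f1 (x, 0) = 0.
  have := od x 0; rewrite oppr0 => /eqP; rewrite -addr_eq0 -mulr2n -scaler_nat.
  by rewrite scaler_eq0 pnatr_eq0/= => /eqP.
have N0 t : 0 <= N t by exact: sqrtr_ge0.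
exists N, (fun t => qcross (f0 t) (f1 t)); split.
- split => //.
  + have cS := cD _ _ (cD _ _ (cD _ _ (cD _ _ (cM _ _ ca0 ca0) (cM _ _ ca1 ca1))
      (cM _ _ ca2 ca2)) (cM _ _ ca3 ca3)) (cD _ _ (cD _ _ (cD _ _
      (cM _ _ cb0 cb0) (cM _ _ cb1 cb1)) (cM _ _ cb2 cb2)) (cM _ _ cb3 cb3)).
    move: cS; set S := (fun t => _) => cS.
    have -> : N = Num.sqrt \o S.
      by apply/funext => t; rewrite /N -N2 N2E !expr2.
    by move=> t; apply: continuous_comp; [exact: cS|exact: sqrt_continuous].
  + move=> x y; rewrite /N ev od; congr (Num.sqrt (_ + _)).
    by rewrite -scaleN1r qnormZ normrN1 mul1r.
  + move=> t.
    (* Of eight squares with sum N^2 one is at least N^2 / 9, whence the factor 3. A coordinate of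
       f1 becomes the first member of its pair by [holo_rot]. *)
    have case8 a b p q : holo a b p q ->
        (forall s, a s ^+ 2 + b s ^+ 2 <= N s ^+ 2) ->
        N t ^+ 2 <= 9 * a t ^+ 2 ->
        exists a b p q, [/\ holo a b p q,
          forall s, a s ^+ 2 + b s ^+ 2 <= N s ^+ 2 & N t <= 3 * `|a t|].
      move=> hab abN ta; exists a, b, p, q; split => //.
      rewrite -(@ler_pXn2r _ 2) ?nnegrE ?mulr_ge0// exprMn real_normK ?num_real//.
      by rewrite (_ : 3 ^+ 2 = 9 :> R)//; ring.
    have le0 s : pi0 (f0 s) ^+ 2 + pi0 (f1 s) ^+ 2 <= N s ^+ 2.
      rewrite N2E; have := sqr_ge0 (pi1 (f0 s)); have := sqr_ge0 (pi1 (f1 s)).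
      have := sqr_ge0 (pi2 (f0 s)); have := sqr_ge0 (pi2 (f1 s)).
      by have := sqr_ge0 (pi3 (f0 s)); have := sqr_ge0 (pi3 (f1 s)); lra.
    have le1 s : pi1 (f0 s) ^+ 2 + pi1 (f1 s) ^+ 2 <= N s ^+ 2.
      rewrite N2E; have := sqr_ge0 (pi0 (f0 s)); have := sqr_ge0 (pi0 (f1 s)).
      have := sqr_ge0 (pi2 (f0 s)); have := sqr_ge0 (pi2 (f1 s)).
      by have := sqr_ge0 (pi3 (f0 s)); have := sqr_ge0 (pi3 (f1 s)); lra.
    have le2 s : pi2 (f0 s) ^+ 2 + pi2 (f1 s) ^+ 2 <= N s ^+ 2.
      rewrite N2E; have := sqr_ge0 (pi1 (f0 s)); have := sqr_ge0 (pi1 (f1 s)).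
      have := sqr_ge0 (pi0 (f0 s)); have := sqr_ge0 (pi0 (f1 s)).
      by have := sqr_ge0 (pi3 (f0 s)); have := sqr_ge0 (pi3 (f1 s)); lra.
    have le3 s : pi3 (f0 s) ^+ 2 + pi3 (f1 s) ^+ 2 <= N s ^+ 2.
      rewrite N2E; have := sqr_ge0 (pi1 (f0 s)); have := sqr_ge0 (pi1 (f1 s)).
      have := sqr_ge0 (pi2 (f0 s)); have := sqr_ge0 (pi2 (f1 s)).
      by have := sqr_ge0 (pi0 (f0 s)); have := sqr_ge0 (pi0 (f1 s)); lra.
    have [|k0] := leP (N t ^+ 2) (9 * pi0 (f0 t) ^+ 2); first exact: (case8 _ _ _ _ h0).
    have [|k1] := leP (N t ^+ 2) (9 * pi1 (f0 t) ^+ 2); first exact: (case8 _ _ _ _ h1).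
    have [|k2] := leP (N t ^+ 2) (9 * pi2 (f0 t) ^+ 2); first exact: (case8 _ _ _ _ h2).
    have [|k3] := leP (N t ^+ 2) (9 * pi3 (f0 t) ^+ 2); first exact: (case8 _ _ _ _ h3).
    have [|l0] := leP (N t ^+ 2) (9 * pi0 (f1 t) ^+ 2).
      by apply: (case8 _ _ _ _ (holo_rot h0)) => s; rewrite sqrrN addrC; exact: le0.
    have [|l1] := leP (N t ^+ 2) (9 * pi1 (f1 t) ^+ 2).
      by apply: (case8 _ _ _ _ (holo_rot h1)) => s; rewrite sqrrN addrC; exact: le1.
    have [|l2] := leP (N t ^+ 2) (9 * pi2 (f1 t) ^+ 2).
      by apply: (case8 _ _ _ _ (holo_rot h2)) => s; rewrite sqrrN addrC; exact: le2.
    have [|l3] := leP (N t ^+ 2) (9 * pi3 (f1 t) ^+ 2).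
      by apply: (case8 _ _ _ _ (holo_rot h3)) => s; rewrite sqrrN addrC; exact: le3.
    by exfalso; have := sqr_ge0 (N t); have := N2E t; lra.
- split.
  + exact: (cD _ _ (cD _ _ (cD _ _ (cM _ _ (cN _ ca0) cb1) (cM _ _ ca1 cb0))
      (cN _ (cM _ _ ca2 cb3))) (cM _ _ ca3 cb2)).
  + exact: (cD _ _ (cD _ _ (cD _ _ (cM _ _ (cN _ ca0) cb2) (cM _ _ ca1 cb3))
      (cM _ _ ca2 cb0)) (cN _ (cM _ _ ca3 cb1))).
  + exact: (cD _ _ (cD _ _ (cD _ _ (cM _ _ (cN _ ca0) cb3)
      (cN _ (cM _ _ ca1 cb2))) (cM _ _ ca2 cb1)) (cM _ _ ca3 cb0)).
- by move=> x; rewrite f10 /qcross/= !mulr0 !addr0 !subr0.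
- by move=> x y I SI; rewrite fE// qnorm_slice// N2.
Qed.

End slice_regular_norm.

(** * Weighted values of slice regular functions *)

Section weighted_bounds.
Context {R : realType} (alpha p : R).
Hypotheses (alpha_gt0 : 0 < alpha) (p_gt0 : 0 < p).
Local Notation R3 :=
  (measurableTypeR R * measurableTypeR R * measurableTypeR R)%type.

Lemma weightedE (f : quat R -> quat R) z :
  weighted alpha f z = expR (- (alpha / 2) * qnorm z ^+ 2) * qnorm (f z).
Proof. by rewrite /weighted qnormZ ger0_norm ?expR_ge0. Qed.

Lemma weighted_ge0 (f : quat R -> quat R) z : 0 <= weighted alpha f z.
Proof. exact: qnorm_ge0. Qed.

Lemma qnorm_weighted (f : quat R -> quat R) z :
  qnorm (f z) = expR (alpha / 2 * qnorm z ^+ 2) * weighted alpha f z.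
Proof.
by rewrite weightedE mulrA -expRD mulNr subrr expR0 mul1r.
Qed.

Lemma measurable_plane :
  measurable_fun setT (fun q : quat R => (q.1, enorm q.2) :
    measurableTypeR R * measurableTypeR R).
Proof.
apply/measurable_fun_pair.
  exact: (@measurable_fst _ _ (measurableTypeR R) R3).
by apply: measurable_enorm; exact: (@measurable_snd _ _ (measurableTypeR R) R3).
Qed.

Lemma measurable_qnorm : measurable_fun setT (@qnorm R).
Proof.
apply: (measurableT_comp (f := @Num.sqrt R)).
  by apply: continuous_measurable_fun; exact: sqrt_continuous.
apply: measurable_funD; apply: measurable_funX.
  exact: (@measurable_fst _ _ (measurableTypeR R) R3).
by apply: measurable_enorm; exact: (@measurable_snd _ _ (measurableTypeR R) R3).
Qed.

(** The modulus is rebuilt from continuous functions of the plane coordinates and from the Borel map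
    [direction]. *)
Lemma measurable_weighted (f : quat R -> quat R) : slice_regular f ->
  measurable_fun setT (weighted alpha f).
Proof.
move=> /slice_regular_norm[N [c [[_ cN _ _] [c1 c2 c3] c0 fE]]].
have msnd := @measurable_snd _ _ (measurableTypeR R) R3.
have mdir := measurableT_comp (@measurable_direction R) msnd.
have mdirv := measurableT_comp (@measurable_snd _ _ (measurableTypeR R) R3) mdir.
have mdir1 := measurableT_comp measurable_fst mdirv.
have mdir11 := measurableT_comp measurable_fst mdir1.
have mdir12 := measurableT_comp measurable_snd mdir1.
have mdir2 := measurableT_comp measurable_snd mdirv.
have mp (g : R * R -> R) : continuous g ->
    measurable_fun setT (fun q : quat R => g (q.1, enorm q.2)).
  by move=> cg; exact: (measurableT_comp (continuous_measurable2 cg) measurable_plane).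
have -> : weighted alpha f = fun q =>
    expR (- (alpha / 2) * qnorm q ^+ 2) *
    Num.sqrt (N (q.1, enorm q.2) ^+ 2 +
      2 * dot3 (c (q.1, enorm q.2)) (direction q.2).2).
  apply/funext => q; rewrite weightedE; congr (_ * _).
  rewrite -[LHS]ger0_norm ?qnorm_ge0// -sqrtr_sqr; congr Num.sqrt.
  (* On the real axis [direction] is not a unit, but the formula survives because [c] vanishes
     there. *)
  have [q0|q0] := eqVneq (enorm q.2) 0; last first.
    by rewrite -(fE _ _ _ (direction_sphere q0)) -qpt_direction.
  have {1}-> : q = qpt q.1 (enorm q.2) qi.
    by rewrite q0 {1}(qpt_direction q) q0 /qpt !scale0r.
  rewrite fE; last exact: qsphere_qi.
  by rewrite q0 c0 /dot3/= !mul0r !addr0.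
apply: measurable_funM.
  apply: (measurableT_comp (@measurable_expR R)); apply: measurable_funM => //.
  by apply: measurable_funX; exact: measurable_qnorm.
apply: (measurableT_comp (f := @Num.sqrt R)).
  by apply: continuous_measurable_fun; exact: sqrt_continuous.
apply: measurable_funD; first by apply: measurable_funX; exact: mp.
apply: measurable_funM => //.
apply: measurable_funD; first apply: measurable_funD.
- by apply: measurable_funM; [exact: (mp _ c1)|exact: mdir11].
- by apply: measurable_funM; [exact: (mp _ c2)|exact: mdir12].
- by apply: measurable_funM; [exact: (mp _ c3)|exact: mdir2].
Qed.

Lemma measurable_weighted_powR (f : quat R -> quat R) : slice_regular f ->
  measurable_fun setT (fun q => weighted alpha f q `^ p).
Proof.
move=> fr; exact: (measurableT_comp (measurable_powR p) (measurable_weighted fr)).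
Qed.

Lemma gaussw_qpt x y I : qsphere R I ->
  expR (- (alpha / 2) * qnorm (qpt x y I) ^+ 2) = gaussw alpha (x, y).
Proof. by move=> SI; rewrite qnorm_qpt. Qed.

(** Upper bound: the cross terms at I and -I are opposite and |f|^2 >= 0 at -I, so |f|^2 <= 2 N^2 at
    I. Lower bound: the cross term is nonnegative on the hemisphere of [c]. *)
Lemma weighted_holo_norm (f : quat R -> quat R) : slice_regular f ->
  exists N, [/\ holo_norm N,
    forall x y I, qsphere R I ->
      weighted alpha f (qpt x y I) <= 2 * (N (x, y) * gaussw alpha (x, y)) &
    forall x y, exists c, forall I, hemisphere c I ->
      N (x, y) * gaussw alpha (x, y) <= weighted alpha f (qpt x y I)].
Proof.
move=> /slice_regular_norm[N [c [hN _ _ fE]]]; exists N.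
have [N0 _ _ _] := hN.
have dotN (v w : R * R * R) : dot3 v (- w) = - dot3 v w by rewrite /dot3 /=; ring.
split => // x y.
  move=> I SI; rewrite weightedE gaussw_qpt// mulrC mulrA ler_wpM2r ?expR_ge0//.
  rewrite -(@ler_pXn2r _ 2) ?nnegrE ?qnorm_ge0 ?mulr_ge0// fE// exprMn.
  have := fE x y (- I) (qsphereN SI); rewrite dotN.
  have := sqr_ge0 (qnorm (f (qpt x y (- I)))); have := sqr_ge0 (N (x, y)).
  by rewrite (_ : 2 ^+ 2 = 4 :> R); [lra|ring].
exists (c (x, y)) => I [SI cI]; rewrite weightedE gaussw_qpt//.
rewrite mulrC ler_wpM2l ?expR_ge0//.
by rewrite -(@ler_pXn2r _ 2) ?nnegrE ?qnorm_ge0// fE// lerDl mulr_ge0.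
Qed.

Lemma Fock_norm_le (f : quat R -> quat R) (M : R) :
  (Fock_norm alpha p f <= M%:E)%E ->
  (\int[slice_volume]_z (weighted alpha f z `^ p)%:E <=
    (`|M| `^ p / (p * alpha / pi))%:E)%E.
Proof.
move=> fM; have c0 : 0 < p * alpha / pi by rewrite divr_gt0 ?mulr_gt0 ?pi_gt0.
set X := (\int[slice_volume]_z _)%E.
have X0 : (0 <= X)%E by apply: integral_ge0 => z _; rewrite lee_fin powR_ge0.
have cX0 : (0 <= (p * alpha / pi)%:E * X)%E by rewrite mule_ge0// lee_fin ltW.
have : (((p * alpha / pi)%:E * X) `^ p^-1 <= (`|M|)%:E)%E.
  by apply: (le_trans fM); rewrite lee_fin ler_norm.
move=> /(gt0_ler_poweR (ltW p_gt0)).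
rewrite !in_itv/= !leey !andbT poweR_ge0 lee_fin normr_ge0 => /(_ erefl erefl).
rewrite -poweRrM mulVf ?gt_eqF// poweRe1// ?poweR_EFin.
by rewrite -lee_pdivlMl// -EFinM mulrC.
Qed.

Lemma Fock_norm_ge (f : quat R -> quat R) (B : R) :
  (\int[slice_volume]_z (weighted alpha f z `^ p)%:E <= B%:E)%E ->
  (Fock_norm alpha p f <= ((p * alpha / pi * `|B|) `^ p^-1)%:E)%E.
Proof.
move=> fB; have c0 : 0 < p * alpha / pi by rewrite divr_gt0 ?mulr_gt0 ?pi_gt0.
rewrite -poweR_EFin; apply: gt0_ler_poweR.
- by rewrite invr_ge0 ltW.
- rewrite in_itv/= leey andbT mule_ge0//; first by rewrite lee_fin ltW.
  by apply: integral_ge0 => z _; rewrite lee_fin powR_ge0.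
- by rewrite in_itv/= leey andbT lee_fin mulr_ge0// ltW.
rewrite [leRHS]EFinM; apply: lee_wpmul2l; first by rewrite lee_fin ltW.
by apply: (le_trans fB); rewrite lee_fin ler_norm.
Qed.

End weighted_bounds.

Section ereal_cvg0.
Context {R : realType}.

Lemma cvge0P {T : Type} (F : set_system T) {FF : Filter F} (f : T -> \bar R) :
  (forall t, (0 <= f t)%E) ->
  f @ F --> 0%E <-> forall e : R, 0 < e -> \forall t \near F, (f t < e%:E)%E.
Proof.
move=> f0; split => [f_cvg e e0|fe P].
  suff : \forall x \near f @ F, (x < e%:E)%E by [].
  apply: f_cvg; apply/nbhs_EFin; near=> x.
  by rewrite lte_fin (le_lt_trans (ler_norm _))//; near: x; exact: nbhs0_lt.
move=> /nbhs_EFin/nbhs_ballP[e /= e0 eP]; rewrite /= near_simpl.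
apply: filterS (fe e e0) => t /=; have := f0 t; rewrite /preimage/=.
case: (f t) => [x| |] //; rewrite lee_fin lte_fin => x0 xe.
by apply: eP; rewrite -ball_normE /= sub0r normrN ger0_norm.
Unshelve. all: by end_near. Qed.

End ereal_cvg0.

(** * Size of the normalized kernels *)

Section kernel_bounds.
Context {R : realType} (alpha p : R).
Hypotheses (alpha_gt0 : 0 < alpha) (p_gt0 : 0 < p).
Local Notation k := (normalized_kernel alpha).

Lemma expR_half_sqr (s : R) :
  expR (- (alpha / 2) * s) ^+ 2 = expR (- alpha * s).
Proof. by rewrite expr2 -expRD; congr expR; field. Qed.

(** Both (1 + s) / 2 and (1 - s) / 2 lie in [0, 1], and the root of a sum is at most the sum of the
    roots. *)
Lemma weighted_kernel_le (u v x y : R) I J : qsphere R I -> qsphere R J ->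
  weighted alpha (k (qpt x y J)) (qpt u v I) <=
    expR (- (alpha / 2) * ((u - x) ^+ 2 + (v - y) ^+ 2)) +
    expR (- (alpha / 2) * ((u - x) ^+ 2 + (v + y) ^+ 2)).
Proof.
move=> SI SJ.
have e1 := expR_ge0 (- (alpha / 2) * ((u - x) ^+ 2 + (v - y) ^+ 2)).
have e2 := expR_ge0 (- (alpha / 2) * ((u - x) ^+ 2 + (v + y) ^+ 2)).
rewrite -(@ler_pXn2r _ 2) ?nnegrE ?weighted_ge0 ?addr_ge0//.
rewrite weighted_kernel// sqrrD !expR_half_sqr /kweight2.
have d1 := expR_ge0 (- alpha * ((u - x) ^+ 2 + (v - y) ^+ 2)).
have d2 := expR_ge0 (- alpha * ((u - x) ^+ 2 + (v + y) ^+ 2)).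
have e12 := mulr_ge0 e1 e2.
have := qdot_sphere_le1 SI SJ; rewrite ler_norml => /andP[s1 s2].
move: s1 s2; set s := qdot I J => s1 s2.
have s3 : 0 <= 1 - s by rewrite subr_ge0.
have s4 : 0 <= 1 + s by rewrite -lerBlDl sub0r.
have h1 := mulr_ge0 s3 d1; have h2 := mulr_ge0 s4 d2.
rewrite mulr2n -subr_ge0; move: h1 h2 e12.
set D1 := expR (- alpha * _); set D2 := expR (- alpha * _) => h1 h2 e12.
rewrite (_ : _ - _ = (1 - s) * D1 / 2 + (1 + s) * D2 / 2 +
  (expR (- (alpha / 2) * ((u - x) ^+ 2 + (v - y) ^+ 2)) *
   expR (- (alpha / 2) * ((u - x) ^+ 2 + (v + y) ^+ 2))) * 2); last by field.
by rewrite !addr_ge0// ?divr_ge0// mulr_ge0.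
Qed.

(** Changing y to -y exchanges the two Gaussians, so their coefficients add up to 1 and the angle
    between I and J disappears. *)
Lemma weighted_kernel_conj (u v x y : R) I J : qsphere R I -> qsphere R J ->
  weighted alpha (k (qpt x y J)) (qpt u v I) ^+ 2 +
  weighted alpha (k (qpt x (- y) J)) (qpt u v I) ^+ 2 =
    expR (- alpha * ((u - x) ^+ 2 + (v - y) ^+ 2)) +
    expR (- alpha * ((u - x) ^+ 2 + (v + y) ^+ 2)).
Proof.
move=> SI SJ; apply: (etrans (f_equal2 +%R (weighted_kernel alpha u v x y SI SJ)
  (weighted_kernel alpha u v x (- y) SI SJ))).
rewrite /kweight2 opprK.
move: (expR (- alpha * ((u - x) ^+ 2 + (v - y) ^+ 2))) => D1.
move: (expR (- alpha * ((u - x) ^+ 2 + (v + y) ^+ 2))) => D2.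
by field.
Qed.

(** Through the larger of the two numbers, hence also for p < 1, where the power is not convex. *)
Lemma powRD_le (a b : R) : 0 <= a -> 0 <= b ->
  (a + b) `^ p <= 2 `^ p * (a `^ p + b `^ p).
Proof.
move=> a0 b0; have m0 : 0 <= Num.max a b by rewrite le_max a0.
apply: (@le_trans _ _ ((2 * Num.max a b) `^ p)).
  apply: ge0_ler_powR; rewrite ?nnegrE ?(ltW p_gt0) ?addr_ge0 ?mulr_ge0//.
  by rewrite mulr_natl mulr2n lerD// le_max lexx ?orbT.
rewrite powRM// ler_wpM2l ?powR_ge0//.
by case: (leP a b) => _; [rewrite lerDr|rewrite lerDl]; exact: powR_ge0.
Qed.

Lemma kernel_Fock_bounded : exists M : R, forall z : quat R,
  Fock alpha p (k z) /\ (Fock_norm alpha p (k z) <= M%:E)%E.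
Proof.
have a0 : 0 < alpha * p / 2 by rewrite divr_gt0// mulr_gt0.
have [M MP] := gaussian_plane_integral a0.
pose B := 2 `^ p * (M + M).
suff kB z : (\int[slice_volume]_w (weighted alpha (k z) w `^ p)%:E <= B%:E)%E.
  exists ((p * alpha / pi * `|B|) `^ p^-1) => z.
  have kz := Fock_norm_ge alpha_gt0 p_gt0 (kB z).
  split => //; split; first exact: normalized_kernel_regular.
  by rewrite (le_lt_trans kz)// ltry.
have [J SJ ->] := exists_slice z.
move: (z.1) (enorm z.2) => x y.
have powE s : expR (- (alpha / 2) * s) `^ p = expR (- (alpha * p / 2) * s).
  by rewrite -expRM; congr expR; field.
pose E (y : R) (t : R * R) :=
  expR (- (alpha * p / 2) * ((t.1 - x) ^+ 2 + (t.2 - y) ^+ 2)).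
have mE y' : measurable_fun setT (E y' : measurableTypeR R * measurableTypeR R -> R).
  apply: (measurableT_comp (@measurable_expR R)); apply: measurable_funM => //.
  by apply: measurable_funD; apply: measurable_funX; apply: measurable_funB.
apply: (@le_trans _ _ (\int[leb2]_t (2 `^ p * (E y t + E (- y) t))%:E)%E).
  apply: slice_volume_integral_le.
  - by apply: measurable_weighted_powR; exact: normalized_kernel_regular.
  - by move=> q; exact: powR_ge0.
  - by apply: measurable_funM => //; exact: measurable_funD.
  move=> u v I SI; apply: (le_trans (ge0_ler_powR _ _ _ (weighted_kernel_le u v x y SI SJ))).
  + exact: ltW.
  + by rewrite nnegrE weighted_ge0.
  + by rewrite nnegrE addr_ge0// expR_ge0.
  apply: (le_trans (powRD_le (expR_ge0 _) (expR_ge0 _))).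
  by rewrite !powE /E /= opprK.
under eq_integral do rewrite EFinM EFinD.
have mEE y' : measurable_fun setT
    (fun t : measurableTypeR R * measurableTypeR R => (E y' t)%:E).
  exact/measurable_EFinP.
have EE0 (t : measurableTypeR R * measurableTypeR R) :
    setT t -> (0 <= (E y t)%:E + (E (- y) t)%:E)%E.
  by move=> _; rewrite adde_ge0// lee_fin expR_ge0.
rewrite (ge0_integralZl _ _ _ EE0)//; last exact: emeasurable_funD.
have E0 y' (t : measurableTypeR R * measurableTypeR R) :
  setT t -> (0 <= (E y' t)%:E)%E by move=> _; rewrite lee_fin expR_ge0.
rewrite (ge0_integralD _ _ (E0 y) _ (E0 (- y)))//.
by rewrite !MP -EFinD -EFinM.
Qed.

(** Once the weight at w is removed, the gap between the two exponents is alpha / 4 times the square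
    |2 w - z|^2, for z and for its conjugate alike. *)
Lemma kernel_decay (z w : quat R) :
  qnorm (k z w) <= 2 * expR (alpha * qnorm w ^+ 2 - alpha / 4 * qnorm z ^+ 2).
Proof.
have [J SJ ->] := exists_slice z; have [I SI ->] := exists_slice w.
move: (z.1) (enorm z.2) (w.1) (enorm w.2) => x y u v.
rewrite (qnorm_weighted alpha).
apply: (le_trans (ler_wpM2l (expR_ge0 _) (weighted_kernel_le u v x y SI SJ))).
rewrite mulrDr -!expRD !qnorm_qpt// mulr_natl mulr2n.
have h (s : R) : alpha / 2 * (u ^+ 2 + v ^+ 2) +
    - (alpha / 2) * ((u - x) ^+ 2 + (v - s) ^+ 2) <=
    alpha * (u ^+ 2 + v ^+ 2) - alpha / 4 * (x ^+ 2 + s ^+ 2).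
  rewrite -subr_ge0 (_ : _ - _ = alpha / 4 *
    ((2 * u - x) ^+ 2 + (2 * v - s) ^+ 2)); last by field.
  by rewrite mulr_ge0 ?divr_ge0 ?addr_ge0 ?sqr_ge0// ltW.
apply: lerD; rewrite ler_expR; first exact: h.
by have := h (- y); rewrite opprK sqrrN.
Qed.

End kernel_bounds.

(** * Symmetric boxes and the two norms on H *)

Section boxes.
Context {R : realType}.

(** A point of a disk may be a + b I with b < 0; as [enorm z.2] is nonnegative, |b| is at least as
    close to it as b. The box is thus a condition on the plane coordinates alone. *)
Lemma symmetric_boxE (z : quat R) (r : R) : 0 < r ->
  symmetric_box z r = [set w |
    (w.1 - z.1) ^+ 2 + (enorm w.2 - enorm z.2) ^+ 2 < r ^+ 2].
Proof.
move=> r0; have diffE a b x y I :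
    qpt a b I - qpt x y I = qpt (a - x) (b - y) I :> quat R.
  rewrite /qpt scalerBl opprD addrACA; congr (_ + _).
  by transitivity ((a - x, (0 - 0, 0 - 0, 0 - 0)) : quat R) => //; rewrite subrr.
apply/seteqP; split => w /=.
  move=> [I SI [[a [b ->]]]]; rewrite diffE qpt_re// qpt_im// => ab.
  have : (a - z.1) ^+ 2 + (b - enorm z.2) ^+ 2 < r ^+ 2.
    by rewrite -(qnorm_qpt _ _ SI) ltrXn2r ?nnegrE ?qnorm_ge0// ltW.
  apply: le_lt_trans; rewrite lerD2l.
  have := enorm_ge0 z.2; have := ler_norm b; have := real_normK (num_real b).
  by rewrite !expr2; nra.
move=> wr; have [I SI wE] := exists_slice w.
exists I => //; split; first by exists w.1, (enorm w.2).
rewrite {1}wE diffE -(@ltr_pXn2r _ 2) ?nnegrE ?qnorm_ge0 ?(ltW r0)//.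
by rewrite qnorm_qpt.
Qed.

Lemma measurable_symmetric_box (z : quat R) (r : R) : 0 < r ->
  measurable (symmetric_box z r).
Proof.
move=> r0; rewrite symmetric_boxE//.
have mp := @measurable_plane R.
have m1 := measurableT_comp measurable_fst mp.
have m2 := measurableT_comp measurable_snd mp.
pose f (w : quat R) := (w.1 - z.1) ^+ 2 + (enorm w.2 - enorm z.2) ^+ 2.
have mf : measurable_fun setT f.
  by apply: measurable_funD; apply: measurable_funX; apply: measurable_funB.
rewrite (_ : [set w | _] = setT `&` f @^-1` `]-oo, r ^+ 2[%classic).
  by apply: mf => //; exact: measurable_itv.
by rewrite setTI; apply/seteqP; split => w /=; rewrite in_itv.
Qed.

End boxes.

Section norms.
Context {R : realType}.
Implicit Types q : quat R.

Lemma quat_normE q : `|q| = Num.max `|q.1|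
  (Num.max (Num.max `|q.2.1.1| `|q.2.1.2|) `|q.2.2|).
Proof. by []. Qed.

Lemma qnorm_le_norm q : qnorm q <= 2 * `|q|.
Proof.
rewrite -(@ler_pXn2r _ 2) ?nnegrE ?qnorm_ge0 ?mulr_ge0//.
rewrite qnorm_sqr enorm_sqr exprMn.
have sq (x : R) : `|x| <= `|q| -> x ^+ 2 <= `|q| ^+ 2.
  by move=> h; rewrite -(real_normK (num_real x)) lerXn2r ?nnegrE.
have h1 : q.1 ^+ 2 <= `|q| ^+ 2 by apply: sq; rewrite quat_normE le_max lexx.
have h2 : q.2.1.1 ^+ 2 <= `|q| ^+ 2.
  by apply: sq; rewrite quat_normE !le_max lexx !orbT.
have h3 : q.2.1.2 ^+ 2 <= `|q| ^+ 2.
  by apply: sq; rewrite quat_normE !le_max lexx !orbT.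
have h4 : q.2.2 ^+ 2 <= `|q| ^+ 2.
  by apply: sq; rewrite quat_normE !le_max lexx !orbT.
by rewrite (_ : 2 ^+ 2 = 4 :> R); [lra|ring].
Qed.

Lemma norm_le_qnorm q : `|q| <= qnorm q.
Proof.
have sq (x : R) : x ^+ 2 <= qnorm q ^+ 2 -> `|x| <= qnorm q.
  by move=> h; rewrite -(@ler_pXn2r _ 2) ?nnegrE ?qnorm_ge0// real_normK ?num_real.
have := sqr_ge0 q.1; have := sqr_ge0 q.2.1.1; have := sqr_ge0 q.2.1.2.
have := sqr_ge0 q.2.2 => h4 h3 h2 h1.
rewrite quat_normE !ge_max !sq// qnorm_sqr enorm_sqr; lra.
Qed.

End norms.

(** * From (a) to (b) and from (b) to (c) *)

Section carleson_to_boxes.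
Context {R : realType} (alpha p : R) (mu : {measure set (quat R) -> \bar R}).
Hypotheses (alpha_gt0 : 0 < alpha) (p_gt0 : 0 < p).
Local Notation k := (normalized_kernel alpha).

(* The integral in (b). *)
Definition kint z :=
  (\int[mu]_w (weighted alpha (normalized_kernel alpha z) w `^ p)%:E)%E.

Lemma kint_ge0 z : (0 <= kint z)%E.
Proof. by apply: integral_ge0 => w _; rewrite lee_fin powR_ge0. Qed.

Lemma slice_infty_nearP (I : quat R) (P : quat R -> Prop) :
  (\forall z \near slice_infty I, P z) <->
  exists M : R, forall z, qslice I z -> M < qnorm z -> P z.
Proof.
split => [[M _ MP]|[M MP]]; exists M => //.
  by move=> z Iz Mz; apply: MP.
by move=> z [Iz Mz]; exact: MP.
Qed.

Lemma kernel_cvg0 (z : nat -> quat R) : (forall n, n%:R < qnorm (z n)) ->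
  {family compact, (fun n => k (z n)) @ \oo --> (cst 0 : quat R -> quat R)}.
Proof.
move=> zn; apply/fam_cvgP => K cK P /uniform_nbhs[E [entE EP]].
have [/= e e0 eE] : exists2 e : R, 0 < e & forall a b : quat R,
    `|a - b| < e -> E (a, b).
  move: entE; rewrite -entourage_ballE => -[e /= e0 eE].
  exists e => // a b ab; apply: eE; rewrite /= -ball_normE.
  exact: ab.
have [B [_ BK]] := compact_bounded cK.
have {}BK w : K w -> qnorm w <= 2 * (`|B| + 1).
  move=> Kw; apply: (le_trans (qnorm_le_norm w)); rewrite ler_pM2l//.
  by apply: BK => //; rewrite (le_lt_trans (ler_norm B))// ltrDl.
pose C := alpha * (2 * (`|B| + 1)) ^+ 2.
have zC n w : K w -> qnorm (k (z n) w) <= 2 * expR (C - alpha / 4 * n%:R).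
  move=> Kw; apply: (le_trans (kernel_decay alpha_gt0 (z n) w)).
  rewrite ler_pM2l// ler_expR; apply: lerB.
    rewrite /C ler_pM2l// lerXn2r ?nnegrE ?qnorm_ge0 ?mulr_ge0 ?addr_ge0//.
    exact: BK.
  rewrite ler_pM2l ?divr_gt0//.
  have [->|n0] := eqVneq n 0%N; first exact: sqr_ge0.
  have n1 : 1 <= n%:R :> R by rewrite ler1n lt0n.
  have nz := zn n; rewrite expr2.
  by apply: (@le_trans _ _ (n%:R * n%:R)); [rewrite ler_peMl|rewrite ler_pM// ltW].
have [n0 n0P] : exists n0 : nat, forall n, (n0 <= n)%N ->
    2 * expR (C - alpha / 4 * n%:R) < e.
  (* The solution of 2 exp(C - alpha / 4 X) = e. *)
  pose X := (C - ln (e / 2)) / (alpha / 4).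
  exists (Num.truncn X).+1 => n Xn.
  rewrite [ltLHS]mulrC -ltr_pdivlMr// -[ltRHS]lnK ?posrE ?divr_gt0// ltr_expR.
  rewrite ltrBlDr -ltrBlDl [ltRHS]mulrC -ltr_pdivrMr ?divr_gt0//.
  by apply: (lt_le_trans (truncnS_gt X)); rewrite ler_nat.
exists n0 => // n /= nn; apply: EP => w Kw; apply: eE.
rewrite /cst sub0r normrN (le_lt_trans (norm_le_qnorm _))//.
exact: le_lt_trans (zC n w Kw) (n0P n nn).
Qed.

(** Condition (a) speaks of sequences and the limit is along a filter: if it fails, there are z_n
    with |z_n| > n whose integrals stay above e, and their kernels contradict (a). *)
Lemma vanishing_kint (I : quat R) : vanishing_Fock_Carleson alpha p mu ->
  kint z @[z --> slice_infty I] --> 0%E.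
Proof.
move=> van; have FF := slice_infty_proper I; apply/cvge0P; first exact: kint_ge0.
move=> e e0; apply: contrapT => nope.
have /choice[z zP] : forall n : nat, exists z,
    n%:R < qnorm z /\ ~ (kint z < e%:E)%E.
  move=> n; apply: contrapT => none; apply: nope.
  apply/slice_infty_nearP; exists n%:R => z _ nz.
  by apply: contrapT => ze; apply: none; exists z.
have [M MP] := kernel_Fock_bounded alpha_gt0 p_gt0.
have : (fun n => kint (z n)) @ \oo --> 0%E.
  apply: van => [n||].
  - exact: (MP (z n)).1.
  - by exists M => n; exact: (MP (z n)).2.
  - by apply: kernel_cvg0 => n; exact: (zP n).1.
move/cvge0P => /(_ (fun n => kint_ge0 (z n)) e e0) [n _ /(_ n (leqnn n))].
exact: (zP n).2.
Qed.

(** One of A and B is at least s, which settles the inequality for every exponent. *)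
Lemma powRD_ge (A B s : R) : 0 <= A -> 0 <= B -> 0 < s ->
  s ^+ 2 * 2 <= A ^+ 2 + B ^+ 2 -> s `^ p <= A `^ p + B `^ p.
Proof.
move=> A0 B0 s0 AB; have [sA|As] := leP s A.
  apply: (@le_trans _ _ (A `^ p)); last by rewrite lerDl powR_ge0.
  by apply: ge0_ler_powR; rewrite ?nnegrE ?(ltW p_gt0)// ltW.
apply: (@le_trans _ _ (B `^ p)); last by rewrite lerDr powR_ge0.
apply: ge0_ler_powR; rewrite ?nnegrE ?(ltW p_gt0) ?(ltW s0)//.
rewrite -(@ler_pXn2r _ 2) ?nnegrE ?(ltW s0)//.
have : A ^+ 2 <= s ^+ 2 by rewrite lerXn2r ?nnegrE ?(ltW s0)// ltW.
by lra.
Qed.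

Lemma measurable_kint z :
  measurable_fun setT (fun w => (weighted alpha (k z) w `^ p)%:E).
Proof.
apply/measurable_EFinP; apply: measurable_weighted_powR.
exact: normalized_kernel_regular.
Qed.

Lemma box_le_kint (r : R) : 0 < r ->
  exists2 d : R, 0 < d & forall z,
    (d%:E * mu (symmetric_box z r) <= kint z + kint (qconj z))%E.
Proof.
(* Chosen so that 2 s^2 = e^{- alpha r^2}, the lower bound on the box for the sum of the two squared
   weighted values. *)
move=> r0; pose s := Num.sqrt (expR (- alpha * r ^+ 2) / 2).
have s0 : 0 < s by rewrite sqrtr_gt0 divr_gt0// expR_gt0.
exists (s `^ p); first exact: powR_gt0.
move=> z; have mS := measurable_symmetric_box z r0.
rewrite -integral_cst// /kint -ge0_integralD//; first last.
- exact: measurable_kint.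
- by move=> w _; rewrite lee_fin powR_ge0.
- exact: measurable_kint.
- by move=> w _; rewrite lee_fin powR_ge0.
have mD : measurable_fun setT (fun w => (weighted alpha (k z) w `^ p)%:E +
    (weighted alpha (k (qconj z)) w `^ p)%:E)%E.
  by apply: emeasurable_funD; exact: measurable_kint.
apply: (@le_trans _ _ (\int[mu]_(w in symmetric_box z r)
    ((weighted alpha (k z) w `^ p)%:E +
     (weighted alpha (k (qconj z)) w `^ p)%:E))%E); last first.
  apply: ge0_subset_integral => // w _.
  by rewrite adde_ge0// lee_fin powR_ge0.
apply: ge0_le_integral => //.
- by move=> w _; rewrite lee_fin powR_ge0.
- exact: measurable_funTS.
move=> w; rewrite symmetric_boxE// => wz.
rewrite -EFinD lee_fin.
have [J SJ zE] := exists_slice z; have [I SI wE] := exists_slice w.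
have := weighted_kernel_conj alpha w.1 (enorm w.2) z.1 (enorm z.2) SI SJ.
rewrite -qconj_qpt// -wE -zE.
move=> AB; apply: powRD_ge (weighted_ge0 _ _ _) (weighted_ge0 _ _ _) s0 _.
rewrite [leRHS]AB sqr_sqrtr ?divr_ge0 ?expR_ge0// divfK//.
apply: (@le_trans _ _ (expR (- alpha *
  ((w.1 - z.1) ^+ 2 + (enorm w.2 - enorm z.2) ^+ 2)))).
  by rewrite ler_expR !mulNr lerN2 ler_pM2l// ltW.
by rewrite lerDl expR_ge0.
Qed.

(** The conjugate of z lies in the same slice and has the same norm, so both integrals are small
    together. *)
Lemma kint_boxes (r : R) (I : quat R) : 0 < r -> qsphere R I ->
  kint z @[z --> slice_infty I] --> 0%E ->
  mu (symmetric_box z r) @[z --> slice_infty I] --> 0%E.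
Proof.
move=> r0 SI; have FF := slice_infty_proper I.
move=> /cvge0P => /(_ kint_ge0) kI; apply/cvge0P => // e e0.
have [d d0 dP] := box_le_kint r0.
have ed : 0 < e * d / 2 by rewrite divr_gt0// mulr_gt0.
have /slice_infty_nearP[M MP] := kI _ ed.
apply/slice_infty_nearP; exists M => z Iz Mz.
have Iz' : qslice I (qconj z).
  by case: Iz => a [b ->]; exists a, (- b); rewrite qconj_qpt.
have Mz' : M < qnorm (qconj z).
  rewrite (_ : qnorm _ = qnorm z)//; apply/eqP.
  rewrite -(@eqrXn2 _ 2) ?qnorm_ge0// !qnorm_sqr !enorm_sqr /=.
  by rewrite !sqrrN.
have := lteD (MP z Iz Mz) (MP _ Iz' Mz').
rewrite -EFinD -splitr => zed.
have := le_lt_trans (dP z) zed.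
by rewrite mulrC EFinM lte_pmul2l.
Qed.

End carleson_to_boxes.

(** * Tonelli for a measure proved to be sigma-finite *)

Section sigma_finite_left.
Context d1 d2 (T1 : measurableType d1) (T2 : measurableType d2) (R : realType).
Context (m1 : {measure set T1 -> \bar R})
  (m2 : {sigma_finite_measure set T2 -> \bar R}) (f : T1 * T2 -> \bar R).
Hypotheses (m1_fin : sigma_finite setT m1) (mf : measurable_fun setT f)
  (f0 : forall t, (0 <= f t)%E).

(** Sigma-finiteness of the first measure is a proposition here; packing it into a structure makes
    the Tonelli lemmas applicable. *)
Let sfinite := isSFinite.Build _ _ _ _ (sfinite_measure_sigma_finite m1_fin).
Let sigmaf := isSigmaFinite.Build _ _ _ _ m1_fin.
Let m := HB.pack_for (SigmaFiniteMeasure.type T1 R) (Measure.sort m1)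
  sfinite sigmaf.

Lemma sigma_finite_tonelli :
  (\int[m1]_x \int[m2]_y f (x, y) = \int[m2]_y \int[m1]_x f (x, y))%E.
Proof. exact: (@fubini_tonelli _ _ _ _ _ m m2 f mf f0). Qed.

Lemma sigma_finite_measurable_integral :
  measurable_fun setT (fun y => \int[m1]_x f (x, y))%E.
Proof. exact: (@measurable_fun_fubini_tonelli_G _ _ _ _ _ m f mf f0). Qed.

End sigma_finite_left.

(** * From (c) to (a): the integral far from the origin *)

Section boxes_to_carleson.
Context {R : realType} (alpha p r : R) (mu : {measure set (quat R) -> \bar R}).
Hypotheses (alpha_gt0 : 0 < alpha) (p_gt0 : 0 < p) (r_gt0 : 0 < r).
Hypothesis mu_locfin : finite_on_compacts mu.
Local Notation R3 :=
  (measurableTypeR R * measurableTypeR R * measurableTypeR R)%type.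

Definition qball (L : R) : set (quat R) := [set w | qnorm w <= L].

(** A product of segments, hence compact by construction; Euclidean balls inherit finite mass from
    it. *)
Definition qcube (L : R) : set (quat R) :=
  `[- L, L]%classic `*` ((`[- L, L]%classic `*` `[- L, L]%classic) `*`
    `[- L, L]%classic).

Lemma compact_qcube L : compact (qcube L).
Proof.
by apply: compact_setX; [|apply: compact_setX; [apply: compact_setX|]];
  exact: segment_compact.
Qed.

Lemma measurable_qcube L : measurable (qcube L).
Proof.
have mI : measurable (`[- L, L]%classic : set (measurableTypeR R)).
  exact: measurable_itv.
by apply: measurableX => //; apply: measurableX => //; exact: measurableX.
Qed.

Lemma measurable_qball L : measurable (qball L).
Proof.
rewrite (_ : qball L = setT `&` @qnorm R @^-1` `]-oo, L]%classic).
  by apply: measurable_qnorm => //; exact: measurable_itv.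
by rewrite setTI; apply/seteqP; split => w /=; rewrite in_itv.
Qed.

Lemma qball_qcube L : qball L `<=` qcube L.
Proof.
move=> w /= wL; have := le_trans (norm_le_qnorm w) wL; rewrite quat_normE.
rewrite !ge_max => /andP[h1 /andP[/andP[h2 h3] h4]].
by split; [|split; [split|]]; rewrite /= in_itv/= -ler_norml.
Qed.

Lemma mu_qball_lty L : (mu (qball L) < +oo)%E.
Proof.
apply: (@le_lt_trans _ _ (mu (qcube L))); last exact/mu_locfin/compact_qcube.
apply: le_measure; rewrite ?inE; [exact: measurable_qball|
  exact: measurable_qcube|exact: qball_qcube].
Qed.

Lemma mu_sigma_finite : sigma_finite setT mu.
Proof.
exists (fun n => qball n%:R).
  apply/seteqP; split => w _ //.
  by exists (Num.truncn (qnorm w)).+1 => //; rewrite /qball/= ltW// truncnS_gt.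
by move=> n; split; [exact: measurable_qball|exact: mu_qball_lty].
Qed.

(** A square of half side r / 2 fits in a disk of radius r, since 2 (r / 2)^2 < r^2. *)
Let rho := r / 2.
Let rho_gt0 : 0 < rho. Proof. by rewrite divr_gt0. Qed.

(** The domain of the double integral: at fixed far w its section is a half square, at fixed t it
    lies in a symmetric box. *)
Let near_diag (L : R) : set (quat R * (measurableTypeR R * measurableTypeR R)) :=
  [set x | [/\ L < qnorm x.1, `|x.2.1 - x.1.1| < rho,
    `|x.2.2 - enorm x.1.2| < rho & 0 < x.2.2]].

Let measurable_near_diag L : measurable (near_diag L).
Proof.
have m1 := @measurable_fst _ _ (quat R)
  (measurableTypeR R * measurableTypeR R)%type.
have m2 := @measurable_snd _ _ (quat R)
  (measurableTypeR R * measurableTypeR R)%type.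
have m21 := measurableT_comp measurable_fst m2.
have m22 := measurableT_comp measurable_snd m2.
have mp := measurableT_comp (@measurable_plane R) m1.
have mp1 := measurableT_comp measurable_fst mp.
have mp2 := measurableT_comp measurable_snd mp.
have mq := measurableT_comp (@measurable_qnorm R) m1.
have md1 : measurable_fun setT
    (fun x : quat R * (measurableTypeR R * measurableTypeR R) => `|x.2.1 - x.1.1|).
  exact: (measurableT_comp (@normr_measurable R setT) (measurable_funB m21 mp1)).
have md2 : measurable_fun setT
    (fun x : quat R * (measurableTypeR R * measurableTypeR R) =>
      `|x.2.2 - enorm x.1.2|).
  exact: (measurableT_comp (@normr_measurable R setT) (measurable_funB m22 mp2)).
have gtS (g : quat R * (measurableTypeR R * measurableTypeR R) -> R) c :
    measurable_fun setT g -> measurable [set x | c < g x].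
  move=> mg; rewrite (_ : [set x | _] = setT `&` g @^-1` `]c, +oo[%classic).
    by apply: mg => //; exact: measurable_itv.
  by rewrite setTI; apply/seteqP; split => x /=; rewrite in_itv/= andbT.
have ltS (g : quat R * (measurableTypeR R * measurableTypeR R) -> R) c :
    measurable_fun setT g -> measurable [set x | g x < c].
  move=> mg; rewrite (_ : [set x | _] = setT `&` g @^-1` `]-oo, c[%classic).
    by apply: mg => //; exact: measurable_itv.
  by rewrite setTI; apply/seteqP; split => x /=; rewrite in_itv.
rewrite (_ : near_diag L = [set x | L < qnorm x.1] `&`
  ([set x | `|x.2.1 - x.1.1| < rho] `&`
  ([set x | `|x.2.2 - enorm x.1.2| < rho] `&` [set x | 0 < x.2.2]))).
  by apply: measurableI; [exact: gtS|apply: measurableI; [exact: ltS|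
    apply: measurableI; [exact: ltS|exact: gtS]]].
by apply/seteqP; split => x /=; [case|move=> [? [? []]]].
Qed.

(** If |t| <= |M0|, any w in the section has both plane coordinates of size at most |M0| + rho, so
    |w| <= L, which is excluded. A nonempty section therefore has t far out, where the box is
    small. *)
Let near_diag_small (I : quat R) (M0 d : R) : qsphere R I -> 0 < d ->
  (forall z, qslice I z -> M0 < qnorm z -> (mu (symmetric_box z r) < d%:E)%E) ->
  let L := 2 * (`|M0| + rho) in
  forall t, (mu (ysection (near_diag L) t) <= d%:E)%E.
Proof.
move=> SI d0 M0P L t; have mY := measurable_ysection t (measurable_near_diag L).
have [->|/set0P[w]] := eqVneq (ysection (near_diag L) t) set0.
  by rewrite measure0 lee_fin ltW.
rewrite /ysection/= inE => -[/= wL t1 t2 t0].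
apply: (@le_trans _ _ (mu (symmetric_box (qpt t.1 t.2 I) r))); last first.
  apply/ltW/M0P; first by exists t.1, t.2.
  rewrite ltNge; apply/negP => zM; move: wL; apply/negP; rewrite -leNgt.
  have qz := qnorm_qpt t.1 t.2 SI.
  have M00 : 0 <= `|M0| + rho by rewrite addr_ge0// ltW.
  have {}zM : qnorm (qpt t.1 t.2 I) <= `|M0| by rewrite (le_trans zM)// ler_norm.
  have {}zM : t.1 ^+ 2 + t.2 ^+ 2 <= `|M0| ^+ 2.
    by rewrite -qz lerXn2r ?nnegrE ?qnorm_ge0.
  have sq (x : R) : x ^+ 2 <= `|M0| ^+ 2 -> `|x| <= `|M0|.
    by move=> h; rewrite -(@ler_pXn2r _ 2) ?nnegrE// real_normK ?num_real.
  have s1 := sqr_ge0 t.1; have s2 := sqr_ge0 t.2.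
  have n1 : `|t.1| <= `|M0| by apply: sq; lra.
  have n2 : `|t.2| <= `|M0| by apply: sq; lra.
  have sum (x y : R) : `|x| <= `|M0| -> `|x - y| < rho ->
      y ^+ 2 <= (`|M0| + rho) ^+ 2.
    move=> xM xy; rewrite -(real_normK (num_real y)) lerXn2r ?nnegrE//.
    have := ler_distD x y 0; rewrite !subr0 distrC; lra.
  have e1 := sum _ _ n1 t1; have e2 := sum _ _ n2 t2.
  rewrite -(@ler_pXn2r _ 2) ?nnegrE ?qnorm_ge0 ?mulr_ge0// qnorm_sqr exprMn.
  have := sqr_ge0 (`|M0| + rho); rewrite (_ : 2 ^+ 2 = 4 :> R); last by ring.
  by lra.
apply: le_measure; rewrite ?inE//; first exact: measurable_symmetric_box.
move=> w' /=; rewrite inE => -[/= _ t1' t2' _].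
rewrite symmetric_boxE// /mkset qpt_re// qpt_im// gtr0_norm//.
move: t1' t2'; rewrite !ltr_norml => /andP[a1 a2] /andP[b1 b2].
have q1 : (w'.1 - t.1) ^+ 2 <= rho ^+ 2 by rewrite !expr2; nra.
have q2 : (enorm w'.2 - t.2) ^+ 2 <= rho ^+ 2 by rewrite !expr2; nra.
have := exprn_gt0 2 r_gt0; rewrite /rho expr_div_n in q1 q2 *.
by rewrite (_ : 2 ^+ 2 = 4 :> R) in q1 q2; [lra|ring].
Qed.

(* The sub-mean-value inequality bounds the integrand at w by an integral over
   the plane point t near (w.1, enorm w.2); exchanging the order of integration,
   t receives the mu-mass of a set contained in the symmetric box at t. *)
Lemma tail_integral_le (I : quat R) (C k M0 d B : R) (f : quat R -> quat R) :
  qsphere R I -> 0 < d -> 0 < C -> 0 < k -> 0 <= B ->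
  (forall z, qslice I z -> M0 < qnorm z -> (mu (symmetric_box z r) < d%:E)%E) ->
  (forall N, holo_norm N -> forall u v, 0 <= v ->
    (((N (u, v) * gaussw alpha (u, v)) `^ p)%:E <= C%:E *
      \int[leb2]_(t in half_square rho (u, v))
        ((N t * gaussw alpha t) `^ p)%:E)%E) ->
  (forall c, (k%:E <= sphere_measure (hemisphere c))%E) ->
  slice_regular f ->
  (\int[slice_volume]_z (weighted alpha f z `^ p)%:E <= B%:E)%E ->
  (\int[mu]_(w in ~` qball (2 * (`|M0| + rho)))
    (weighted alpha f w `^ p)%:E <= (2 `^ p * C * (d * (B / k)))%:E)%E.
Proof.
move=> SI d0 C0 k0 B0 M0P CP kP fr fB; set L := 2 * (`|M0| + rho).
have [N [hN Nup Nlow]] := weighted_holo_norm alpha fr.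
have [N0 cN _ _] := hN.
pose H t := N t * gaussw alpha t.
have H0 t : 0 <= H t by rewrite mulr_ge0// expR_ge0.
have cH : continuous H.
  by move=> t; apply: cvgM; [exact: cN|exact: continuous_gaussw].
have mHp : measurable_fun setT
    (fun t : measurableTypeR R * measurableTypeR R => H t `^ p).
  apply: (measurableT_comp (measurable_powR p)); exact: continuous_measurable2.
have mEHp : measurable_fun setT
    (fun t : measurableTypeR R * measurableTypeR R => (H t `^ p)%:E).
  exact/measurable_EFinP.
have mU := @measurable_upper_half R.
have HB : (\int[leb2]_(t in upper_half) (H t `^ p)%:E <= (B / k)%:E)%E.
  rewrite mulrC EFinM lee_pdivlMl//; apply: le_trans fB.
  apply: (slice_volume_integral_ge k0 kP) => //.
  - exact: measurable_weighted_powR.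
  - by move=> q; exact: powR_ge0.
  - by move=> t; exact: powR_ge0.
  move=> x y; have [c cP] := Nlow x y; exists c => I' hI'.
  by apply: ge0_ler_powR; rewrite ?nnegrE ?(ltW p_gt0) ?weighted_ge0//; exact: cP.
pose F (x : quat R * (measurableTypeR R * measurableTypeR R)) : \bar R :=
  ((\1_(near_diag L) x)%:E * (H x.2 `^ p)%:E)%E.
have F0 x : (0 <= F x)%E by rewrite mule_ge0// lee_fin ?powR_ge0.
have m2 := @measurable_snd _ _ (quat R)
  (measurableTypeR R * measurableTypeR R)%type.
have mF : measurable_fun setT F.
  apply: emeasurable_funM; last exact: (measurableT_comp mEHp m2).
  by apply/measurable_EFinP/measurable_indic.
have sfm := mu_sigma_finite.
have mA := measurableC (measurable_qball L).
have c0 : 0 <= 2 `^ p * C by rewrite mulr_ge0 ?powR_ge0 ?ltW.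
have mG : measurable_fun setT (fun w => \int[leb2]_t F (w, t))%E.
  exact: (@measurable_fun_fubini_tonelli_F _ _ _ _ _ leb2 F mF F0).
apply: (@le_trans _ _ (\int[mu]_w ((2 `^ p * C)%:E * \int[leb2]_t F (w, t)))%E).
  apply: (@le_trans _ _ (\int[mu]_(w in ~` qball L)
      ((2 `^ p * C)%:E * \int[leb2]_t F (w, t)))%E); last first.
    apply: ge0_subset_integral => //; first exact: measurable_funeM.
    move=> w _; apply: mule_ge0; first by rewrite lee_fin.
    by apply: integral_ge0 => t _; exact: F0.
  apply: ge0_le_integral => //.
  - by move=> w _; rewrite lee_fin powR_ge0.
  - apply: measurable_funTS; apply/measurable_EFinP.
    exact: measurable_weighted_powR.
  - by apply: measurable_funTS; exact: measurable_funeM.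
  move=> w /negP; rewrite -ltNge => wL.
  have -> : (\int[leb2]_t F (w, t) =
      \int[leb2]_(t in half_square rho (w.1, enorm w.2)) (H t `^ p)%:E)%E.
    rewrite [RHS]integral_mkcond; apply: eq_integral => t _.
    rewrite /F /= patchE indicE; case: ifPn => tS.
      by rewrite mem_set ?mul1e//; move: tS; rewrite inE => -[].
    rewrite memNset ?mul0e// => -[_ /= h1 h2 h3]; move: tS.
    by rewrite notin_setE; apply.
  rewrite EFinM -muleA; apply: (@le_trans _ _
      ((2 `^ p)%:E * (H (w.1, enorm w.2) `^ p)%:E)%E); last first.
    apply: lee_wpmul2l; first by rewrite lee_fin powR_ge0.
    by apply: CP => //; exact: enorm_ge0.
  rewrite -EFinM -powRM//; rewrite lee_fin.
  have [J SJ wE] := exists_slice w.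
  apply: ge0_ler_powR; rewrite ?nnegrE ?(ltW p_gt0) ?weighted_ge0 ?mulr_ge0//.
  exact: expR_ge0.
  by have := Nup w.1 (enorm w.2) J SJ; rewrite -wE.
rewrite ge0_integralZl//; last by move=> w _; apply: integral_ge0 => t _; exact: F0.
rewrite [leRHS]EFinM; apply: lee_wpmul2l; first by rewrite lee_fin.
rewrite sigma_finite_tonelli// [leRHS]EFinM.
apply: (@le_trans _ _ (d%:E * \int[leb2]_(t in upper_half) (H t `^ p)%:E)%E);
  last by apply: lee_wpmul2l => //; rewrite lee_fin ltW.
rewrite -ge0_integralZl//; last 3 first.
- exact: measurable_funTS.
- by move=> t _; rewrite lee_fin powR_ge0.
- by rewrite lee_fin ltW.
have FE t : (\int[mu]_w F (w, t) =
    mu (ysection (near_diag L) t) * (H t `^ p)%:E)%E.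
  have mY := measurable_ysection t (measurable_near_diag L).
  have YE : (fun w => \1_(near_diag L) (w, t)) =
      \1_(ysection (near_diag L) t) :> (_ -> R).
    by apply/funext => w; rewrite !indicE mem_ysection.
  have mI : measurable_fun setT (fun w => (\1_(near_diag L) (w, t) : R)%:E).
    by apply/measurable_EFinP; rewrite YE; exact: measurable_indic.
  rewrite /F/= (ge0_integralZr _ _ mI)//; last by rewrite lee_fin powR_ge0.
  congr (_ * _)%E.
  rewrite -[in RHS](setIT (ysection _ _)) -integral_indic//.
  by apply: eq_integral => w _; rewrite -[in RHS]YE.
have mdH : measurable_fun upper_half (fun t => d%:E * (H t `^ p)%:E)%E.
  by apply: measurable_funTS; exact: measurable_funeM.
rewrite [leRHS]integral_mkcond; apply: ge0_le_integral => //.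
- by move=> t _; apply: integral_ge0 => w _; exact: F0.
- exact: (@sigma_finite_measurable_integral _ _ _ _ _ mu F sfm mF F0).
- exact: ((measurable_restrictT _ mU).1 mdH).
(* Outside the upper half plane the section is empty, so the integral over t reduces to the half
   plane, where [HB] applies. *)
move=> t _; rewrite FE patchE; case: ifPn => tU.
  apply: lee_wpmul2r; first by rewrite lee_fin powR_ge0.
  exact: near_diag_small M0P _.
rewrite (_ : ysection _ _ = set0) ?measure0 ?mul0e//.
rewrite -subset0 => w; rewrite /ysection/= inE => -[_ _ _ /= t0].
by move: tU; rewrite notin_setE; exact.
Qed.

End boxes_to_carleson.

(** * From (c) to (a): the remaining ball and the conclusion *)

Section final.
Context {R : realType} (alpha p r : R) (mu : {measure set (quat R) -> \bar R}).
Hypotheses (alpha_gt0 : 0 < alpha) (p_gt0 : 0 < p) (r_gt0 : 0 < r).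
Hypothesis mu_locfin : finite_on_compacts mu.
Local Notation rho := (r / 2).

(** The Gaussian weight is at most 1 and the ball has finite mass, so uniform convergence on the
    surrounding cube is enough. *)
Lemma compact_integral_cvg0 (L : R) (f : nat -> quat R -> quat R) :
  (forall n, slice_regular (f n)) ->
  {family compact, f @ \oo --> (cst 0 : quat R -> quat R)} ->
  (fun n => \int[mu]_(w in qball L) (weighted alpha (f n) w `^ p)%:E)%E
    @ \oo --> 0%E.
Proof.
move=> fr fcvg; apply/cvge0P => [n|e e0].
  by apply: integral_ge0 => w _; rewrite lee_fin powR_ge0.
have [m mE] : exists m : R, mu (qball L) = m%:E.
  exists (fine (mu (qball L))); rewrite fineK// ge0_fin_numE//.
  exact: mu_qball_lty.
have m0 : 0 <= m by rewrite -lee_fin -mE.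
(* The final division by 2 pays for [qnorm_le_norm], as convergence is in the sup norm; [m + 1]
   avoids dividing by a zero mass. *)
pose s := (e / (m + 1)) `^ p^-1 / 2.
have e1 : 0 < e / (m + 1) by rewrite divr_gt0// ltr_wpDl.
have s0 : 0 < s by rewrite divr_gt0// powR_gt0.
have /fam_cvgP/(_ _ (@compact_qcube R L)) fL := fcvg.
have near_s : \forall n \near \oo, forall w, qcube L w -> `|f n w| < s.
  pose V : set (quat R -> quat R) := [set g | forall w, qcube L w -> `|g w| < s].
  apply: (fL V); apply/uniform_nbhs; exists [set ab | `|ab.1 - ab.2| < s]; split.
    rewrite -entourage_ballE; exists s => // -[a b] /=.
    by rewrite -ball_normE.
  by move=> g gE w Lw; have := gE w Lw; rewrite /= /cst sub0r normrN.
apply: filterS near_s => n ns; apply: (@le_lt_trans _ _ ((e / (m + 1) * m)%:E)).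
  rewrite [leRHS]EFinM -mE -integral_cst//; last exact: measurable_qball.
  apply: ge0_le_integral => //.
  - exact: measurable_qball.
  - by move=> w _; rewrite lee_fin powR_ge0.
  - apply: measurable_funTS; apply/measurable_EFinP.
    exact: measurable_weighted_powR.
  move=> w /qball_qcube Lw; rewrite lee_fin.
  have -> : e / (m + 1) = (2 * s) `^ p.
    have -> : 2 * s = (e / (m + 1)) `^ p^-1 by rewrite /s mulrC divfK.
    by rewrite -powRrM mulVf ?gt_eqF// powRr1// ltW.
  apply: ge0_ler_powR; rewrite ?nnegrE ?(ltW p_gt0) ?weighted_ge0 ?mulr_ge0 ?powR_ge0//.
  rewrite weightedE; apply: (@le_trans _ _ (qnorm (f n w))).
    rewrite ler_piMl ?qnorm_ge0// -expR0 ler_expR mulNr oppr_le0.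
    by rewrite mulr_ge0 ?sqr_ge0// divr_ge0// ltW.
  apply: (le_trans (qnorm_le_norm _)); rewrite ler_pM2l// ltW//; exact: ns.
by rewrite lte_fin mulrAC ltr_pdivrMr ?ltr_wpDl// ltr_pM2l// ltrDl.
Qed.

Lemma boxes_vanishing (I : quat R) : qsphere R I ->
  mu (symmetric_box z r) @[z --> slice_infty I] --> 0%E ->
  vanishing_Fock_Carleson alpha p mu.
Proof.
move=> SI; have FF := slice_infty_proper I.
move=> /cvge0P => /(_ (fun z => measure_ge0 mu _)) boxes f Ff [M fM] fcvg.
have fr n : slice_regular (f n) by case: (Ff n).
have rho_gt0 : 0 < rho by rewrite divr_gt0.
have [C C0 CP] := submean alpha_gt0 p_gt0 rho_gt0.
have [k k0 kP] := @hemisphere_measure_ge R.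
pose B := `|M| `^ p / (p * alpha / pi).
have c0 : 0 < p * alpha / pi by rewrite divr_gt0 ?mulr_gt0 ?pi_gt0.
have B0 : 0 <= B by apply: divr_ge0 (powR_ge0 _ _) (ltW c0).
apply/cvge0P => [n|e e0].
  by apply: integral_ge0 => w _; rewrite lee_fin powR_ge0.
pose A := 2 `^ p * C * (B / k).
have A0 : 0 <= A.
  by apply: mulr_ge0 (mulr_ge0 (powR_ge0 _ _) (ltW C0)) (divr_ge0 B0 (ltW k0)).
have e2 : 0 < e / 2 by rewrite divr_gt0.
(* [A] depends on alpha, p, r and the norm bound [M] only, so [d], and with it [L], is fixed before
   n. *)
pose d := e / 2 / (A + 1).
have d0 : 0 < d by rewrite divr_gt0// ltr_wpDl.
have /slice_infty_nearP[M0 M0P] := boxes _ d0.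
set L := 2 * (`|M0| + rho).
have inside : \forall n \near \oo,
    (\int[mu]_(w in qball L) (weighted alpha (f n) w `^ p)%:E < (e / 2)%:E)%E.
  have /cvge0P := compact_integral_cvg0 L fr fcvg; apply => // n.
  by apply: integral_ge0 => w _; rewrite lee_fin powR_ge0.
apply: filterS inside => n inside.
have outside := tail_integral_le p_gt0 r_gt0 mu_locfin SI d0 C0 k0 B0
  M0P CP kP (fr n) (Fock_norm_le alpha_gt0 p_gt0 (fM n)).
have mL := measurable_qball L.
rewrite -(setUv (qball L)) (ge0_integral_setU mu mL (measurableC mL))//; first last.
- by rewrite disj_set2E setICr eqxx.
- by move=> w _; rewrite lee_fin powR_ge0.
- apply: measurable_funTS; apply/measurable_EFinP.
  exact: measurable_weighted_powR.
rewrite [X in (_ < X%:E)%E](splitr e) EFinD.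
apply: lteD => //; apply: (le_lt_trans outside); rewrite lte_fin.
rewrite (_ : _ * (d * _) = d * A); last by rewrite /A; ring.
by rewrite mulrAC ltr_pdivrMr ?ltr_wpDl// ltr_pM2l// ltrDl.
Qed.

End final.

Unset Implicit Arguments.
Set Strict Implicit.
Set Printing Implicit Defensive.

Theorem theorem3p7 (R : realType) (alpha p r : R)
    (mu : {measure set (quat R) -> \bar R})
    (alpha_gt0 : 0 < alpha) (p_gt0 : 0 < p) (r_gt0 : 0 < r)
    (mu_locfin : finite_on_compacts mu)
    (mu1_Radon : Radon_on (~` qreal R) mu) :
  let a := vanishing_Fock_Carleson alpha p mu in
  let b := forall I, qsphere R I ->
    (\int[mu]_w (weighted alpha (normalized_kernel alpha z) w `^ p)%:E)%E
      @[z --> slice_infty I] --> 0%E in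
  let c := forall I, qsphere R I ->
    mu (symmetric_box z r) @[z --> slice_infty I] --> 0%E in
  (a <-> b) /\ (b <-> c).
Proof.
have ab : vanishing_Fock_Carleson alpha p mu -> forall I, qsphere R I ->
    kint alpha p mu z @[z --> slice_infty I] --> 0%E.
  by move=> van I _; exact: vanishing_kint.
have bc : (forall I, qsphere R I ->
      kint alpha p mu z @[z --> slice_infty I] --> 0%E) ->
    forall I, qsphere R I ->
      mu (symmetric_box z r) @[z --> slice_infty I] --> 0%E.
  by move=> b I SI; apply: kint_boxes (b I SI).
have ca : (forall I, qsphere R I ->
      mu (symmetric_box z r) @[z --> slice_infty I] --> 0%E) ->
    vanishing_Fock_Carleson alpha p mu.
  (* A box depends only on the plane coordinates of its center, so one slice gives the masses of all
     far boxes. *)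
  move=> c; have SI := @qsphere_qi R.
  exact: (boxes_vanishing alpha_gt0 p_gt0 r_gt0 mu_locfin SI (c _ SI)).
by move=> a b c; split; (split => [h|h]); [exact: ab|exact: ca (bc h)|exact: bc|
  exact: ab (ca h)].
Qed.
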